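(* Let $0<\alpha<1$. Then ${}^{\pm}H^{\alpha}(\mathbb{R})=\widetilde{H}^{\alpha}(\mathbb{R})$ (for each of the signs $-$ and $+$).
   Context: $\widetilde{H}^{\alpha}(\mathbb{R})=\{u\in L^2(\mathbb{R}): \int_{\mathbb{R}}\int_{\mathbb{R}}\frac{|u(x)-u(y)|^2}{|x-y|^{1+2\alpha}}dx\,dy<\infty\}$. For $0<\alpha<1$ and $\varphi\in C_0^\infty(\mathbb{R})$: ${}^{-}D^{\alpha}\varphi(x)=\frac{1}{\Gamma(1-\alpha)}\frac{d}{dx}\int_{-\infty}^x\frac{\varphi(y)}{(x-y)^{\alpha}}dy$ and ${}^{+}D^{\alpha}\varphi(x)=\frac{-1}{\Gamma(1-\alpha)}\frac{d}{dx}\int_x^{\infty}\frac{\varphi(y)}{(y-x)^{\alpha}}dy$. For $u\in L^1(\mathbb{R})$ (or, with the same identity, $u\in L^2(\mathbb{R})$), $v\in L^1_{loc}(\mathbb{R})$ is the left (resp. right) weak fractional derivative of $u$, $v={}^{-}\mathcal{D}^{\alpha}u$ (resp. ${}^{+}\mathcal{D}^{\alpha}u$), if $\int_{\mathbb{R}} v\varphi\,dx=\int_{\mathbb{R}} u\,{}^{+}D^{\alpha}\varphi\,dx$ (resp. with ${}^{-}D^{\alpha}\varphi$) for all $\varphi\in C_0^\infty(\mathbb{R})$. ${}^{\pm}H^{\alpha}(\mathbb{R})={}^{\pm}W^{\alpha,2}(\mathbb{R})=\{u\in L^2(\mathbb{R}): {}^{\pm}\mathcal{D}^{\alpha}u\in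 L^2(\mathbb{R})\}$. *)

(* Defs.v *)
From mathcomp Require Import all_boot all_order all_algebra.
From mathcomp Require Import all_classical all_reals all_analysis.

Set Implicit Arguments.
Unset Strict Implicit.
Unset Printing Implicit Defensive.

Import Order.TTheory GRing.Theory Num.Theory.
Import numFieldNormedType.Exports.

Local Open Scope classical_set_scope.
Local Open Scope ring_scope.

Section FractionalSobolev.
Context {R : realType}.
Local Notation mu := (@lebesgue_measure R).
Implicit Types (a s x : R) (u v phi : R -> R).

(* Euler's integral, meaningful for s > 0. *)
Definition Gamma s : R :=
  \int[mu]_(t in `]0, +oo[) (t `^ (s - 1) * expR (- t)).

Definition test_function phi : Prop :=
  (forall n x, derivable (phi^`(n))%classic x 1) /\ compact (closure [set x | phi x != 0]).

Definition left_fracD a phi : R -> R := fun x =>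
  (Gamma (1 - a))^-1 *
  (fun z : R => \int[mu]_(y in `]-oo, z[) (phi y / (z - y) `^ a))^`()%classic x.

Definition right_fracD a phi : R -> R := fun x =>
  - (Gamma (1 - a))^-1 *
  (fun z : R => \int[mu]_(y in `]z, +oo[) (phi y / (y - z) `^ a))^`()%classic x.

(* Tested against the fractional derivative of the opposite direction.  Both
   integrals converge absolutely when u is in L^1 or L^2. *)
Definition is_left_weak_fracD a u v : Prop :=
  locally_integrable [set: R] v /\
  forall phi, test_function phi ->
    (\int[mu]_x (v x * phi x)%:E = \int[mu]_x (u x * right_fracD a phi x)%:E)%E.

Definition is_right_weak_fracD a u v : Prop :=
  locally_integrable [set: R] v /\
  forall phi, test_function phi ->
    (\int[mu]_x (v x * phi x)%:E = \int[mu]_x (u x * left_fracD a phi x)%:E)%E.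

(* The spaces below are sets of (Borel) measurable representatives; each of
   them is invariant under equality almost everywhere. *)
Definition left_fracH a : set (R -> R) :=
  [set u | u \in Lfun mu 2%:E /\
           exists v, is_left_weak_fracD a u v /\ v \in Lfun mu 2%:E].

Definition right_fracH a : set (R -> R) :=
  [set u | u \in Lfun mu 2%:E /\
           exists v, is_right_weak_fracD a u v /\ v \in Lfun mu 2%:E].

(* On the diagonal, a null set, the integrand takes the value 0. *)
Definition gagliardoH a : set (R -> R) :=
  [set u | u \in Lfun mu 2%:E /\
    (\int[mu]_x \int[mu]_y
       (`|u x - u y| ^+ 2 / `|x - y| `^ (1 + 2 * a))%:E < +oo)%E].

End FractionalSobolev.

(* Main.v *)
(* Fix a direction s = 1 or s = -1.  On test functions the one-sided derivative
   is, up to the constant a / Gamma (1 - a), Marchaud's difference integral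
     M_s U x = \int_0^oo t^(-1-a) (U x - U (x - s t)) dt.
   Expand the square of the L^2 norm of M_s U as a double integral over t and z.
   By polarization the inner products of the increments of U are combinations of
   E t = \int (U x - U (x - t))^2 dx, and the substitution z -> t z turns the
   double integral into
     |M_s U|^2 = c * \int_0^oo t^(-1-2a) E t dt,   0 < c < oo,
   whose right-hand side is a multiple of the squared Gagliardo seminorm.
   If v is the weak derivative of u, then mollification r_n * v is the derivative
   of r_n * u, so this identity bounds the seminorms of r_n * u by |v|, and
   Fatou's lemma applies.  If the seminorm of u is finite, then r_n * u tends to
   u in L^2 and in the seminorm, so the derivatives of r_n * u are Cauchy in L^2;
   their limit is the weak derivative of u because M_s is adjoint to M_(-s). *)
Require Import Defs.
From mathcomp Require Import all_boot all_order all_algebra.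
From mathcomp Require Import all_classical all_reals all_analysis.
From mathcomp Require Import measurable_realfun.
From mathcomp Require Import ring lra.
Set Implicit Arguments.
Unset Strict Implicit.
Unset Printing Implicit Defensive.
Import Order.TTheory GRing.Theory Num.Theory.
Import numFieldNormedType.Exports.
Local Open Scope classical_set_scope.
Local Open Scope ring_scope.

(** * Affine changes of variable for Lebesgue measure *)

Section Affine.
Context {R : realType}.
Local Notation mu := (@lebesgue_measure R).

(** The textbook argument compares both seminorms with the integral of |xi|^(2a) |Fu|^2, F being the
    Fourier transform; here the comparison takes place on the real line itself. What makes it
    possible is polarization by differences: the difference of two increments of U is, up to a
    translation, again an increment, so every inner product is a combination of three energies. The
    energy is even in its argument, hence the constant c is the same for s = 1 and s = -1 and both
    directions are handled at once. The obstacle is that t^(-1-a) is not integrable at 0. Fubini and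
    the substitution are justified only when increments have size min(1, |t|), pointwise and in L^2;
    this is the class [nice], and the condition 0 < a < 1 is what makes t^(-1-a) min(1, t)
    integrable at both ends of the half-line. A general u in L^2 is not of this kind, so the
    identity reaches it only through limits. Cauchy-Schwarz is mostly used as the inequality 2xy <=
    l x^2 + y^2 / l, with l chosen to balance the two terms; this avoids square roots of extended
    reals. *)

Definition affine (c d : R) : measurableTypeR R -> measurableTypeR R :=
  fun x => c * x + d.

Lemma measurable_affine (c d : R) : measurable_fun setT (affine c d).
Proof. by apply: measurable_funD => //; exact: mulrl_measurable. Qed.

Lemma preimage_affine_oc (c d a b : R) : c != 0 ->
  mu ((fun x => c * x + d) @^-1` `]a, b]) = (`|c|^-1%:E * mu `]a, b])%E.
Proof.
move=> c0; case: (ltgtP c 0) (c0) => // [cn|cp] _.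
(* A negative slope exchanges the open and the closed end of the interval; the length does not
   notice. *)
- have -> : (fun x => c * x + d) @^-1` `]a, b] = `[(b - d) / c, (a - d) / c[%classic.
    apply/seteqP; split => x /=; rewrite !in_itv/= ler_ndivrMr// ltr_ndivlMr// => /andP[*]; apply/andP; split; lra.
  rewrite !lebesgue_measure_itv/= !lte_fin ltr_ndivlMr// divfK// ltrD2r.
  case: ifPn => ab; last by rewrite mule0.
  by rewrite !EFinN -!EFinB -EFinM ltr0_norm// invrN; congr (_%:E); field.
- have -> : (fun x => c * x + d) @^-1` `]a, b] = `](a - d) / c, (b - d) / c]%classic.
    apply/seteqP; split => x /=; rewrite !in_itv/= ler_pdivlMr// ltr_pdivrMr// => /andP[*]; apply/andP; split; lra.
  rewrite !lebesgue_measure_itv/= !lte_fin ltr_pdivlMr// divfK// ltrD2r.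
  case: ifPn => ab; last by rewrite mule0.
  by rewrite !EFinN -!EFinB -EFinM gtr0_norm//; congr (_%:E); field.
Qed.

Definition affine_measure (c d : R) : {measure set (measurableTypeR R) -> \bar R}.
Proof.
refine (mscale (NngNum (normr_ge0 c)) (pushforward mu (affine c d))).
exact: measurable_affine.
Defined.

(** Lebesgue measure is determined by its values on half-open intervals, and there the scaled
    pushforward has the right ones. *)
Lemma lebesgue_affine_measure (c d : R) (A : set R) : c != 0 -> measurable A ->
  mu A = affine_measure c d A.
Proof.
move=> c0 mA; apply: lebesgue_measure_unique => // _ [[a b]] _ <-.
transitivity (`|c|%:E * mu ((fun x => c * x + d)%R @^-1` `]a, b]))%E; last by [].
rewrite preimage_affine_oc// muleA -EFinM mulfV ?mul1e// normr_eq0//.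
Qed.

Lemma ge0_integral_affine (c d : R) (f : R -> \bar R) : c != 0 ->
  measurable_fun [set: R] f -> (forall x, 0 <= f x)%E ->
  (\int[mu]_x f (c * x + d)%R = `|c|^-1%:E * \int[mu]_x f x)%E.
Proof.
move=> c0 mf f0.
rewrite [in RHS](eq_measure_integral (affine_measure c d)); last first.
  by move=> A mA _; exact: lebesgue_affine_measure.
rewrite ge0_integral_mscale// ge0_integral_pushforward//=.
rewrite preimage_setT muleA -EFinM mulVf ?mul1e// ?normr_eq0//; exact: measurable_affine.
Unshelve. exact: measurable_affine.
Qed.

Lemma integral_affine (c d : R) (f : R -> \bar R) : c != 0 ->
  mu.-integrable [set: R] f ->
  (\int[mu]_x f (c * x + d)%R = `|c|^-1%:E * \int[mu]_x f x)%E.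
Proof.
move=> c0 fi; have mf := measurable_int _ fi.
rewrite [LHS]integralE [X in (_ * X)%E]integralE [RHS]muleBr//; last exact: integrable_add_def.
congr (_ - _)%E.
- rewrite -(ge0_integral_affine d (f := f^\+%E))//; last exact: measurable_funepos.
  by apply: eq_integral => x _; rewrite ?funeposE ?funenegE.
- rewrite -(ge0_integral_affine d (f := f^\-%E))//; last exact: measurable_funeneg.
  by apply: eq_integral => x _; rewrite ?funeposE ?funenegE.
Qed.

Lemma integrable_affine (c d : R) (f : R -> \bar R) : c != 0 ->
  mu.-integrable [set: R] f -> mu.-integrable [set: R] (fun x => f (c * x + d)%R).
Proof.
move=> c0 /integrableP[mf fi]; apply/integrableP; split.
  by apply: (measurableT_comp mf); exact: measurable_affine.
rewrite (ge0_integral_affine _ (f := fun x => `|f x|%E))//; last exact: measurableT_comp.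
by rewrite lte_mul_pinfty// lee_fin invr_ge0.
Qed.

End Affine.

Ltac nonneg := repeat first [done | exact: sqr_ge0 | apply: mulr_ge0 | apply: addr_ge0
  | rewrite invr_ge0 | apply: ltW; done].

(** * Fubini, squared L^2 norms, and Young's inequality *)

Section L2Estimates.
Context {R : realType}.
Local Notation mu := (@lebesgue_measure R).

Lemma measurable_integral2 (F : R * R -> \bar R) : measurable_fun setT F ->
  measurable_fun setT (fun x => \int[mu]_y F (x, y))%E.
Proof.
move=> mF.
rewrite (_ : (fun x => _) = (fun x => \int[mu]_y F^\+%E (x, y) - \int[mu]_y F^\-%E (x, y)))%E; last first.
  apply/funext => x; rewrite integralE.
  by congr (_ - _)%E; apply: eq_integral => y _; rewrite !(funeposE, funenegE).
apply: emeasurable_funB.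
  by apply: measurable_fun_fubini_tonelli_F => //; exact: measurable_funepos.
by apply: measurable_fun_fubini_tonelli_F => //; exact: measurable_funeneg.
Qed.

Lemma measurable_Rintegral2 (F : R -> R -> R) :
  measurable_fun setT (fun p : R * R => F p.1 p.2) ->
  measurable_fun setT (fun x => \int[mu]_y F x y).
Proof.
move=> mF; rewrite /Rintegral; apply: measurableT_comp; first exact: fine_measurable.
apply: (measurable_integral2 (F := fun p => (F p.1 p.2)%:E)).
exact/measurable_EFinP.
Qed.

Lemma tonelli (F : R -> R -> \bar R) :
  measurable_fun setT (fun p : R * R => F p.1 p.2) ->
  (forall x y, 0 <= F x y)%E ->
  (\int[mu]_x \int[mu]_y F x y = \int[mu]_y \int[mu]_x F x y)%E.
Proof.
move=> mF F0; exact: (@fubini_tonelli _ _ _ _ _ mu mu (fun p => F p.1 p.2)).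
Qed.

Lemma fubini_int (F : R -> R -> R) :
  measurable_fun setT (fun p : R * R => F p.1 p.2) ->
  (\int[mu]_x \int[mu]_y (`|F x y|)%:E < +oo)%E ->
  (\int[mu]_x \int[mu]_y (F x y)%:E = \int[mu]_y \int[mu]_x (F x y)%:E)%E.
Proof.
move=> mF Foo; apply: (@Fubini _ _ _ _ _ mu mu (fun p => (F p.1 p.2)%:E)).
apply/integrable12ltyP => //=; exact/measurable_EFinP.
Qed.

(** The squared L^2 norm, extended-real so that it can be estimated before it is known to be
    finite. *)
Definition sqn (f : R -> R) : \bar R := (\int[mu]_x (f x ^+ 2)%:E)%E.

Lemma sqn_ge0 f : (0 <= sqn f)%E.
Proof. by apply: integral_ge0 => x _; rewrite lee_fin sqr_ge0. Qed.

Lemma sqn_affine (c d : R) f : c != 0 -> measurable_fun setT f ->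
  sqn (fun x => f (c * x + d)) = (`|c|^-1%:E * sqn f)%E.
Proof.
move=> c0 mf; rewrite /sqn (ge0_integral_affine d (f := fun x => (f x ^+ 2)%:E))//.
  by apply/measurable_EFinP; exact: measurable_funX.
by move=> x; rewrite lee_fin sqr_ge0.
Qed.

Lemma sqnZ (c : R) (f : R -> R) : measurable_fun setT f ->
  sqn (fun x => c * f x) = ((c ^+ 2)%:E * sqn f)%E.
Proof.
move=> mf; rewrite /sqn -ge0_integralZl//.
- by apply: eq_integral => x _; rewrite exprMn EFinM.
- by apply/measurable_EFinP; exact: measurable_funX.
- by move=> x _; rewrite lee_fin sqr_ge0.
- by rewrite lee_fin sqr_ge0.
Qed.

(** Integrates (f + g)^2 <= 2 f^2 + 2 g^2. The factor 2 is harmless: only finiteness and smallness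
    are ever drawn from this bound. *)
Lemma sqnD (f g : R -> R) : measurable_fun setT f -> measurable_fun setT g ->
  (sqn (fun x => (f x + g x)%R) <= 2%:E * sqn f + 2%:E * sqn g)%E.
Proof.
move=> mf mg; rewrite /sqn -!ge0_integralZl//; try by
  [apply/measurable_EFinP; exact: measurable_funX | move=> x _; rewrite lee_fin sqr_ge0].
rewrite -ge0_integralD//; try by
  [apply: emeasurable_funM => //; apply/measurable_EFinP; exact: measurable_funX
  | move=> x _; rewrite -EFinM lee_fin mulr_ge0// sqr_ge0].
apply: ge0_le_integral => //.
- by move=> x _; rewrite lee_fin sqr_ge0.
- by apply/measurable_EFinP; apply: measurable_funX; exact: measurable_funD.
- by apply: emeasurable_funD; apply: emeasurable_funM => //; apply/measurable_EFinP; exact: measurable_funX.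
- move=> x _; rewrite -!EFinM -EFinD lee_fin.
  have := sqr_ge0 (f x - g x); nra.
Qed.

Lemma sqnN f : sqn (fun x => - f x) = sqn f.
Proof. by apply: eq_integral => x _; rewrite sqrrN. Qed.

Lemma sqnB (f g : R -> R) : measurable_fun setT f -> measurable_fun setT g ->
  (sqn (fun x => (f x - g x)%R) <= 2%:E * sqn f + 2%:E * sqn g)%E.
Proof.
by move=> mf mg; rewrite -(sqnN g); apply: sqnD => //; exact: measurable_funN.
Qed.

Lemma integrable_mul (f g : R -> R) : measurable_fun setT f -> measurable_fun setT g ->
  (sqn f < +oo)%E -> (sqn g < +oo)%E ->
  mu.-integrable setT (fun x => (f x * g x)%:E).
Proof.
move=> mf mg fo go.
apply: (@le_integrable _ _ _ mu setT measurableT _ (fun x => (f x ^+ 2)%:E + (g x ^+ 2)%:E)%E).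
- by apply/measurable_EFinP; exact: measurable_funM.
- move=> x _; rewrite -EFinD lee_fin/= [leRHS]ger0_norm ?addr_ge0 ?sqr_ge0//.
  rewrite ler_norml; have := sqr_ge0 (f x - g x); have := sqr_ge0 (f x + g x).
  have := sqr_ge0 (f x); have := sqr_ge0 (g x) => *; apply/andP; split; nra.
- have h (h0 : R -> R) : measurable_fun setT h0 -> (sqn h0 < +oo)%E -> mu.-integrable [set: R] (fun x => (h0 x ^+ 2)%:E)%E.
    move=> mh h0o; apply/integrableP; split.
      by apply/measurable_EFinP; exact: measurable_funX.
    by under eq_integral do rewrite gee0_abs ?lee_fin ?sqr_ge0//.
  by apply: integrableD => //; [exact: (h f)|exact: (h g)].
Qed.

(** Cauchy-Schwarz for the measure |k| dt, obtained by optimizing an arithmetic-geometric inequality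
    over a free parameter l. *)
Lemma cauchy_schwarz_kernel (k F : R -> R) (K : R) :
  measurable_fun setT k -> measurable_fun setT F ->
  0 < K -> (\int[mu]_t (`|k t|)%:E <= K%:E)%E ->
  (((\int[mu]_t (k t * F t))%R ^+ 2)%:E <= K%:E * \int[mu]_t (`|k t| * F t ^+ 2)%:E)%E.
Proof.
move=> mk mF K0 kK.
set B := (\int[mu]_t (`|k t| * F t ^+ 2)%:E)%E.
have B0 : (0 <= B)%E by apply: integral_ge0 => t _; rewrite lee_fin mulr_ge0// sqr_ge0.
have [Bfin|] := boolP (B \is a fin_num); last first.
  by rewrite ge0_fin_numE// -leNgt leye_eq => /eqP ->; rewrite gt0_muley ?lte_fin// leey.
pose A := (\int[mu]_t (`|k t * F t|)%:E)%E.
have A0 : (0 <= A)%E by apply: integral_ge0 => t _; rewrite lee_fin.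
have mk' : measurable_fun setT (fun t => `|k t|) by exact: measurableT_comp.
have mB : measurable_fun setT (fun t => `|k t| * F t ^+ 2).
  by apply: measurable_funM => //; exact: measurable_funX.
(* Integrated form of 2 |k F| <= l |k| + |k| F^2 / l; the case l = 1 already shows that A is
   finite. *)
have key (l : R) : 0 < l -> (2%:E * A <= l%:E * K%:E + l^-1%:E * B)%E.
  move=> l0.
  apply: (@le_trans _ _ (l%:E * (\int[mu]_t (`|k t|)%:E) + l^-1%:E * B)%E); last first.
    by rewrite leeD2r// lee_wpmul2l// lee_fin ltW.
  rewrite /A /B -!ge0_integralZl//; try by
    [exact/measurable_EFinP | move=> ? _; rewrite lee_fin mulr_ge0// sqr_ge0|rewrite lee_fin ?invr_ge0 ltW
    | apply/measurable_EFinP; apply: measurableT_comp => //; exact: measurable_funM].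
  rewrite -ge0_integralD//; try by
    [exact/measurable_EFinP/measurable_funM| by move=> t _; rewrite -EFinM lee_fin; nonneg].
  apply: ge0_le_integral => //.
  - by apply: emeasurable_funM => //; apply/measurable_EFinP; apply: measurableT_comp => //; exact: measurable_funM.
  - by apply: emeasurable_funD; apply/measurable_EFinP; exact: measurable_funM.
  - move=> t _; rewrite -!EFinM -EFinD lee_fin normrM.
    have -> : l * `|k t| + l^-1 * (`|k t| * F t ^+ 2) = `|k t| * (l + l^-1 * `|F t| ^+ 2).
      by rewrite real_normK ?num_real//; ring.
    rewrite mulrCA ler_wpM2l//.
    have -> : l + l^-1 * `|F t| ^+ 2 = 2 * `|F t| + l^-1 * (l - `|F t|) ^+ 2 by field; rewrite gt_eqF.
    by rewrite lerDl mulr_ge0 ?invr_ge0 ?sqr_ge0// ltW.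
have Afin : A \is a fin_num.
  rewrite ge0_fin_numE//; have := key 1 ltr01; rewrite invr1 !mul1e => h.
  have : (2%:E * A < +oo)%E by apply: le_lt_trans h _; rewrite lte_add_pinfty ?ltry// -ge0_fin_numE.
  by apply: le_lt_trans; rewrite -[leLHS]mul1e lee_wpmul2r// lee_fin ler1n.
have ikF : mu.-integrable setT (fun t => (k t * F t)%:E).
  apply/integrableP; split; first exact/measurable_EFinP/measurable_funM.
  by rewrite -ge0_fin_numE.
have aI : `|\int[mu]_t (k t * F t)| <= fine A.
  by rewrite -lee_fin EFin_normr_Rintegral// fineK//; exact: le_abse_integral (measurable_int _ ikF).
move: Afin Bfin aI key A0 B0; move/fineK => <- /fineK <- /=.
move: (fine A) (fine B) (\int[mu]_t (k t * F t)) => a b i iA {}key.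
rewrite !lee_fin => a0 b0; apply: (@le_trans _ _ (a ^+ 2)).
  by rewrite -(real_normK (num_real i)) lerXn2r ?nnegrE.
(* The optimal parameter is l = a / K, which has to be positive. *)
have [->|an0] := eqVneq a 0; first by rewrite expr0n/= mulr_ge0// ltW.
have ap : 0 < a by rewrite lt_def an0.
have := key _ (divr_gt0 ap K0); rewrite -!EFinM -EFinD lee_fin divfK ?gt_eqF// invf_div.
rewrite mulr_natl mulr2n lerD2l => h.
by rewrite expr2 -ler_pdivlMl// mulrA (mulrC _ K).
Qed.

(** Pointwise Cauchy-Schwarz in t, then Tonelli. The functions [F ^~ t] need not be translates of
    one function, so rescaled increments are covered as well as convolutions. *)
Lemma young (k : R -> R) (F : R -> R -> R) (K : R) :
  measurable_fun setT k -> measurable_fun setT (fun p : R * R => F p.1 p.2) ->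
  0 < K -> (\int[mu]_t (`|k t|)%:E <= K%:E)%E ->
  (sqn (fun x => \int[mu]_t (k t * F x t))%R <=
   K%:E * \int[mu]_t ((`|k t|)%:E * sqn (fun x => F x t)))%E.
Proof.
move=> mk mF K0 kK.
have m1 : measurable_fun setT (fun p : R * R => k p.2 * F p.1 p.2).
  by apply: measurable_funM => //; exact: (measurableT_comp mk).
have m2 : measurable_fun setT (fun p : R * R => `|k p.2| * F p.1 p.2 ^+ 2).
  by apply: measurable_funM; [do 2 apply: measurableT_comp => //|exact: measurable_funX].
have m2' : measurable_fun setT (fun p : R * R => (`|k p.2| * F p.1 p.2 ^+ 2)%:E) by exact/measurable_EFinP.
apply: (@le_trans _ _ (\int[mu]_x (K%:E * \int[mu]_t (`|k t| * F x t ^+ 2)%:E))%E).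
  apply: ge0_le_integral => //.
  - by move=> x _; rewrite lee_fin sqr_ge0.
  - apply/measurable_EFinP; apply: measurable_funX.
    exact: (measurable_Rintegral2 (F := fun x t => k t * F x t)).
  - by apply: emeasurable_funM => //; exact: (measurable_integral2 m2').
  - move=> x _; apply: cauchy_schwarz_kernel => //.
    exact: (measurableT_comp mF (pair1_measurable x)).
rewrite ge0_integralZl//; last 3 first.
- exact: (measurable_integral2 m2').
- by move=> x _; apply: integral_ge0 => t _; rewrite lee_fin mulr_ge0// sqr_ge0.
- by rewrite lee_fin ltW.
rewrite lee_pmul2l//.
rewrite (tonelli (F := fun x t => (`|k t| * F x t ^+ 2)%:E))//; last first.
  by move=> x t; rewrite lee_fin mulr_ge0// sqr_ge0.
rewrite le_eqVlt; apply/orP; left; apply/eqP; apply: eq_integral => t _.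
rewrite /sqn -ge0_integralZl//.
- apply/measurable_EFinP; apply: measurable_funX.
  exact: (measurableT_comp mF (pair2_measurable t)).
- by move=> x _; rewrite lee_fin sqr_ge0.
Qed.

End L2Estimates.

(** * Powers on the half-line and their integrability at 0 and at infinity *)

Section PowerKernels.
Context {R : realType}.
Local Notation mu := (@lebesgue_measure R).
Implicit Types b c s t : R.

(* Extended by 0 to t <= 0, so that integrals over the half-line are integrals
   over R. *)
Definition pker (b t : R) : R := if 0 < t then t `^ b else 0.

Lemma pker_ge0 b t : 0 <= pker b t.
Proof. by rewrite /pker; case: ifP => // _; exact: powR_ge0. Qed.

Lemma pkerE b t : 0 < t -> pker b t = t `^ b.
Proof. by rewrite /pker => ->. Qed.

Lemma pker0 b t : t <= 0 -> pker b t = 0.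
Proof. by rewrite /pker ltNge => ->. Qed.

Lemma measurable_pker b : measurable_fun [set: R] (pker b).
Proof.
apply: measurable_fun_ifT => //.
by apply: measurable_fun_ltr.
Qed.

Lemma pker_scale b c t : 0 < c -> pker b (c * t) = c `^ b * pker b t.
Proof.
move=> c0; rewrite /pker pmulr_rgt0//; case: ifPn => [t0|_]; last by rewrite mulr0.
by rewrite powRM// ltW.
Qed.

Lemma powR_cvg_pinfty c : 0 < c -> t `^ (- c) @[t --> +oo] --> (0 : R).
Proof.
move=> c0; apply/cvgrPdist_lt => e e0; near=> t.
have t0 : (e^-1) `^ c^-1 < t by near: t; apply: nbhs_pinfty_gt; exact: num_real.
have tp : 0 < t by apply: le_lt_trans t0; exact: powR_ge0.
rewrite sub0r normrN ger0_norm ?powR_ge0// powRN -ltf_pV2 ?posrE ?invr_gt0 ?powR_gt0// invrK.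
have := gt0_ltr_powR c0 _ _ t0; rewrite -powRrM mulVf ?gt_eqF// powRr1 ?invr_ge0 ?ltW//.
by apply => //; rewrite ?nnegrE ?powR_ge0// ltW.
Unshelve. all: end_near. Qed.

Lemma continuous_powR b t : 0 < t -> {for t, continuous (fun x : R => x `^ b)}.
Proof.
move=> t0; apply: differentiable_continuous; apply/derivable1_diffP.
by apply: derivable_powR; rewrite in_itv/= t0.
Qed.

(** The integrand is the derivative of -t^(-c). The factor c normalizes the value to s^(-c) exactly,
    the form in which the kernel y^(-a) is later written as a tail integral. *)
Lemma integral_powR_tail c s : 0 < c -> 0 < s ->
  (\int[mu]_(t in `]s, +oo[) (c * t `^ (-1 - c))%:E = (s `^ (- c))%:E)%E.
Proof.
move=> c0 s0.
have mf : measurable_fun `]s, +oo[ (fun t : R => (c * t `^ (-1 - c))%:E).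
  apply/measurable_EFinP; apply: measurable_funTS; apply: measurable_funM => //; exact: measurable_powR.
rewrite integral_itv_obnd_cbnd//.
rewrite (@ge0_continuous_FTC2y _ (fun t => c * t `^ (-1 - c)) (fun t => - t `^ (- c)) s 0).
- by rewrite sub0e -EFinN opprK.
- by move=> x _; rewrite mulr_ge0 ?powR_ge0// ltW.
- apply: continuous_in_subspaceT => x; rewrite inE/= in_itv/= andbT => sx.
  have x0 := lt_le_trans s0 sx.
  by apply: cvgM; [exact: cvg_cst|exact: continuous_powR].
- by rewrite -[0]oppr0; apply: cvgN; exact: powR_cvg_pinfty.
- move=> x sx; apply: derivableN; apply: derivable_powR.
  by rewrite in_itv/= (lt_trans s0 sx).
- apply: cvgN; apply: cvg_at_right_filter; exact: continuous_powR.
- move=> x; rewrite in_itv/= andbT => sx; have x0 := lt_trans s0 sx.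
  rewrite derive1N; last by apply: derivable_powR; rewrite in_itv/= x0.
  rewrite powR_derive1 ?in_itv/= ?x0// mulNr opprK; congr (_ * _ `^ _); ring.
Qed.

Lemma integral_powR_head b : -1 < b ->
  (\int[mu]_(t in `]0%R, 1%R]) (t `^ b)%:E <= ((b + 1)^-1)%:E)%E.
Proof.
move=> b1; have b0 : 0 < b + 1 by lra.
(* The power t^b may blow up at 0, so ]0, 1] is exhausted by compact intervals on which the
   fundamental theorem applies, and monotone convergence does the rest. *)
pose F (i : nat) : set (measurableTypeR R) := `[i.+1%:R^-1, 1]%classic.
have FU : \bigcup_i F i = `]0, 1]%classic.
  apply/seteqP; split => x /=.
    move=> [i _]; rewrite /F/= !in_itv/= => /andP[ix ->]; rewrite andbT.
    by apply: lt_le_trans ix; rewrite invr_gt0.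
  rewrite in_itv/= => /andP[x0 x1]; exists (Num.truncn x^-1) => //.
  rewrite /F/= in_itv/= x1 andbT invf_ple ?posrE//.
  by apply: ltW; exact: truncnS_gt.
have m i : measurable_fun (F i) (fun t : R => (t `^ b)%:E).
  apply/measurable_EFinP; apply: measurable_funTS; exact: measurable_powR.
have cv : (\int[mu]_(t in F i) (t `^ b)%:E @[i --> \oo] --> \int[mu]_(t in \bigcup_i F i) (t `^ b)%:E)%E.
  apply: ge0_nondecreasing_set_cvg_integral => //.
  - apply/nondecreasing_seqP => i; apply/subsetPset => x; rewrite /F/= !in_itv/= => /andP[ix ->].
    by rewrite andbT (le_trans _ ix)// lef_pV2 ?posrE// ler_nat.
  - by move=> i; exact: measurable_itv.
  - by move=> i x _; rewrite lee_fin powR_ge0.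
rewrite -FU -(cvg_lim _ cv)//; apply: lime_le; first by apply/cvg_ex; eexists; exact: cv.
apply: nearW => i; rewrite /F.
(* For i = 0 the interval is the single point 1, and the fundamental theorem asks for distinct
   endpoints. *)
have [->|i0] := eqVneq i 0%N.
  rewrite invr1 set_itv1 integral_set1 lee_fin invr_ge0 ltW//.
have i1 : i.+1%:R^-1 < 1 :> R by rewrite invf_lt1// ltr1n ltnS lt0n.
rewrite (@continuous_FTC2 _ (fun t => t `^ b) (fun t => (b + 1)^-1 * t `^ (b + 1)))//.
- by rewrite powR1 mulr1 -EFinB lee_fin gerBl mulr_ge0 ?powR_ge0// invr_ge0 ltW.
- apply: continuous_in_subspaceT => x; rewrite inE/= in_itv/= => /andP[sx _].
  by apply: continuous_powR; apply: lt_le_trans sx; rewrite invr_gt0.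
- split.
  + move=> x; rewrite in_itv/= => /andP[sx _]; apply: derivableM => //.
    by apply: derivable_powR; rewrite in_itv/= andbT; apply: lt_trans sx; rewrite invr_gt0.
  + by apply: cvg_at_right_filter; apply: cvgM; [exact: cvg_cst|apply: continuous_powR; rewrite invr_gt0].
  + by apply: cvg_at_left_filter; apply: cvgM; [exact: cvg_cst|exact: continuous_powR].
- move=> x; rewrite in_itv/= => /andP[sx _].
  have x0 : 0 < x by apply: lt_trans sx; rewrite invr_gt0.
  rewrite derive1Ml; last by apply: derivable_powR; rewrite in_itv/= x0.
  by rewrite powR_derive1 ?in_itv/= ?x0// addrK mulrA mulVf ?gt_eqF// mul1r.
Qed.

Lemma pker_head_lty b : -1 < b ->
  (\int[mu]_t (if t <= 1 then pker b t else 0)%:E < +oo)%E.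
Proof.
move=> b1; apply: le_lt_trans (ltry _); apply: le_trans (integral_powR_head b1).
rewrite [leRHS]integral_mkcond/= le_eqVlt; apply/orP; left; apply/eqP.
apply: eq_integral => t _; rewrite patchE mem_setE in_itv/= /pker.
by case: (0 < t); case: (t <= 1).
Qed.

Lemma pker_tail_lty c : 0 < c ->
  (\int[mu]_t (if 1 < t then pker (-1 - c) t else 0)%:E < +oo)%E.
Proof.
move=> c0; suff : (c%:E * \int[mu]_t (if (1 < t)%R then pker (-1 - c) t else 0%R)%:E < +oo)%E.
  by case: (X in (_ * X)%E) => [x|/=|//]; rewrite ?ltry// gt0_muley ?lte_fin.
rewrite -ge0_integralZl//; last 3 first.
- apply/measurable_EFinP; apply: measurable_fun_ifT => //.
  + by apply: measurable_fun_ltr.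
  + exact: measurable_pker.
- by move=> t _; rewrite lee_fin; case: ifP => // _; exact: pker_ge0.
- by rewrite lee_fin ltW.
apply: le_lt_trans (ltry (1 `^ (- c))); rewrite -integral_powR_tail//.
rewrite [leRHS]integral_mkcond/= le_eqVlt; apply/orP; left; apply/eqP.
apply: eq_integral => t _; rewrite patchE mem_setE in_itv/= /pker andbT -EFinM.
by case: ifPn => t1; rewrite ?mulr0// (lt_trans ltr01 t1).
Qed.

End PowerKernels.

Ltac mfun1 := match goal with
  | |- measurable_fun _ _ => assumption
  | |- measurable_fun _ (fun p => EFin (@?f p)) => apply/measurable_EFinP
  | |- measurable_fun _ (EFin \o ?f) => apply/measurable_EFinP
  | |- measurable_fun _ (fun p => @?f p - @?g p) => apply: measurable_funB
  | |- measurable_fun _ (fun p => @?f p + @?g p) => (apply: measurable_funD || apply: emeasurable_funD)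
  | |- measurable_fun _ (fun p => - @?f p) => apply: measurable_funN
  | |- measurable_fun _ (fun p => @?f p * @?g p) => (apply: measurable_funM || apply: emeasurable_funM)
  | |- measurable_fun _ (fun p => @?f p ^+ ?n) => apply: measurable_funX
  | |- measurable_fun _ (fun p => (@?f p * @?g p)%E) => apply: emeasurable_funM
  | |- measurable_fun _ (fun p => `|@?f p|) => apply: (measurableT_comp (@normr_measurable _ _))
  | H : measurable_fun _ ?U |- measurable_fun _ ?U => exact: H
  | |- measurable_fun _ (pker _) => exact: measurable_pker
  | |- measurable_fun _ (fun p => pker ?b (@?g p)) => apply: (measurableT_comp (measurable_pker b))
  | H : measurable_fun _ ?U |- measurable_fun _ (fun p => ?U (@?g p)) => apply: (measurableT_comp H)
  | |- measurable_fun _ (fun p => fst p) => exact: measurable_fst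
  | |- measurable_fun _ (fun p => snd p) => exact: measurable_snd
  | |- measurable_fun _ (fun p => p) => exact: measurable_id
  | |- measurable_fun _ (fun p => ?c) => exact: measurable_cst
  | H : measurable_fun _ ?h |- measurable_fun _ _ =>
      first [exact: (measurableT_comp H measurable_fst) | exact: (measurableT_comp H measurable_snd)]
  end.
Ltac mfun := repeat mfun1.

(** * Marchaud's integral on functions with controlled increments *)

Section Marchaud.
Context {R : realType}.
Local Notation mu := (@lebesgue_measure R).
Implicit Types (t x y : R) (f g u v U : R -> R).

(** A substitute for Cauchy-Schwarz that is linear in the squared norms. If the norms of f and g are
    known to scale like p and q, the choice l = q / p recovers the product p q. *)
Lemma integral_mul_le f g (l : R) : 0 < l ->
  measurable_fun setT f -> measurable_fun setT g ->
  (\int[mu]_x (`|f x * g x|)%:E <= (l / 2)%:E * sqn f + (l^-1 / 2)%:E * sqn g)%E.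
Proof.
move=> l0 mf mg; have l20 : 0 <= l / 2 by rewrite divr_ge0// ltW.
have l20' : 0 <= l^-1 / 2 by rewrite divr_ge0// invr_ge0 ltW.
rewrite /sqn -!ge0_integralZl//; try by [mfun|move=> ? _; rewrite lee_fin sqr_ge0].
rewrite -ge0_integralD//; try by [rewrite /=; mfun|move=> ? _; rewrite -EFinM lee_fin; nonneg].
apply: ge0_le_integral => //.
- by mfun.
- by apply: emeasurable_funD; apply: emeasurable_funM => //; mfun.
move=> x _; rewrite -!EFinM -EFinD lee_fin normrM.
rewrite -(real_normK (num_real (f x))) -(real_normK (num_real (g x))).
have -> : l / 2 * `|f x| ^+ 2 + l^-1 / 2 * `|g x| ^+ 2 =
   `|f x| * `|g x| + l^-1 / 2 * (l * `|f x| - `|g x|) ^+ 2 by field; rewrite gt_eqF.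
by rewrite lerDl mulr_ge0 ?sqr_ge0.
Qed.

(** The size of an increment by t of a bounded Lipschitz function, up to a constant. *)
Definition wgt t : R := Num.min 1 `|t|.

Lemma wgt_ge0 t : 0 <= wgt t.
Proof. by rewrite /wgt le_min ler01 normr_ge0. Qed.

Lemma wgt_gt0 t : t != 0 -> 0 < wgt t.
Proof. by move=> t0; rewrite /wgt lt_min ltr01 normr_gt0. Qed.

Lemma wgt_le1 t : wgt t <= 1.
Proof. by rewrite /wgt ge_min lexx. Qed.

Lemma wgt_le t : wgt t <= `|t|.
Proof. by rewrite /wgt ge_min lexx orbT. Qed.

Lemma measurable_wgt : measurable_fun [set: R] wgt.
Proof. by apply: measurable_minr => //; exact: normr_measurable. Qed.

Definition energy U t : \bar R := sqn (fun x => U x - U (x - t)).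

(* Functions on which Marchaud's integral converges absolutely, pointwise and in
   L^2; mollifications of L^2 functions are of this kind. *)
Definition nice U := [/\ measurable_fun setT U, (sqn U < +oo)%E &
  exists2 M, 0 < M & (forall x y, `|U x - U y| <= M * wgt (x - y)) /\
                     (forall t, energy U t <= (M * wgt t ^+ 2)%:E)%E].

Context (a s : R) (a0 : 0 < a) (a1 : a < 1) (s1 : `|s| = 1).
Local Notation k := (pker (- 1 - a)).

Let wgt_s t : wgt (s * t) = wgt t. Proof. by rewrite /wgt normrM s1 mul1r. Qed.

Lemma kw_ge0 t : 0 <= k t * wgt t.
Proof. by rewrite mulr_ge0 ?pker_ge0 ?wgt_ge0. Qed.

Lemma measurable_kw : measurable_fun setT (fun t => k t * wgt t).
Proof. by apply: measurable_funM; [exact: measurable_pker|exact: measurable_wgt]. Qed.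

(** Below 1 the integrand is at most t^(-a), integrable since a < 1; above 1 it is at most t^(-1-a),
    integrable since a > 0. *)
Lemma kw_lty : (\int[mu]_t (k t * wgt t)%:E < +oo)%E.
Proof.
have mh : measurable_fun [set: R] (fun t : R => if t <= 1 then pker (- a) t else 0).
  by apply: measurable_fun_ifT => //; [apply: measurable_fun_ler|exact: measurable_pker].
have mt : measurable_fun [set: R] (fun t : R => if 1 < t then k t else 0).
  by apply: measurable_fun_ifT => //; [apply: measurable_fun_ltr|exact: measurable_pker].
have h0 t : (0 <= (if t <= 1 then pker (- a) t else 0)%:E)%E by rewrite lee_fin; case: ifP => // _; exact: pker_ge0.
have t0 t : (0 <= (if (1 < t)%R then k t else 0%R)%:E)%E by rewrite lee_fin; case: ifP => // _; exact: pker_ge0.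
apply: (@le_lt_trans _ _ (\int[mu]_t (if (t <= 1)%R then pker (- a) t else 0%R)%:E
  + \int[mu]_t (if (1 < t)%R then k t else 0%R)%:E)%E); last first.
  by rewrite lte_add_pinfty ?pker_tail_lty// pker_head_lty// ltrN2.
rewrite -ge0_integralD//; try exact/measurable_EFinP.
apply: ge0_le_integral => //.
- by move=> t _; rewrite lee_fin kw_ge0.
- by apply/measurable_EFinP; exact: measurable_kw.
- by apply: emeasurable_funD; exact/measurable_EFinP.
move=> t _; rewrite -EFinD lee_fin; case: (ltP 1 t) => t1.
  by rewrite add0r ler_piMr ?pker_ge0 ?wgt_le1.
rewrite addr0; case: (ltP 0 t) => tp; last by rewrite !pker0// mul0r.
rewrite !pkerE//; apply: (@le_trans _ _ (t `^ (- 1 - a) * t)).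
  by rewrite ler_wpM2l ?powR_ge0// -[leRHS]gtr0_norm// wgt_le.
by rewrite -{2}(powRr1 (ltW tp)) -powRD ?(gt_eqF tp) ?implybT// addrAC addrC addNr addr0.
Qed.

Definition marchaud U x : R := \int[mu]_t (k t * (U x - U (x - s * t))).

Lemma marchaud_integrable U x : nice U ->
  mu.-integrable [set: R] (fun t => (k t * (U x - U (x - s * t)))%:E).
Proof.
move=> [mU _ [M M0 [UM _]]].
apply: (@le_integrable _ _ _ mu setT measurableT _ (fun t => (M%:E * (k t * wgt t)%:E)%E)) => //.
- apply/measurable_EFinP; apply: measurable_funM; first exact: measurable_pker.
  apply: measurable_funB => //; apply: (measurableT_comp mU).
  by apply: measurable_funB => //; exact: mulrl_measurable.
- move=> t _; rewrite lee_fin/= !normrM (ger0_norm (pker_ge0 _ _)) (ger0_norm (wgt_ge0 _)) (gtr0_norm M0).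
  rewrite mulrCA ler_wpM2l ?pker_ge0//; apply: le_trans (UM _ _) _.
  by rewrite opprB addrC subrK wgt_s.
- apply: integrableZl => //; apply/integrableP; split.
    by apply/measurable_EFinP; exact: measurable_kw.
  by under eq_integral do rewrite gee0_abs ?lee_fin ?kw_ge0//; exact: kw_lty.
Qed.

Lemma measurable_marchaud U : measurable_fun setT U -> measurable_fun setT (marchaud U).
Proof.
move=> mU; apply: (measurable_Rintegral2 (F := fun x t => k t * (U x - U (x - s * t)))).
by mfun.
Qed.

(** The energy is even: translating x by t exchanges the two values in the increment, and the square
    forgets the sign. *)
Lemma energy_s U t : measurable_fun setT U -> energy U (s * t) = energy U t.
Proof.
move=> mU; have : s = 1 \/ s = - 1.
  by have := s1; case: (leP 0 s) => [/ger0_norm->|/ltr0_norm-> h]; [left|right; rewrite -h opprK].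
case=> ->; first by rewrite mul1r.
rewrite mulN1r /energy -[RHS]sqnN.
have -> : (fun x => - (U x - U (x - t))) = (fun x => U (x - t) - U x) by apply/funext => x; rewrite opprB.
transitivity (sqn (fun x => U (1 * x + t - t) - U (1 * x + t))).
  by congr sqn; apply/funext => x; rewrite mul1r addrK opprK.
rewrite (sqn_affine t (f := fun x => U (x - t) - U x))//; last by mfun.
by rewrite normr1 invr1 mul1e.
Qed.

(** Integrate in x first. The energy of U is at most M [wgt t]^2, so taking l = [wgt t] in
    [integral_mul_le] leaves a constant times k t [wgt t]. This is the hypothesis of every later use
    of Fubini on Marchaud's integral. *)
Lemma marchaud_abs_lty f U : measurable_fun setT f -> (sqn f < +oo)%E -> nice U ->
  (\int[mu]_x \int[mu]_t (`|f x * (k t * (U x - U (x - s * t)))|)%:E < +oo)%E.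
Proof.
move=> mf fo [mU _ [M M0 [_ UM]]].
rewrite (tonelli (F := fun x t => (`|f x * (k t * (U x - U (x - s * t)))|)%:E))//; last first.
  by mfun.
have ff : sqn f \is a fin_num by rewrite ge0_fin_numE// sqn_ge0.
(* With l = w = [wgt t], the bound is (w / 2) |f|^2 + M w^2 / (2 w) = C w. *)
pose C := (fine (sqn f) + M) / 2.
have C0 : 0 <= C by rewrite /C divr_ge0// addr_ge0// ?fine_ge0 ?sqn_ge0// ltW.
apply: (@le_lt_trans _ _ (\int[mu]_t (C%:E * (k t * wgt t)%:E))%E); last first.
  rewrite ge0_integralZl//; last 2 first.
  - by apply/measurable_EFinP; exact: measurable_kw.
  - by move=> t _; rewrite lee_fin kw_ge0.
  by rewrite lte_mul_pinfty// kw_lty.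
apply: ge0_le_integral => //.
- by move=> t _; apply: integral_ge0 => x _; rewrite lee_fin.
- apply: (@measurable_integral2 _ (fun p => (`|f p.2 * (k p.1 * (U p.2 - U (p.2 - s * p.1)))|)%:E)).
  by mfun.
- by apply: emeasurable_funM => //; apply/measurable_EFinP; exact: measurable_kw.
move=> t _; case: (ltP 0 t) => tp; last first.
  by rewrite pker0// mul0r mule0 integral0_eq// => x _; rewrite mul0r mulr0 normr0.
have w0 : 0 < wgt t by rewrite wgt_gt0// gt_eqF.
have mg : measurable_fun setT (fun x => U x - U (x - s * t)) by mfun.
have -> : (\int[mu]_x (`|f x * (k t * (U x - U (x - s * t)))|)%:E =
   (k t)%:E * \int[mu]_x (`|f x * (U x - U (x - s * t))|)%:E)%E.
  rewrite -ge0_integralZl//; last 2 first.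
  - by mfun.
  - by rewrite lee_fin pker_ge0.
  apply: eq_integral => x _; rewrite -EFinM !normrM (ger0_norm (pker_ge0 _ _)).
  by congr EFin; ring.
rewrite [(k t * wgt t)%:E]EFinM muleCA lee_wpmul2l ?lee_fin ?pker_ge0//.
apply: le_trans (integral_mul_le w0 mf mg) _.
rewrite -[X in (_ + _ * X)%E]/(energy U (s * t)) energy_s//.
rewrite -(fineK ff) -EFinM.
apply: le_trans (_ : _ <= ((wgt t / 2 * fine (sqn f))%:E + ((wgt t)^-1 / 2)%:E * (M * wgt t ^+ 2)%:E))%E _.
  by rewrite leeD2l// lee_wpmul2l// lee_fin divr_ge0// invr_ge0 ltW.
rewrite -!EFinM -EFinD lee_fin /C le_eqVlt; apply/orP; left; apply/eqP.
by field; rewrite gt_eqF.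
Qed.

Lemma energy_lty U t : nice U -> (energy U t < +oo)%E.
Proof. by move=> [_ _ [M _ [_ /(_ t)]]] => /le_lt_trans; apply; rewrite ltry. Qed.

Lemma marchaud_duality f U : measurable_fun setT f -> (sqn f < +oo)%E -> nice U ->
  (\int[mu]_x (f x * marchaud U x)%:E =
   \int[mu]_t ((k t)%:E * \int[mu]_x (f x * (U x - U (x - s * t)))%:E))%E.
Proof.
move=> mf fo nU; have [mU _ _] := nU.
transitivity (\int[mu]_x \int[mu]_t (f x * (k t * (U x - U (x - s * t))))%:E)%E.
  apply: eq_integral => x _.
  have := marchaud_integrable x nU => ii.
  rewrite EFinM /marchaud /Rintegral fineK; last exact: integrable_fin_num.
  by rewrite -integralZl//; apply: eq_integral => t _; rewrite -EFinM.
rewrite (fubini_int (F := fun x t => f x * (k t * (U x - U (x - s * t)))))//; last 2 first.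
- by mfun.
- exact: marchaud_abs_lty.
apply: eq_integral => t _.
have mg : measurable_fun setT (fun x => U x - U (x - s * t)) by mfun.
rewrite -integralZl//.
  by apply: eq_integral => x _; rewrite -EFinM; congr EFin; ring.
apply: integrable_mul => //.
by rewrite -[sqn _]/(energy U (s * t)) energy_lty.
Qed.

(** The kernel alone is not integrable, so the weight is moved: Young's inequality is applied to the
    integrable kernel k t [wgt t] and to the increments divided by [wgt t], whose squared norms stay
    below M. *)
Lemma sqn_marchaud_lty U : nice U -> (sqn (marchaud U) < +oo)%E.
Proof.
move=> nU; have [mU _ [M M0 [_ UM]]] := nU.
(* The added 1 keeps K positive, as [young] requires, without examining the integral. *)
pose K := 1 + fine (\int[mu]_t (k t * wgt t)%:E)%E.
have K00 : (0 <= \int[mu]_t (k t * wgt t)%:E)%E by apply: integral_ge0 => t _; rewrite lee_fin kw_ge0.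
have K0 : 0 < K by rewrite ltr_pwDl// fine_ge0.
have mw : measurable_fun setT (fun t : R => (wgt t)^-1).
  rewrite (_ : (fun t => _) = (fun t => wgt t `^ (- 1))); last first.
    by apply/funext => t; rewrite powR_inv1// wgt_ge0.
  exact: (measurableT_comp (@measurable_powR R (-1)) measurable_wgt).
have -> : marchaud U = (fun x => \int[mu]_t ((k t * wgt t) * ((wgt t)^-1 * (U x - U (x - s * t))))%R).
  apply/funext => x; apply: eq_Rintegral => t _.
  (* At t = 0 the weight is 0 and cannot be cancelled, but the kernel vanishes there too. *)
  have [->|t0] := eqVneq t 0; first by rewrite !pker0// !mul0r.
  by rewrite mulrA mulfK// gt_eqF// wgt_gt0.
have mk := measurable_kw.
have le1 : (\int[mu]_t (`|k t * wgt t|)%:E <= K%:E)%E.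
  under eq_integral do rewrite ger0_norm ?kw_ge0//.
  rewrite /K EFinD fineK; first by rewrite leeDr.
  by rewrite ge0_fin_numE// kw_lty.
apply: le_lt_trans (young (F := fun x t => (wgt t)^-1 * (U x - U (x - s * t))) mk _ K0 le1) _.
  by mfun.
rewrite lte_mul_pinfty ?lee_fin ?(ltW K0)//.
apply: (@le_lt_trans _ _ (\int[mu]_t (M%:E * (k t * wgt t)%:E))%E); last first.
  rewrite ge0_integralZl//; last 3 first.
  - by mfun.
  - by move=> t _; rewrite lee_fin kw_ge0.
  - by rewrite lee_fin ltW.
  by rewrite lte_mul_pinfty ?lee_fin ?(ltW M0)// kw_lty.
apply: ge0_le_integral => //.
- by move=> t _; rewrite mule_ge0// sqn_ge0.
- apply: emeasurable_funM; first by mfun.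
  by apply: (@measurable_integral2 _ (fun p => (((wgt p.1)^-1 * (U p.2 - U (p.2 - s * p.1))) ^+ 2)%:E)); mfun.
- by apply: emeasurable_funM => //; mfun.
move=> t _; rewrite ger0_norm ?kw_ge0// muleC.
have [->|t0] := eqVneq t 0; first by rewrite pker0// !mul0r mule0 mule0.
rewrite lee_wpmul2r ?lee_fin ?kw_ge0// sqnZ; last by mfun.
rewrite -[sqn (fun x => _)]/(energy U (s * t)) energy_s//.
apply: le_trans (lee_wpmul2l _ (UM t)) _; first by rewrite lee_fin sqr_ge0.
rewrite -EFinM lee_fin le_eqVlt; apply/orP; left; apply/eqP; field.
by rewrite gt_eqF// wgt_gt0.
Qed.

End Marchaud.

(** * Polarization and elementary properties of the energy *)

Section Polarization.
Context {R : realType}.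
Local Notation mu := (@lebesgue_measure R).
Implicit Types (t x y : R) (f g u v U : R -> R).

(** Stated with f - g and not with f + g, because the difference of two increments of U is again an
    increment of U. *)
Lemma polarization f g : measurable_fun setT f -> measurable_fun setT g ->
  (sqn f < +oo)%E -> (sqn g < +oo)%E ->
  (\int[mu]_x (f x * g x)%:E =
   ((fine (sqn f) + fine (sqn g) - fine (sqn (fun x => f x - g x)%R)) / 2)%:E)%E.
Proof.
move=> mf mg fo go.
have iff := integrable_mul mf mf fo fo; have igg := integrable_mul mg mg go go.
have ifg := integrable_mul mf mg fo go.
have i2 : mu.-integrable [set: R] (EFin \o (fun x => 2 * (f x * g x))).
  by have := integrableZl measurableT 2 ifg; apply: eq_integrable => // x _; rewrite /= EFinM.
have iD : mu.-integrable [set: R] (EFin \o (fun x => f x * f x + g x * g x)).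
  by have := integrableD measurableT iff igg; apply: eq_integrable => // x _; rewrite /= EFinD.
rewrite -[LHS]fineK; last exact: integrable_fin_num.
congr EFin.
have -> : fine (sqn (fun x => f x - g x)) = \int[mu]_x (f x * f x + g x * g x - 2 * (f x * g x)).
  rewrite /sqn /Rintegral; congr fine; apply: eq_integral => x _; congr EFin; ring.
rewrite RintegralB// RintegralD// RintegralZl//.
have sq h : fine (sqn h) = \int[mu]_x (h x * h x).
  by rewrite /sqn /Rintegral; congr fine; apply: eq_integral => x _; rewrite expr2.
by rewrite !sq -/(Rintegral mu setT (fun x => f x * g x)); field.
Qed.

Lemma energy_ge0 U t : (0 <= energy U t)%E.
Proof. exact: sqn_ge0. Qed.

Lemma energy0 U : energy U 0 = 0%E.
Proof. by rewrite /energy /sqn; apply: integral0_eq => x _; rewrite subr0 subrr expr0n. Qed.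

Lemma energyN U t : measurable_fun setT U -> energy U (- t) = energy U t.
Proof. by move=> mU; rewrite -mulN1r; apply: energy_s => //; rewrite normrN normr1. Qed.

Lemma measurable_energy U : measurable_fun setT U -> measurable_fun setT (energy U).
Proof.
move=> mU; apply: (@measurable_integral2 _ (fun p => ((U p.2 - U (p.2 - p.1)) ^+ 2)%:E)).
by mfun.
Qed.

End Polarization.

(** * The half-line form of the Gagliardo seminorm and the constant of the identity *)

Section Core.
Context {R : realType}.
Local Notation mu := (@lebesgue_measure R).
Implicit Types (t x y z : R) (f g u v U : R -> R).
Context (a : R) (a0 : 0 < a) (a1 : a < 1).
Local Notation k := (pker (- 1 - a)).
Local Notation k2 := (pker (- 1 - 2 * a)).

(** Half of Gagliardo's double integral: substitute t = x - y, and use that the energy is even to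
    keep only t > 0. *)
Definition gagliardo U : \bar R := (\int[mu]_t ((k2 t)%:E * energy U t))%E.

Lemma gagliardo_ge0 U : (0 <= gagliardo U)%E.
Proof. by apply: integral_ge0 => t _; rewrite mule_ge0 ?lee_fin ?pker_ge0 ?energy_ge0. Qed.

(** Near 0 the factor t^2 from the energy turns t^(-1-2a) into t^(1-2a), integrable since a < 1;
    beyond 1 the energy is bounded. *)
Lemma nice_gagliardo_lty U : nice U -> (gagliardo U < +oo)%E.
Proof.
move=> [mU _ [M M0 [_ UM]]].
have mh : measurable_fun [set: R] (fun t : R => if t <= 1 then pker (1 - 2 * a) t else 0).
  by apply: measurable_fun_ifT => //; [apply: measurable_fun_ler|exact: measurable_pker].
have mt : measurable_fun [set: R] (fun t : R => if 1 < t then k2 t else 0).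
  by apply: measurable_fun_ifT => //; [apply: measurable_fun_ltr|exact: measurable_pker].
have h0 t : (0 <= (if t <= 1 then pker (1 - 2 * a) t else 0)%:E)%E by rewrite lee_fin; case: ifP => // _; exact: pker_ge0.
have t0 t : (0 <= (if (1 < t)%R then k2 t else 0%R)%:E)%E by rewrite lee_fin; case: ifP => // _; exact: pker_ge0.
apply: (@le_lt_trans _ _ (M%:E * (\int[mu]_t (if (t <= 1)%R then pker (1 - 2 * a) t else 0%R)%:E
  + \int[mu]_t (if (1 < t)%R then k2 t else 0%R)%:E))%E); last first.
  rewrite lte_mul_pinfty ?lee_fin ?(ltW M0)// lte_add_pinfty ?pker_tail_lty ?mulr_gt0// pker_head_lty//.
  by have := a1; lra.
rewrite -ge0_integralD//; try exact/measurable_EFinP.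
rewrite -ge0_integralZl//; last 3 first.
- by apply: emeasurable_funD; exact/measurable_EFinP.
- by move=> t _; rewrite adde_ge0.
- by rewrite lee_fin ltW.
have me := measurable_energy mU.
apply: ge0_le_integral => //.
- by move=> t _; rewrite mule_ge0 ?lee_fin ?pker_ge0 ?energy_ge0.
- by mfun.
- by mfun; apply/measurable_EFinP.
move=> t _; apply: le_trans (_ : (k2 t)%:E * (M * wgt t ^+ 2)%:E <= _)%E.
  by rewrite lee_wpmul2l ?lee_fin ?pker_ge0.
rewrite -EFinD -!EFinM lee_fin mulrCA ler_wpM2l ?(ltW M0)//; case: (ltP 1 t) => t1.
  by rewrite add0r ler_piMr ?pker_ge0// expr_le1 ?wgt_le1 ?wgt_ge0.
rewrite addr0; case: (ltP 0 t) => tp; last by rewrite !pker0// mul0r.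
rewrite !pkerE//; apply: (@le_trans _ _ (t `^ (- 1 - 2 * a) * t ^+ 2)).
  rewrite ler_wpM2l ?powR_ge0// lerXn2r ?nnegrE ?wgt_ge0 ?(ltW tp)//.
  by rewrite -[leRHS]gtr0_norm// wgt_le.
rewrite -(powR_mulrn 2 (ltW tp)) -powRD ?(gt_eqF tp) ?implybT//.
by have -> : -1 - 2 * a + 2 = 1 - 2 * a by ring.
Qed.

(* The value at times 1 and z of (E 1 + E z - E (1 - z)) / 2 for the energy
   profile E t = |t|^(2a). *)
Definition gfac z : R := (1 + z `^ (2 * a) - `|1 - z| `^ (2 * a)) / 2.

(** For z > 0 the number |1 - z| is at most the larger of 1 and z, and powers with positive exponent
    are monotone. *)
Lemma gfac_ge0 z : 0 < z -> 0 <= gfac z.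
Proof.
move=> z0; have aa : 0 <= 2 * a by rewrite mulr_ge0// ltW.
rewrite /gfac divr_ge0// subr_ge0.
case: (leP 1 z) => z1.
  apply: le_trans (_ : z `^ (2 * a) <= _); last by rewrite lerDr.
  rewrite ler0_norm ?subr_le0// opprB ge0_ler_powR// ?nnegrE ?subr_ge0// ?(ltW z0)//.
  by rewrite gerBl.
apply: le_trans (_ : 1 `^ (2 * a) <= _); last by rewrite powR1 lerDl powR_ge0.
rewrite gtr0_norm ?subr_gt0// ge0_ler_powR// ?nnegrE ?subr_ge0// ?(ltW z1)//.
by rewrite gerBl ltW.
Qed.

Lemma measurable_gfac : measurable_fun [set: R] gfac.
Proof.
have m1 : measurable_fun [set: R] (fun z => z `^ (2 * a)) by exact: measurable_powR.
have m2 : measurable_fun [set: R] (fun z => `|1 - z| `^ (2 * a)).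
  by apply: (measurableT_comp (@measurable_powR R (2 * a))); mfun.
by rewrite /gfac; mfun.
Qed.

(** The constant c of the identity, relative to [gagliardo]. *)
Definition cst_core : \bar R := (\int[mu]_z (k z * gfac z)%:E)%E.

Lemma kgfac_ge0 z : 0 <= k z * gfac z.
Proof.
case: (ltP 0 z) => z0; first by rewrite mulr_ge0 ?pker_ge0 ?gfac_ge0.
by rewrite pker0// mul0r.
Qed.

(** On ]0, 1] one has |1 - z| <= 1, hence [gfac z] >= z^(2a) / 2, and the integrand is at least
    z^(a-1) / 2 >= 1/2. *)
Lemma cst_core_gt0 : (0 < cst_core)%E.
Proof.
have mg := measurable_gfac.
apply: (@lt_le_trans _ _ (2^-1%:E)); first by rewrite lte_fin.
apply: (@le_trans _ _ (\int[mu]_(z in `]0%R, 1%R]) (cst 2^-1%:E z)))%E.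
  by rewrite integral_cst//= lebesgue_measure_itv/= lte01 sube0 mule1.
rewrite /cst_core; apply: (@le_trans _ _ (\int[mu]_(z in `]0%R, 1%R]) (k z * gfac z)%:E)%E); last first.
  apply: ge0_subset_integral => //; first by mfun.
  by move=> z _; rewrite lee_fin kgfac_ge0.
apply: ge0_le_integral => //.
- by move=> z _; rewrite lee_fin.
- by apply/measurable_EFinP; apply: measurable_funTS; mfun.
- move=> z /=; rewrite in_itv/= => /andP[z0 z1]; rewrite lee_fin.
  have e1 : z `^ (2 * a) <= 1 + z `^ (2 * a) - `|1 - z| `^ (2 * a).
    rewrite addrAC lerDr subr_ge0; apply: le_trans (_ : _ <= 1 `^ (2 * a)) _; last by rewrite powR1.
    rewrite ge0_ler_powR ?nnegrE ?mulr_ge0 ?(ltW a0)//.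
    by rewrite ger0_norm ?subr_ge0// gerBl ltW.
  apply: le_trans (_ : k z * (z `^ (2 * a) / 2) <= _).
    rewrite pkerE// mulrA -powRD ?(gt_eqF z0) ?implybT//.
    rewrite ler_pdivlMr// mulVf//.
    have -> : -1 - a + 2 * a = a - 1 by ring.
    apply: le_trans (_ : z `^ 0 <= _); first by rewrite powRr0.
    by apply: ger_powR; rewrite ?z0// subr_le0 ltW.
  by rewrite ler_wpM2l ?pker_ge0// /gfac ler_wpM2r.
Qed.

(** Comparison with the exponent 2: as 2a <= 2 and the base is at most 1, (1 - z)^(2a) >= (1 - z)^2
    >= 1 - 2z. This treats 2a < 1 and 2a >= 1 alike. *)
Lemma onem_powR_ge z : 0 <= z <= 1 -> 1 - (1 - z) `^ (2 * a) <= 2 * z.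
Proof.
move=> /andP[z0]; rewrite le_eqVlt => /predU1P[->|z1].
  by rewrite mulr1 subrr powR0 ?subr0 ?ler1n// mulf_neq0// gt_eqF.
have h : (1 - z) `^ 2 <= (1 - z) `^ (2 * a).
  by apply: ger_powR; [rewrite subr_gt0 z1 gerBl z0|rewrite ger_pMr// ltW].
rewrite powR_mulrn ?subr_ge0 ?(ltW z1)// in h.
have := sqr_ge0 z; nra.
Qed.

(** The terms 1 and |1 - z|^(2a) cancel to order z at 0, which leaves z^(a-1) + 2 z^(-a); at
    infinity z^(2a) and |1 - z|^(2a) cancel likewise, which leaves z^(-1-a) + 2 z^(a-2). All four
    powers are integrable at their end. *)
Lemma cst_core_lty : (cst_core < +oo)%E.
Proof.
have mg := measurable_gfac.
pose h b z := if z <= 1 then pker b z else 0 : R.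
pose l b z := if 1 < z then pker b z else 0 : R.
have mh b : measurable_fun [set: R] (h b).
  by apply: measurable_fun_ifT => //; [apply: measurable_fun_ler|exact: measurable_pker].
have mt b : measurable_fun [set: R] (l b).
  by apply: measurable_fun_ifT => //; [apply: measurable_fun_ltr|exact: measurable_pker].
have h0 b z : 0 <= h b z by rewrite /h; case: ifP => // _; exact: pker_ge0.
have t0 b z : 0 <= l b z by rewrite /l; case: ifP => // _; exact: pker_ge0.
have ge2 (x y : R) : 0 <= x -> 0 <= y -> 0 <= x + 2 * y by move=> *; rewrite addr_ge0// mulr_ge0.
apply: (@le_lt_trans _ _ (\int[mu]_z ((h (a - 1) z)%:E + 2%:E * (h (- a) z)%:E + ((l (- 1 - a) z)%:E + 2%:E * (l (- 1 - (1 - a)) z)%:E)))%E).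
  have mhh b : measurable_fun [set: R] (fun z => (h b z)%:E) by exact/measurable_EFinP.
  have mll b : measurable_fun [set: R] (fun z => (l b z)%:E) by exact/measurable_EFinP.
  apply: ge0_le_integral => //.
  - by move=> z _; rewrite lee_fin kgfac_ge0.
  - by mfun.
  - by mfun; do ?[exact: mh|exact: mt].
  move=> z _; rewrite -!EFinM -!EFinD lee_fin /h /l; case: (ltP 0 z) => z0; last first.
    by rewrite !pker0// mul0r !(if_same, mulr0, addr0).
  rewrite !pkerE//; case: (leP z 1) => z1.
    rewrite mulr0 !addr0.
    have -> : z `^ (a - 1) + 2 * z `^ (- a) = z `^ (- 1 - a) * (z `^ (2 * a) + 2 * z).
      have e1 : z `^ (- 1 - a) * z `^ (2 * a) = z `^ (a - 1).
        by rewrite -powRD ?(gt_eqF z0) ?implybT//; congr (_ `^ _); ring.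
      have e2 : z `^ (- 1 - a) * z = z `^ (- a).
        by rewrite -[X in _ * X](powRr1 (ltW z0)) -powRD ?(gt_eqF z0) ?implybT//; congr (_ `^ _); ring.
      by rewrite mulrDr e1 mulrCA e2.
    rewrite ler_wpM2l ?powR_ge0// /gfac ger0_norm ?subr_ge0//.
    have := @onem_powR_ge z; rewrite (ltW z0) z1 => /(_ isT).
    have := powR_ge0 z (2 * a); lra.
  rewrite mulr0 !add0r.
  have -> : z `^ (- 1 - a) + 2 * z `^ (- 1 - (1 - a)) = z `^ (- 1 - a) * (1 + 2 * (z `^ (2 * a) * z^-1)).
    have e1 : z `^ (- 1 - a) * (z `^ (2 * a) * z^-1) = z `^ (- 1 - (1 - a)).
      rewrite -(powR_inv1 (ltW z0)) -!powRD ?(gt_eqF z0) ?implybT//.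
      by congr (_ `^ _); ring.
    by rewrite mulrDr mulr1 mulrCA e1.
  rewrite ler_wpM2l ?powR_ge0// /gfac ltr0_norm ?subr_lt0// opprB.
  have zi : 0 <= z^-1 <= 1 by rewrite invr_ge0 (ltW z0)/= invf_le1// ltW.
  (* Pulling out z^(2a) reduces z > 1 to the preceding estimate at 1 / z. *)
  have -> : (z - 1) `^ (2 * a) = z `^ (2 * a) * (1 - z^-1) `^ (2 * a).
    rewrite -powRM ?(ltW z0)// ?subr_ge0; last by case/andP: zi.
    by rewrite mulrBr mulr1 mulfV// gt_eqF.
  have := onem_powR_ge zi; have zz := powR_ge0 z (2 * a).
  move=> /(ler_wpM2l zz); have : 0 <= z `^ (2 * a) * z^-1 by rewrite mulr_ge0//; case/andP: zi.
  lra.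
have fin b : -1 < b -> (\int[mu]_z (h b z)%:E < +oo)%E by exact: pker_head_lty.
have fit c : 0 < c -> (\int[mu]_z (l (-1 - c) z)%:E < +oo)%E by exact: pker_tail_lty.
have mhh b : measurable_fun [set: R] (fun z => (h b z)%:E) by exact/measurable_EFinP.
have mll b : measurable_fun [set: R] (fun z => (l b z)%:E) by exact/measurable_EFinP.
have m2 : measurable_fun [set: R] (fun z => 2%:E * (h (- a) z)%:E)%E by mfun; exact: mh.
have m2' : measurable_fun [set: R] (fun z => 2%:E * (l (- 1 - (1 - a)) z)%:E)%E by mfun; exact: mt.
rewrite ge0_integralD//; last 4 first.
- by move=> z _; rewrite -!EFinM -!EFinD lee_fin; exact: ge2.
- by apply: emeasurable_funD; [exact: mhh|].
- by move=> z _; rewrite -!EFinM -!EFinD lee_fin; exact: ge2.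
- by apply: emeasurable_funD; [exact: mll|].
rewrite ge0_integralD//; try by [exact: mhh|exact: mll|move=> z _; rewrite lee_fin|move=> z _; rewrite -EFinM lee_fin mulr_ge0].
rewrite [X in (_ + X)%E]ge0_integralD//; try by [exact: mhh|exact: mll|move=> z _; rewrite lee_fin|move=> z _; rewrite -EFinM lee_fin mulr_ge0].
rewrite !ge0_integralZl//; try by [exact: mhh|exact: mll|move=> z _; rewrite lee_fin|move=> z _; rewrite -EFinM lee_fin mulr_ge0].
have am1 : - 1 < a - 1 by have := a0; lra.
have Na1 : - 1 < - a by have := a1; lra.
have a1' : 0 < 1 - a by have := a1; lra.
apply: lte_add_pinfty; apply: lte_add_pinfty; try apply: lte_mul_pinfty => //.
all: by [exact: fin|exact: fit].
Qed.

End Core.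

(** * The exact identity between the Marchaud norm and the Gagliardo seminorm *)

Section CoreIdentity.
Context {R : realType}.
Local Notation mu := (@lebesgue_measure R).
Implicit Types (t x y z : R) (f g u v U : R -> R).
Context (a : R) (a0 : 0 < a) (a1 : a < 1).
Local Notation k := (pker (- 1 - a)).
Local Notation k2 := (pker (- 1 - 2 * a)).

Definition renergy U t : R := fine (energy U t).

Let fenE U t : nice U -> energy U t = (renergy U t)%:E.
Proof. by move=> nU; rewrite fineK// ge0_fin_numE ?energy_lty ?energy_ge0. Qed.

Let measurable_fen U : nice U -> measurable_fun [set: R] (renergy U).
Proof. by move=> [mU _ _]; apply: measurableT_comp (measurable_energy mU); exact: fine_measurable. Qed.

(** The inner product of the increments of U by z and by t, written in energies only: in this form
    it can be rescaled, and the direction has disappeared. *)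
Definition gram U z t : R := (renergy U z + renergy U t - renergy U (z - t)) / 2.

(** The difference of the increments by t and by z is, after a translation by s t, an increment by z
    - t; polarization does the rest. *)
Lemma increment_cross (s : R) U z t : `|s| = 1 -> nice U ->
  (\int[mu]_x ((U x - U (x - s * t)) * (U x - U (x - s * z)))%:E = (gram U z t)%:E)%E.
Proof.
move=> s1 nU; have [mU _ _] := nU.
have e r : sqn (fun x => U x - U (x - s * r)) = (renergy U r)%:E.
  by rewrite -fenE// -(energy_s s1 r mU).
rewrite polarization; [|by mfun|by mfun|by rewrite e ltry|by rewrite e ltry].
have -> : sqn (fun x => U x - U (x - s * t) - (U x - U (x - s * z))) = (renergy U (z - t))%:E.
  rewrite -fenE// -(energy_s s1 (z - t) mU) /energy.
  transitivity (sqn (fun x => U (1 * x + - (s * t)) - U (1 * x + - (s * t) - s * (z - t)))).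
    rewrite -sqnN; congr sqn; apply/funext => x; rewrite mul1r.
    have -> : x - s * t - s * (z - t) = x - s * z by ring.
    ring.
  rewrite (sqn_affine (- (s * t)) (f := fun x => U x - U (x - s * (z - t))))//; last by mfun.
  by rewrite normr1 invr1 mul1e.
by rewrite !e/= /gram (addrC (renergy U t)).
Qed.

(** [integral_mul_le] with l = [wgt z] / [wgt t] makes both terms equal to M [wgt z] [wgt t] / 2. *)
Let gram_bound U : nice U -> exists2 M, 0 <= M &
  forall z t, 0 < z -> 0 < t -> `|gram U z t| <= M * (wgt z * wgt t).
Proof.
move=> nU; have [mU _ [M M0 [_ UM]]] := nU; exists M; first exact: ltW.
move=> z t z0 t0; rewrite -lee_fin.
have w1 : 0 < wgt z by rewrite wgt_gt0// gt_eqF.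
have w2 : 0 < wgt t by rewrite wgt_gt0// gt_eqF.
have := @increment_cross 1 U z t (normr1 _) nU; rewrite !mul1r => e.
rewrite -abse_EFin -e.
have m1 : measurable_fun [set: R] (fun x => U x - U (x - t)) by mfun.
have m2 : measurable_fun [set: R] (fun x => U x - U (x - z)) by mfun.
apply: le_trans (le_abse_integral _ _ _) _ => //; first by mfun.
have l0 : 0 < wgt z / wgt t by rewrite divr_gt0.
apply: le_trans (integral_mul_le l0 m1 m2) _.
apply: (@le_trans _ _ ((wgt z / wgt t / 2)%:E * (M * wgt t ^+ 2)%:E + ((wgt z / wgt t)^-1 / 2)%:E * (M * wgt z ^+ 2)%:E)%E).
  apply: leeD; apply: lee_wpmul2l; rewrite ?lee_fin ?UM// ?divr_ge0 ?invr_ge0// ltW//.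
rewrite -!EFinM -EFinD lee_fin le_eqVlt; apply/orP; left; apply/eqP.
by field; rewrite !gt_eqF.
Qed.

Let measurable_gram U : nice U -> measurable_fun setT (fun p : R * R => gram U p.1 p.2).
Proof. by move=> nU; have me := measurable_fen nU; rewrite /gram; mfun. Qed.

Let sqn_marchaudE (s : R) U : `|s| = 1 -> nice U ->
  (sqn (marchaud a s U) = \int[mu]_t ((k t)%:E * \int[mu]_z (k z * gram U z t)%:E))%E.
Proof.
move=> s1 nU; have [mU _ _] := nU.
have mm := measurable_marchaud a s mU.
have mo := sqn_marchaud_lty a0 a1 s1 nU.
transitivity (\int[mu]_x (marchaud a s U x * marchaud a s U x)%:E)%E.
  by apply: eq_integral => x _; rewrite expr2.
rewrite (marchaud_duality a0 a1 s1 mm mo nU).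
apply: eq_integral => t _; congr (_ * _)%E.
(* Duality has been used with f the Marchaud integral itself; it is now used again with f an
   increment of U. *)
have mf : measurable_fun [set: R] (fun x => U x - U (x - s * t)) by mfun.
have fo : (sqn (fun x => (U x - U (x - s * t))%R) < +oo)%E.
  by rewrite -[sqn _]/(energy U (s * t)) energy_lty.
rewrite (_ : (\int[mu]_x (marchaud a s U x * (U x - U (x - s * t)))%:E)%E = (\int[mu]_x ((U x - U (x - s * t)) * marchaud a s U x)%:E)%E); last first.
  by apply: eq_integral => x _; rewrite mulrC.
rewrite (marchaud_duality a0 a1 s1 mf fo nU).
by apply: eq_integral => z _; rewrite EFinM increment_cross.
Qed.

(** The weight [wgt z] in the Gram bound compensates the singularity of the kernel at z = 0. *)
Let gram_integrable U t : nice U -> 0 < t ->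
  mu.-integrable [set: R] (fun z => (k z * gram U z t)%:E).
Proof.
move=> nU t0; have [M M0 b] := gram_bound nU; have me := measurable_fen nU.
have mk := @measurable_kw R a.
apply: (@le_integrable _ _ _ mu setT measurableT _ (fun z => ((M * wgt t)%:E * (k z * wgt z)%:E)%E)) => //.
- by rewrite /gram; mfun.
- move=> z _; rewrite -EFinM lee_fin/= (normrM (k z)) (ger0_norm (pker_ge0 _ z)).
  rewrite [leRHS]ger0_norm; last by rewrite !mulr_ge0 ?wgt_ge0 ?pker_ge0.
  case: (ltP 0 z) => z0; last by rewrite pker0// !(mul0r, mulr0).
  by rewrite mulrCA ler_wpM2l ?pker_ge0//; apply: le_trans (b _ _ z0 t0) _; rewrite -!mulrA (mulrC (wgt t)).
- apply: integrableZl => //; apply/integrableP; split; first by mfun.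
  by under eq_integral do rewrite gee0_abs ?lee_fin ?kw_ge0//; exact: kw_lty.
Qed.

(** The three factors are the outer kernel, the Jacobian of z -> t z, and the factor that the
    homogeneous inner kernel releases. *)
Let k2E t : 0 < t -> k2 t = k t * t * t `^ (-1 - a).
Proof.
move=> t0; have tn0 : t != 0 by rewrite gt_eqF.
rewrite !pkerE// -[X in _ * X * _](powRr1 (ltW t0)) -!powRD ?tn0 ?implybT//.
by congr (_ `^ _); ring.
Qed.

Let inner_scale U t : nice U ->
  ((k t)%:E * \int[mu]_z (k z * gram U z t)%:E =
   \int[mu]_z (k2 t * (k z * gram U (t * z) t))%:E)%E.
Proof.
move=> nU; case: (ltP 0 t) => t0; last first.
  by rewrite !pker0// mul0e integral0_eq// => x _; rewrite mul0r.
have tn0 : t != 0 by rewrite gt_eqF.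
have sc z : k (t * z + 0) * gram U (t * z + 0) t = t `^ (-1 - a) * (k z * gram U (t * z) t).
  by rewrite addr0 pker_scale// mulrA.
have := integral_affine 0 tn0 (gram_integrable nU t0) => /=.
under eq_integral do rewrite sc EFinM.
have i2 : mu.-integrable [set: R] (fun z => (k z * gram U (t * z) t)%:E).
  have := integrableZl measurableT ((t `^ (-1 - a))^-1) (integrable_affine 0 tn0 (gram_integrable nU t0)).
  apply: eq_integrable => // z _; rewrite sc -EFinM mulKf//.
  by rewrite gt_eqF// powR_gt0.
rewrite integralZl; do ?[exact: i2|exact: measurableT].
rewrite (gtr0_norm t0) => e.
under [RHS]eq_integral do rewrite EFinM.
rewrite integralZl; do ?[exact: i2|exact: measurableT].
have exr (x : \bar R) : x \is a fin_num -> exists r, x = r%:E by move=> h; exists (fine x); rewrite fineK.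
have [I1 eI1] : exists r, (\int[mu]_z (k z * gram U z t)%:E = r%:E)%E.
  by apply: exr; exact: integrable_fin_num (gram_integrable nU t0).
have [I2 eI2] : exists r, (\int[mu]_z (k z * gram U (t * z) t)%:E = r%:E)%E.
  by apply: exr; exact: integrable_fin_num i2.
move: e; rewrite eI1 eI2 -!EFinM => -[e]; congr EFin.
have -> : I1 = t * (t `^ (-1 - a) * I2) by rewrite e mulrA mulfV// mul1r.
by rewrite k2E// !mulrA.
Qed.

Let abs_scale U t : nice U -> 0 < t ->
  (\int[mu]_z (`|k2 t * (k z * gram U (t * z) t)|)%:E =
  (k t)%:E * \int[mu]_z (`|k z * gram U z t|)%:E)%E.
Proof.
move=> nU t0; have me := measurable_fen nU; have tn0 : t != 0 by rewrite gt_eqF.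
have m1 : measurable_fun [set: R] (fun z => (`|k z * gram U z t|)%:E) by rewrite /gram; mfun.
have sc z : `|k (t * z + 0) * gram U (t * z + 0) t| = t `^ (-1 - a) * `|k z * gram U (t * z) t|.
  by rewrite addr0 pker_scale// -(mulrA (t `^ _)) normrM (ger0_norm (powR_ge0 t _)).
have m2 : measurable_fun [set: R] (fun z => (`|k z * gram U (t * z) t|)%:E).
  by rewrite /gram; mfun.
have p1 z : (0 <= (`|k z * gram U z t|)%:E)%E by rewrite lee_fin.
have := ge0_integral_affine 0 tn0 m1 p1 => /=.
under eq_integral do rewrite sc EFinM.
rewrite ge0_integralZl//; last by rewrite lee_fin powR_ge0.
rewrite (gtr0_norm t0) => e.
transitivity (\int[mu]_z ((k2 t)%:E * (`|k z * gram U (t * z) t|)%:E))%E.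
  by apply: eq_integral => z _; rewrite (normrM (k2 t)) EFinM (ger0_norm (pker_ge0 _ t)).
have p2 z : [set: measurableTypeR R] z -> (0 <= (`|k z * gram U (t * z) t|)%:E)%E by rewrite lee_fin.
have k20 : (0 <= (k2 t)%:E)%E by rewrite lee_fin pker_ge0.
rewrite ge0_integralZl; do ?[exact: m2|exact: p2|exact: k20|exact: measurableT].
rewrite (k2E t0) [(k t * t * _)%:E]EFinM -[LHS]muleA.
rewrite [X in (_ * X)%E = _]e.
rewrite [LHS]muleA.
rewrite -EFinM.
rewrite mulfK; first by [].
exact: tn0.
Qed.

(** Undoing the substitution and inserting the Gram bound gives at most M times the square of the
    integral of k t [wgt t]. *)
Let core_abs_lty U : nice U ->
  (\int[mu]_t \int[mu]_z (`|k2 t * (k z * gram U (t * z) t)|)%:E < +oo)%E.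
Proof.
move=> nU; have [M M0 b] := gram_bound nU; have me := measurable_fen nU.
have mk := @measurable_kw R a; have mc := measurable_gram nU.
pose K := (\int[mu]_z (k z * wgt z)%:E)%E.
have K0 : (0 <= K)%E by apply: integral_ge0 => t _; rewrite lee_fin kw_ge0.
have Kf : K \is a fin_num by rewrite ge0_fin_numE// kw_lty.
apply: (@le_lt_trans _ _ (\int[mu]_t ((M * fine K)%:E * (k t * wgt t)%:E))%E); last first.
  rewrite ge0_integralZl//; last 3 first.
  - by mfun.
  - by move=> t _; rewrite lee_fin kw_ge0.
  - by rewrite lee_fin mulr_ge0// fine_ge0.
  by rewrite lte_mul_pinfty ?lee_fin ?mulr_ge0 ?fine_ge0// kw_lty.
apply: ge0_le_integral => //.
- by move=> t _; apply: integral_ge0 => z _; rewrite lee_fin.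
- apply: (@measurable_integral2 _ (fun p => (`|k2 p.1 * (k p.2 * gram U (p.1 * p.2) p.1)|)%:E)).
  by rewrite /gram; mfun.
- by mfun.
move=> t _; case: (ltP 0 t) => t0; last first.
  rewrite integral0_eq; first by rewrite mule_ge0 ?lee_fin ?kw_ge0// mulr_ge0// fine_ge0.
  by move=> x _; rewrite pker0// mul0r normr0.
rewrite abs_scale// [X in (_ <= _ * X)%E]EFinM muleCA lee_wpmul2l ?lee_fin ?pker_ge0//.
rewrite -EFinM mulrAC EFinM fineK// /K -ge0_integralZl//; last 3 first.
- by mfun.
- by move=> z _; rewrite lee_fin kw_ge0.
- by rewrite lee_fin mulr_ge0// wgt_ge0.
apply: ge0_le_integral => //.
- by rewrite /gram; mfun.
- by mfun.
move=> z _; rewrite -EFinM lee_fin (normrM (k z)) (ger0_norm (pker_ge0 _ z)).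
case: (ltP 0 z) => z0; last by rewrite pker0// !(mul0r, mulr0).
by rewrite mulrCA ler_wpM2l ?pker_ge0//; apply: le_trans (b _ _ z0 t0) _; rewrite -!mulrA (mulrC (wgt t)).
Qed.

(** The kernel is homogeneous of degree -1-2a and the Jacobian contributes one power of |c|;
    evenness of the energy covers c < 0. *)
Let gag_scale U (c : R) : nice U -> c != 0 ->
  (\int[mu]_t (k2 t * renergy U (c * t))%:E = (`|c| `^ (2 * a))%:E * gagliardo a U)%E.
Proof.
move=> nU c0; have me := measurable_fen nU; have [mU _ _] := nU.
have cp : 0 < `|c| by rewrite normr_gt0.
have cn0 : `|c| != 0 by rewrite gt_eqF.
have -> : gagliardo a U = (\int[mu]_t (k2 t * renergy U t)%:E)%E.
  by apply: eq_integral => t _; rewrite EFinM -fenE.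
have m1 : measurable_fun [set: R] (fun t => (k2 t * renergy U t)%:E) by mfun.
have fe0 t : 0 <= renergy U t by rewrite fine_ge0// energy_ge0.
have p0 t : (0 <= (k2 t * renergy U t)%:E)%E by rewrite lee_fin mulr_ge0 ?pker_ge0.
have := ge0_integral_affine 0 cn0 m1 p0 => /=.
have -> : (\int[mu]_t (k2 (`|c| * t + 0) * renergy U (`|c| * t + 0))%:E = \int[mu]_t ((`|c| `^ (-1 - 2 * a))%:E * (k2 t * renergy U (c * t))%:E))%E.
  apply: eq_integral => t _; rewrite addr0 pker_scale// -mulrA EFinM; congr (_ * _)%E.
  rewrite EFinM [RHS]EFinM; congr (_ * _)%E; rewrite -!fenE//.
  by case: (leP 0 c) => h; [rewrite ger0_norm|rewrite ltr0_norm// mulNr energyN].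
rewrite ge0_integralZl//; last 2 first.
- by mfun.
- by move=> t _; rewrite lee_fin mulr_ge0 ?pker_ge0.
rewrite normr_id => e.
have e2 : `|c| `^ (2 * a) = (`|c| `^ (-1 - 2 * a))^-1 * `|c|^-1.
  rewrite -powRN -(powR_inv1 (normr_ge0 c)) -powRD ?cn0 ?implybT//; congr (_ `^ _); ring.
rewrite e2 EFinM -muleA -e muleA -EFinM mulVf ?mul1e//.
by rewrite gt_eqF// powR_gt0.
Qed.

(* Scaling out [t] in the Gram integral leaves the Gagliardo energy times an
   explicit one-dimensional integral: this replaces Plancherel's theorem. *)
Lemma sqn_marchaud (s : R) U : `|s| = 1 -> nice U ->
  sqn (marchaud a s U) = (cst_core a * gagliardo a U)%E.
Proof.
move=> s1 nU; have me := measurable_fen nU; have [mU _ _] := nU.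
have fe0 t : 0 <= renergy U t by rewrite fine_ge0// energy_ge0.
have gf : gagliardo a U \is a fin_num.
  by rewrite ge0_fin_numE ?gagliardo_ge0// nice_gagliardo_lty.
have mg := @measurable_gfac R a.
rewrite sqn_marchaudE//.
under eq_integral do rewrite inner_scale//.
rewrite (fubini_int (F := fun t z => k2 t * (k z * gram U (t * z) t))); last 2 first.
- by rewrite /gram; mfun.
- exact: core_abs_lty.
rewrite /cst_core -ge0_integralZr//; last 3 first.
- by mfun.
- by move=> z _; rewrite lee_fin kgfac_ge0.
- exact: gagliardo_ge0.
apply: eq_integral => z _; case: (ltP 0 z) => z0; last first.
  by rewrite pker0// mul0r mul0e integral0_eq// => t _; rewrite mul0r mulr0.
have zn0 : z != 0 by rewrite gt_eqF.
have int c : c != 0 -> mu.-integrable [set: R] (fun t => (k2 t * renergy U (c * t))%:E).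
  move=> c0; apply/integrableP; split; first by mfun.
  under eq_integral do rewrite gee0_abs ?lee_fin ?mulr_ge0 ?pker_ge0//.
  by rewrite gag_scale// lte_mul_pinfty ?lee_fin ?powR_ge0// nice_gagliardo_lty.
(* At z = 1 the scaling factor 1 - z is 0 and [gag_scale] does not apply; there the energy vanishes,
   as does 0^(2a). *)
have int0 : mu.-integrable [set: R] (fun t => (k2 t * renergy U ((1 - z) * t))%:E).
  have [->|] := eqVneq (1 - z) 0; last exact: int.
  apply: eq_integrable (integrable0 _ _) => // t _.
  by rewrite mul0r /renergy energy0 mulr0.
have scal0 : (\int[mu]_t (k2 t * renergy U ((1 - z) * t))%:E = (`|1 - z| `^ (2 * a))%:E * gagliardo a U)%E.
  have [->|] := eqVneq (1 - z) 0; last exact: gag_scale.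
  rewrite normr0 powR0 ?mulf_neq0 ?(gt_eqF a0)// mul0e integral0_eq// => t _.
  by rewrite mul0r /renergy energy0 mulr0.
(* For fixed z, the Gram kernel at (t z, t) involves the energies at z t, t and (1 - z) t, each of
   which integrates to a power times the seminorm. *)
transitivity (\int[mu]_t ((k z / 2)%:E * ((k2 t * renergy U (z * t))%:E + (k2 t * renergy U (1 * t))%:E - (k2 t * renergy U ((1 - z) * t))%:E)))%E.
  apply: eq_integral => t _.
  transitivity ((k z / 2 * (k2 t * renergy U (z * t) + k2 t * renergy U (1 * t) - k2 t * renergy U ((1 - z) * t)))%:E); last by [].
  congr EFin.
  rewrite /gram mul1r (mulrC t z).
  have -> : renergy U ((1 - z) * t) = renergy U (z * t - t).
    by rewrite /renergy -energyN//; congr (fine (energy _ _)); ring.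
  by field.
have i1 := int _ (oner_neq0 R).
rewrite integralZl//; last by apply: integrableB => //; apply: integrableD => //; exact: int.
rewrite integralB//; last by apply: integrableD => //; exact: int.
rewrite integralD//; last exact: int.
rewrite scal0 !gag_scale ?oner_neq0// normr1 powR1 (gtr0_norm z0).
rewrite -(fineK gf); set I := fine _.
transitivity ((k z / 2 * (z `^ (2 * a) * I + 1 * I - `|1 - z| `^ (2 * a) * I))%:E); first by [].
by rewrite -EFinM /gfac; congr EFin; field.
Qed.

End CoreIdentity.

(** * Convolution with Lipschitz kernels of compact support *)

Section Convolution.
Context {R : realType}.
Local Notation mu := (@lebesgue_measure R).
Implicit Types (t x y z h : R) (f g u v U r : R -> R).

Lemma integral_box f (B T : R) : 0 <= B -> 0 <= T -> measurable_fun setT f ->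
  (forall x, `|f x| <= B) -> (forall x, T < `|x| -> f x = 0) ->
  (\int[mu]_x (`|f x|)%:E <= (B * (2 * T))%:E)%E.
Proof.
move=> B0 T0 mf fB fT.
apply: (@le_trans _ _ (\int[mu]_(x in `[(- T)%R, T]) (cst B%:E x))%E); last first.
  rewrite integral_cst//= lebesgue_measure_itv/= lte_fin; case: ifPn => _.
    by rewrite -EFinB -EFinM lee_fin opprK mulr_natl mulr2n.
  by rewrite mule0 lee_fin !mulr_ge0.
rewrite [leRHS]integral_mkcond; apply: ge0_le_integral => //.
- by mfun.
- by apply/(measurable_restrictT _ _).1 => //; exact: measurable_cst.
move=> x _; rewrite patchE mem_setE in_itv/= -ler_norml.
by case: ifPn => [_|]; [rewrite lee_fin|rewrite -ltNge => /fT ->; rewrite normr0].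
Qed.

(** All that the convolution estimates ask of a kernel; test functions and their reflections and
    translates qualify. *)
Definition lipc r := measurable_fun setT r /\ exists B L T : R,
  [/\ 0 <= B, 0 <= L, 0 <= T, (forall x, `|r x| <= B) &
   (forall x y, `|r x - r y| <= L * `|x - y|) /\ (forall x, T < `|x| -> r x = 0)].

Lemma integral_box_sqr f (B T : R) : 0 <= B -> 0 <= T -> measurable_fun setT f ->
  (forall x, `|f x| <= B) -> (forall x, T < `|x| -> f x = 0) ->
  (sqn f <= (B ^+ 2 * (2 * T))%:E)%E.
Proof.
move=> B0 T0 mf fB fT.
have := @integral_box (fun x => f x ^+ 2) (B ^+ 2) T; rewrite sqr_ge0 T0 => h.
apply: le_trans (h isT isT _ _ _); last 3 first.
- by mfun.
- by move=> x; rewrite normrX lerXn2r ?nnegrE.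
- by move=> x /fT ->; rewrite expr0n.
rewrite le_eqVlt; apply/orP; left; apply/eqP; apply: eq_integral => x _.
by rewrite ger0_norm// sqr_ge0.
Qed.

Lemma sqn_shift f h : measurable_fun setT f -> sqn (fun x => f (x - h)) = sqn f.
Proof.
move=> mf; transitivity (sqn (fun x => f (1 * x + - h))).
  by congr sqn; apply/funext => x; rewrite mul1r.
by rewrite sqn_affine// normr1 invr1 mul1e.
Qed.

Lemma energy_le4 f h : measurable_fun setT f -> (energy f h <= 4%:E * sqn f)%E.
Proof.
move=> mf; apply: le_trans (sqnB mf _) _; first by mfun.
rewrite sqn_shift// -ge0_muleDl//.
by rewrite -EFinD -natrD.
Qed.

Lemma wgtE t : wgt t = if `|t| <= 1 then `|t| else 1.
Proof. by rewrite /wgt minC /Num.min; case: ltgtP => [|//|->]. Qed.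

Lemma lipc_near r (T h x : R) : (forall x, T < `|x| -> r x = 0) -> `|h| <= 1 ->
  T + 1 < `|x| -> r x - r (x - h) = 0.
Proof.
move=> rT h1 xT; rewrite !rT ?subrr//.
  apply: lt_le_trans (lerB_normD _ _); rewrite normrN; lra.
lra.
Qed.

(** For |t| <= 1 the increment is at most L |t| and lives on a box enlarged by 1; for larger t the
    bound 4 |r|^2 suffices. The leading 1 in the constant makes it positive. *)
Lemma lipc_energy r : lipc r -> exists2 M, 0 < M & forall t, (energy r t <= (M * wgt t ^+ 2)%:E)%E.
Proof.
move=> [mr [B [L [T [B0 L0 T0 rB [rL rT]]]]]].
exists (1 + L ^+ 2 * (2 * (T + 1)) + 4 * (B ^+ 2 * (2 * T))).
  rewrite -addrA ltr_pwDl// addr_ge0// !mulr_ge0 ?sqr_ge0// addr_ge0//.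
have c1 : 0 <= L ^+ 2 * (2 * (T + 1)) by rewrite !mulr_ge0 ?sqr_ge0// addr_ge0.
have c2 : 0 <= 4 * (B ^+ 2 * (2 * T)) by rewrite !mulr_ge0 ?sqr_ge0.
move=> t; rewrite wgtE; case: ifPn => [t1|_].
  have T10 : 0 <= T + 1 by rewrite addr_ge0.
  have Lt0 : 0 <= L * `|t| by rewrite mulr_ge0.
  apply: le_trans (integral_box_sqr Lt0 T10 _ _ _) _.
  - by mfun.
  - by move=> x; apply: le_trans (rL _ _) _; rewrite opprB addrC subrK.
  - by move=> x; apply: lipc_near.
  rewrite lee_fin exprMn mulrAC ler_wpM2r ?sqr_ge0//; lra.
apply: le_trans (energy_le4 _ mr) _.
apply: (@le_trans _ _ (4%:E * (B ^+ 2 * (2 * T))%:E)%E).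
  by rewrite lee_wpmul2l//; exact: integral_box_sqr.
by rewrite -EFinM lee_fin expr1n mulr1; lra.
Qed.

Lemma lipc_nice r : lipc r -> nice r.
Proof.
move=> lr; have [M M0 rM] := lipc_energy lr.
have [mr [B [L [T [B0 L0 T0 rB [rL rT]]]]]] := lr.
split => //; first by apply: le_lt_trans (integral_box_sqr B0 T0 mr rB rT) (ltry _).
exists (M + L + 2 * B); first by rewrite -addrA ltr_pwDl// addr_ge0// mulr_ge0.
split.
  move=> x y; rewrite wgtE; case: ifPn => _.
    apply: le_trans (rL _ _) _; rewrite ler_wpM2r//; lra.
  rewrite mulr1; apply: le_trans (ler_normB _ _) _.
  have := rB x; have := rB y; lra.
move=> t; apply: le_trans (rM t) _; rewrite lee_fin ler_wpM2r ?sqr_ge0//; lra.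
Qed.

Lemma lipc_integrable r : lipc r -> mu.-integrable [set: R] (fun x => (r x)%:E).
Proof.
move=> [mr [B [L [T [B0 L0 T0 rB [rL rT]]]]]].
apply/integrableP; split; first by mfun.
exact: le_lt_trans (integral_box B0 T0 mr rB rT) (ltry _).
Qed.

Lemma lipc_L1_increment r : lipc r -> exists2 M, 0 < M &
  forall h, (\int[mu]_t (`|r t - r (t - h)|)%:E <= (M * wgt h)%:E)%E.
Proof.
move=> [mr [B [L [T [B0 L0 T0 rB [rL rT]]]]]].
have c1 : 0 <= L * (2 * (T + 1)) by rewrite !mulr_ge0// addr_ge0.
have c2 : 0 <= B * (2 * T) by rewrite !mulr_ge0.
exists (1 + L * (2 * (T + 1)) + 2 * (B * (2 * T))).
  by rewrite -addrA ltr_pwDl// addr_ge0// mulr_ge0.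
move=> h; rewrite wgtE; case: ifPn => [h1|_].
  have T10 : 0 <= T + 1 by rewrite addr_ge0.
  have Lt0 : 0 <= L * `|h| by rewrite mulr_ge0.
  apply: le_trans (integral_box Lt0 T10 _ _ _) _.
  - by mfun.
  - by move=> x; apply: le_trans (rL _ _) _; rewrite opprB addrC subrK.
  - by move=> x; apply: lipc_near.
  by rewrite lee_fin mulrAC ler_wpM2r//; lra.
have mr1 : measurable_fun [set: R] (fun t => (`|r t|)%:E) by mfun.
have mr2 : measurable_fun [set: R] (fun t => (`|r (t - h)|)%:E) by mfun.
apply: (@le_trans _ _ (\int[mu]_t ((`|r t|)%:E + (`|r (t - h)|)%:E))%E).
  apply: ge0_le_integral => //; first by mfun.
  - by apply: emeasurable_funD.
  - by move=> x _; rewrite -EFinD lee_fin ler_normB.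
rewrite ge0_integralD//.
have -> : (\int[mu]_t (`|r (t - h)|)%:E = \int[mu]_t (`|r t|)%:E)%E.
  have := @ge0_integral_affine _ 1 (- h) _ (oner_neq0 _) mr1 (fun x => _).
  rewrite normr1 invr1 mul1e => <-; last by move=> x; rewrite lee_fin.
  by apply: eq_integral => x _; rewrite mul1r.
have := integral_box B0 T0 mr rB rT => hb.
apply: le_trans (leeD hb hb) _; rewrite -EFinD lee_fin; lra.
Qed.

Lemma lipc_affine r (c d : R) : c != 0 -> lipc r -> lipc (fun x => r (c * x + d)).
Proof.
move=> c0 [mr [B [L [T [B0 L0 T0 rB [rL rT]]]]]]; split; first by mfun.
have cp : 0 < `|c| by rewrite normr_gt0.
exists B, (L * `|c|), ((T + `|d|) / `|c|); split => //.
- by rewrite mulr_ge0.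
- by rewrite divr_ge0// addr_ge0.
split.
  move=> x y; apply: le_trans (rL _ _) _.
  by rewrite opprD addrACA subrr addr0 -mulrBr normrM mulrA.
move=> x; rewrite ltr_pdivrMr// => xT; apply: rT.
have := lerB_normD (c * x) d; rewrite normrM mulrC; lra.
Qed.

Definition conv r u x : R := \int[mu]_t (r t * u (x - t)).

Lemma measurable_conv r u : measurable_fun setT r -> measurable_fun setT u ->
  measurable_fun setT (conv r u).
Proof.
move=> mr mu'; apply: (measurable_Rintegral2 (F := fun x t => r t * u (x - t))).
by mfun.
Qed.

Lemma reflect_integral f (x : R) : mu.-integrable [set: R] (fun y => (f y)%:E) ->
  \int[mu]_t f (x - t) = \int[mu]_y f y.
Proof.
move=> fi; rewrite /Rintegral; congr fine.
have := @integral_affine _ (- 1) x _ (_ : - 1 != 0) fi.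
rewrite oppr_eq0 oner_neq0 normrN normr1 invr1 mul1e => /(_ isT) <-.
by apply: eq_integral => t _; rewrite mulN1r addrC.
Qed.

(** Puts the variable x on the kernel, so that differences of values of the convolution become u
    tested against increments of r. *)
Lemma convE r u x : lipc r -> measurable_fun setT u -> (sqn u < +oo)%E ->
  conv r u x = \int[mu]_y (u y * r (x - y)).
Proof.
move=> lr mu' uo.
have lr' : lipc (fun y => r (x - y)).
  have := @lipc_affine r (- 1) x; rewrite oppr_eq0 oner_neq0 => /(_ isT lr).
  by under eq_fun do rewrite mulN1r addrC.
have [mr' ro _] := lipc_nice lr'.
rewrite -(reflect_integral x); last exact: integrable_mul.
by apply: eq_Rintegral => t _; rewrite subKr mulrC.
Qed.

Lemma lipc_reflect r x : lipc r -> lipc (fun y => r (x - y)).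
Proof.
move=> lr; have := @lipc_affine r (- 1) x; rewrite oppr_eq0 oner_neq0 => /(_ isT lr).
by under eq_fun do rewrite mulN1r addrC.
Qed.

Lemma conv_integrable r u x : lipc r -> measurable_fun setT u -> (sqn u < +oo)%E ->
  mu.-integrable [set: R] (fun t => (r t * u (x - t))%:E).
Proof.
move=> lr mu' uo; have [mr ro _] := lipc_nice lr.
apply: integrable_mul => //; first by mfun.
have -> : (fun t => u (x - t)) = (fun t => u (- 1 * t + x)).
  by apply/funext => t; rewrite mulN1r addrC.
by rewrite sqn_affine ?oppr_eq0 ?oner_neq0// normrN normr1 invr1 mul1e.
Qed.

Lemma young_le (k : R -> R) (F : R -> R -> R) (K : R) (e : \bar R) :
  measurable_fun setT k -> measurable_fun setT (fun p : R * R => F p.1 p.2) ->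
  0 < K -> (\int[mu]_t (`|k t|)%:E <= K%:E)%E -> (0 <= e)%E ->
  (forall t, sqn (fun x => F x t) <= e)%E ->
  (sqn (fun x => \int[mu]_t (k t * F x t))%R <= (K ^+ 2)%:E * e)%E.
Proof.
move=> mk mF K0 kK e0 Fe; apply: le_trans (young mk mF K0 kK) _.
rewrite expr2 EFinM -muleA lee_pmul2l//.
apply: (@le_trans _ _ (\int[mu]_t ((`|k t|)%:E * e))%E).
  apply: ge0_le_integral => //.
  - by move=> t _; rewrite mule_ge0// sqn_ge0.
  - apply: emeasurable_funM; first by mfun.
    apply: (@measurable_integral2 _ (fun p => (F p.2 p.1 ^+ 2)%:E)).
    apply/measurable_EFinP; apply: measurable_funX.
    exact: (measurableT_comp (f := fun p : R * R => F p.1 p.2) mF (measurable_fun_pair measurable_snd measurable_fst)).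
  - by apply: emeasurable_funM => //; mfun.
  - by move=> t _; rewrite lee_wpmul2l.
rewrite ge0_integralZr//; last by mfun.
by rewrite lee_wpmul2r.
Qed.

(** All regularity comes from r: pointwise increments pair u with an L^2 increment of r, and L^2
    increments follow from Young's inequality with the L^1 increment of r as kernel. *)
Lemma conv_nice r u : lipc r -> measurable_fun setT u -> (sqn u < +oo)%E ->
  nice (conv r u).
Proof.
move=> lr mu' uo; have [mr _] := lr.
have uf : sqn u \is a fin_num by rewrite ge0_fin_numE// sqn_ge0.
have un t : sqn (fun x => u (x - t)) = sqn u by exact: sqn_shift.
have [N N0 rN] := lipc_L1_increment lr.
have [M M0 rM] := lipc_energy lr.
pose K := 1 + fine (\int[mu]_t (`|r t|)%:E)%E.
have I0 : (0 <= \int[mu]_t (`|r t|)%:E)%E by apply: integral_ge0 => t _; rewrite lee_fin.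
have K0 : 0 < K by rewrite ltr_pwDl// fine_ge0.
have rK : (\int[mu]_t (`|r t|)%:E <= K%:E)%E.
  rewrite /K EFinD fineK; first by rewrite leeDr.
  by rewrite ge0_fin_numE//; have /integrableP[] := lipc_integrable lr.
have mF : measurable_fun setT (fun p : R * R => u (p.1 - p.2)) by mfun.
split.
- exact: measurable_conv.
- apply: le_lt_trans (young_le (F := fun x t => u (x - t)) mr mF K0 rK (sqn_ge0 u) _) _.
    by move=> t; rewrite un.
  by rewrite lte_mul_pinfty ?lee_fin ?sqr_ge0.
pose S := fine (sqn u); have S0 : 0 <= S by rewrite fine_ge0// sqn_ge0.
exists ((S + M) + N ^+ 2 * S); first by rewrite ltr_pwDl ?ltr_wpDl// mulr_ge0// sqr_ge0.
split.
- move=> x y; have [->|xy] := eqVneq x y.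
    by rewrite !subrr normr0 mulr_ge0 ?wgt_ge0// !addr_ge0 ?mulr_ge0 ?sqr_ge0// ltW.
  have w0 : 0 < wgt (x - y) by rewrite wgt_gt0// subr_eq0.
  have mx : measurable_fun setT (fun z => r (x - z)) by mfun.
  have mxy : measurable_fun setT (fun z => r (x - z) - r (y - z)) by mfun.
  have [_ rxo _] := lipc_nice (lipc_reflect x lr).
  have [_ ryo _] := lipc_nice (lipc_reflect y lr).
  rewrite !convE// -RintegralB//; last 2 first.
  - by apply: integrable_mul => //; mfun.
  - by apply: integrable_mul => //; mfun.
  have -> : \int[mu]_z (u z * r (x - z) - u z * r (y - z)) = \int[mu]_z (u z * (r (x - z) - r (y - z))).
    by apply: eq_Rintegral => z _; rewrite mulrBr.
  (* The reflection z -> x - z identifies this norm with an energy of r. *)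
  have sE : sqn (fun z => r (x - z) - r (y - z)) = energy r (x - y).
    rewrite /energy -[RHS](_ : sqn (fun z => r (- 1 * z + x) - r (- 1 * z + x - (x - y))) = _); last first.
      rewrite (sqn_affine x (f := fun z => r z - r (z - (x - y)))) ?oppr_eq0 ?oner_neq0//; last by mfun.
      by rewrite normrN normr1 invr1 mul1e.
    congr sqn; apply/funext => z; rewrite mulN1r (addrC _ x); congr (_ - r _); ring.
  have ii : mu.-integrable [set: R] (fun z => (u z * (r (x - z) - r (y - z)))%:E).
    by apply: integrable_mul => //; rewrite sE; apply: le_lt_trans (rM _) (ltry _).
  rewrite -lee_fin EFin_normr_Rintegral//.
  apply: le_trans (le_abse_integral _ _ (measurable_int _ ii)) _ => //.
  apply: le_trans (integral_mul_le w0 mu' mxy) _; rewrite sE.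
  apply: (@le_trans _ _ ((wgt (x - y) / 2 * S)%:E + ((wgt (x - y))^-1 / 2)%:E * (M * wgt (x - y) ^+ 2)%:E)%E).
    rewrite (EFinM _ S) /S fineK// leeD2l// lee_wpmul2l// lee_fin divr_ge0// invr_ge0 ltW//.
  rewrite -EFinM -EFinD lee_fin.
  have -> : wgt (x - y) / 2 * S + (wgt (x - y))^-1 / 2 * (M * wgt (x - y) ^+ 2) = (S + M) / 2 * wgt (x - y).
    by field; rewrite gt_eqF.
  rewrite ler_wpM2r ?(ltW w0)//; have : 0 <= N ^+ 2 * S by rewrite mulr_ge0// sqr_ge0.
  have := S0; have := M0; lra.
- move=> h; have [->|h0] := eqVneq h 0.
    by rewrite energy0 lee_fin mulr_ge0 ?sqr_ge0// !addr_ge0 ?mulr_ge0 ?sqr_ge0// ltW.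
  have w0 : 0 < wgt h by rewrite wgt_gt0.
  have Nw0 : 0 < N * wgt h by rewrite mulr_gt0.
  have -> : energy (conv r u) h = sqn (fun x => \int[mu]_t ((r t - r (t - h)) * u (x - t))).
    congr sqn; apply/funext => x.
    have lrh : lipc (fun t => r (t - h)).
      have := @lipc_affine r 1 (- h); rewrite oner_neq0 => /(_ isT lr).
      by under eq_fun do rewrite mul1r.
    have -> : conv r u (x - h) = conv (fun t => r (t - h)) u x.
      rewrite !convE//; apply: eq_Rintegral => y _; congr (_ * r _); ring.
    rewrite /conv -RintegralB//; [|exact: conv_integrable..].
    by apply: eq_Rintegral => t _; rewrite mulrBl.
  have mk : measurable_fun setT (fun t => r t - r (t - h)) by mfun.
  apply: le_trans (young_le (F := fun x t => u (x - t)) mk mF Nw0 (rN h) (sqn_ge0 u) _) _.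
    by move=> t; rewrite un.
  rewrite -(fineK uf) -/S -EFinM lee_fin exprMn mulrAC ler_wpM2r ?sqr_ge0//.
  by have := S0; have := M0; lra.
Qed.

End Convolution.

(** * Calculus of test functions *)

Section TestFunctions.
Context {R : realType}.
Local Notation mu := (@lebesgue_measure R).
Implicit Types (t x y z h : R) (f g phi u v : R -> R).

Lemma is_derive_affine f (c d : R) x : derivable f (c * x + d) 1 ->
  is_derive x 1 (fun y => f (c * y + d)) (c * f^`()%classic (c * x + d)).
Proof.
move=> df; rewrite mulrC.
have l : is_derive x 1 (fun y : R => c * y + d) c.
  have -> : (fun y : R => c * y + d) = (c \*: (id : R -> R)) + cst d by apply/funext.
  by apply: is_derive_eq; rewrite addr0 /GRing.scale/= mulr1.
apply: (@is_derive1_comp _ f (fun y => c * y + d)) => //.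
by apply: DeriveDef => //; rewrite derive1E.
Qed.

Lemma derive1_affine f (c d : R) x : derivable f (c * x + d) 1 ->
  (fun y => f (c * y + d))^`()%classic x = c * f^`()%classic (c * x + d).
Proof. by move=> /is_derive_affine h; rewrite derive1E derive_val. Qed.

Definition smooth f := forall n x, derivable (f^`(n))%classic x 1.

Lemma smooth_derivable f x : smooth f -> derivable f x 1.
Proof. by move=> /(_ 0%N x). Qed.

Lemma smooth_derive1 f : smooth f -> smooth (f^`()%classic).
Proof. by move=> sf n x; rewrite -derive1Sn. Qed.

Lemma smooth_continuous f : smooth f -> continuous f.
Proof.
by move=> sf x; apply: differentiable_continuous; apply/derivable1_diffP; exact: smooth_derivable.
Qed.

Lemma derive1n_affine f (c d : R) n : smooth f ->
  ((fun y => f (c * y + d))^`(n))%classic = (fun y => c ^+ n * (f^`(n))%classic (c * y + d)).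
Proof.
move=> sf; elim: n => [|n ih]; first by apply/funext => y; rewrite !derive1n0 expr0 mul1r.
apply/funext => y; rewrite derive1nS ih derive1Ml; last first.
  by apply: ex_derive; apply: is_derive_affine; exact: sf.
by rewrite derive1_affine// mulrA -exprSr derive1nS.
Qed.

Lemma smooth_affine f (c d : R) : smooth f -> smooth (fun y => f (c * y + d)).
Proof.
move=> sf n x; rewrite derive1n_affine//; apply: derivableM; first exact: derivable_cst.
by apply: ex_derive; apply: is_derive_affine; exact: sf.
Qed.

Lemma continuous_reflected f (s x : R) : smooth f -> continuous (fun y => s * f (x - s * y)).
Proof.
move=> sf y; apply: differentiable_continuous; apply/derivable1_diffP.
apply: derivableM; first exact: derivable_cst.
have -> : (fun y => f (x - s * y)) = (fun y => f (- s * y + x)).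
  by apply/funext => z; rewrite mulNr addrC.
by apply: ex_derive; apply: is_derive_affine; exact: smooth_derivable.
Qed.

Definition vanishes_beyond (T : R) f := forall x, T < `|x| -> f x = 0.

(** The region T < |x| is open, so f agrees with 0 near each of its points. *)
Lemma vanishes_derive1 T f : vanishes_beyond T f -> vanishes_beyond T (f^`()%classic).
Proof.
move=> fT x xT; rewrite derive1E (near_eq_derive (g := cst 0)) ?derive_cst//.
have : \forall y \near x, T < `|y|.
  by have /cvgr_gt := @norm_continuous _ _ x; apply.
by apply: filterS => y /fT.
Qed.

Lemma continuous_vanishes_bounded T f : 0 <= T -> continuous f -> vanishes_beyond T f ->
  exists2 B, 0 <= B & forall x, `|f x| <= B.
Proof.
move=> T0 cf fT.
have TT : - T <= T by rewrite ge0_cp.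
have [|c _ cM] := @EVT_max R (fun x => `|f x|) _ _ TT.
  apply: continuous_subspaceT => x; apply: continuous_comp; [exact: cf|exact: norm_continuous].
exists `|f c| => // x; case: (leP `|x| T) => [xT|/fT ->]; last by rewrite normr0.
by apply: cM; rewrite in_itv/= -ler_norml.
Qed.

Lemma lipschitz_of_derive f (L : R) : (forall x, derivable f x 1) ->
  (forall x, `|f^`()%classic x| <= L) -> forall x y, `|f x - f y| <= L * `|x - y|.
Proof.
move=> df fL; have main x y : x <= y -> `|f y - f x| <= L * `|y - x|.
  move=> xy; have [||c _ ->] := @MVT_segment R f (f^`()%classic) x y xy.
  - by move=> z _; apply: DeriveDef => //; rewrite derive1E.
  - by apply: derivable_within_continuous.
  by rewrite normrM ler_wpM2r.
move=> x y; have [xy|/ltW yx] := leP x y; last exact: main.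
by rewrite distrC [X in _ * X]distrC main.
Qed.

Lemma smooth_lipc T f : 0 <= T -> smooth f -> vanishes_beyond T f -> lipc f.
Proof.
move=> T0 sf fT; have cf := smooth_continuous sf.
split; first exact: continuous_measurable_fun.
have [B B0 fB] := continuous_vanishes_bounded T0 cf fT.
have [L L0 fL] := continuous_vanishes_bounded T0 (smooth_continuous (smooth_derive1 sf)) (vanishes_derive1 fT).
exists B, L, T; split => //; split => //.
by apply: lipschitz_of_derive => // x; exact: smooth_derivable.
Qed.

(** Heine-Borel: a compact support is a bounded one, which is the form that the estimates use. *)
Lemma test_functionP phi : test_function phi <->
  smooth phi /\ exists2 T, 0 <= T & vanishes_beyond T phi.
Proof.
split=> [[sf /compact_bounded[M [_ cM]]]|[sf [T T0 fT]]]; split => //.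
  exists (`|M| + 1); first by rewrite addr_ge0.
  move=> x xM; apply/eqP; apply: contraTT xM => fx; rewrite -leNgt.
  apply: (cM (`|M| + 1)); first by rewrite ltr_pwDr// ler_norm.
  by apply: subset_closure.
apply: (@subclosed_compact _ _ `[- T, T]%classic); [exact: closed_closure|exact: segment_compact|].
rewrite [X in _ `<=` X](closure_id _).1; last exact: itv_closed.
apply: closureS => x /= fx; rewrite in_itv/= -ler_norml leNgt.
by apply: contra fx => /fT ->.
Qed.

Lemma test_function_affine phi (c d : R) : c != 0 -> test_function phi ->
  test_function (fun x => phi (c * x + d)).
Proof.
move=> c0 /test_functionP[sf [T T0 fT]]; apply/test_functionP.
have cp : 0 < `|c| by rewrite normr_gt0.
split; first exact: smooth_affine.
exists ((T + `|d|) / `|c|); first by rewrite divr_ge0// addr_ge0.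
move=> x; rewrite ltr_pdivrMr// => xT; apply: fT.
have := lerB_normD (c * x) d; rewrite normrM mulrC; lra.
Qed.

Lemma test_function_lipc phi : test_function phi -> lipc phi.
Proof. by move=> /test_functionP[sf [T T0 fT]]; exact: (smooth_lipc T0). Qed.

End TestFunctions.

(** * One-sided fractional derivatives as Marchaud integrals *)

Section FractionalDerivative.
Context {R : realType}.
Local Notation mu := (@lebesgue_measure R).
Implicit Types (t x y z h : R) (f g phi u v : R -> R).
Context (a : R) (a0 : 0 < a) (a1 : a < 1).
Local Notation k := (pker (- 1 - a)).
Local Notation kap := (pker (- a)).

Lemma integrable_ge0 f : measurable_fun setT f -> (forall t, 0 <= f t) ->
  (\int[mu]_t (f t)%:E < +oo)%E -> mu.-integrable [set: R] (fun t => (f t)%:E).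
Proof.
move=> mf f0 foo; apply/integrableP; split; first by mfun.
by under eq_integral do rewrite gee0_abs ?lee_fin//.
Qed.

Lemma kap_trunc_integrable (T : R) : 0 < T ->
  mu.-integrable [set: R] (fun t => (if t <= T then kap t else 0)%:E).
Proof.
move=> T0; have Tn0 : T^-1 != 0 by rewrite invr_eq0 gt_eqF.
have h : mu.-integrable [set: R] (fun t => (if t <= 1 then kap t else 0)%:E).
  apply: integrable_ge0; last by apply: pker_head_lty; rewrite ltrN2.
    by apply: measurable_fun_ifT => //; [apply: measurable_fun_ler|exact: measurable_pker].
  by move=> t; case: ifP => // _; exact: pker_ge0.
have := integrableZl measurableT ((T^-1 `^ (- a))^-1) (integrable_affine 0 Tn0 h).
apply: eq_integrable => // t _; rewrite addr0 -EFinM; congr EFin.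
rewrite ler_pdivrMl// mulr1; case: ifPn => _; last by rewrite mulr0.
by rewrite pker_scale ?invr_gt0// mulKf// gt_eqF// powR_gt0// invr_gt0.
Qed.

Lemma kap_mul_integrable (s z : R) f (B T : R) : `|s| = 1 -> measurable_fun setT f ->
  0 <= B -> 0 <= T -> (forall x, `|f x| <= B) -> vanishes_beyond T f ->
  mu.-integrable [set: R] (fun t => (kap t * f (z - s * t))%:E).
Proof.
move=> s1 mf B0 T0 fB fT.
have T1 : 0 < T + `|z| + 1 by rewrite ltr_wpDl// addr_ge0.
have ii := kap_trunc_integrable T1.
apply: (@le_integrable _ _ _ mu setT measurableT _ (fun t => (B%:E * (if t <= T + `|z| + 1 then kap t else 0)%:E)%E)) => //.
- by mfun.
- move=> t _; rewrite -EFinM lee_fin/= [leRHS]ger0_norm; last first.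
    by rewrite mulr_ge0//; case: ifP => // _; exact: pker_ge0.
  rewrite normrM (ger0_norm (pker_ge0 _ t)) mulrC.
  case: (leP t (T + `|z| + 1)) => tT; first by rewrite ler_wpM2r ?pker_ge0.
  rewrite fT ?normr0 ?mul0r ?mulr0//.
  have := lerB_dist (s * t) z; rewrite distrC normrM s1 mul1r.
  have := ler_norm t; lra.
- exact: integrableZl.
Qed.

(** The Riemann-Liouville potential without its Gamma factor, in both directions. The variable z
    sits in phi, so differentiation never meets the singular kernel. *)
Definition rl_potential (s : R) phi z : R := \int[mu]_t (kap t * phi (z - s * t)).

Lemma derive_rl_potential (s : R) phi x : `|s| = 1 -> test_function phi ->
  (rl_potential s phi)^`()%classic x = rl_potential s (phi^`()%classic) x.
Proof.
move=> s1 tphi; have /test_functionP[sf [T T0 fT]] := tphi.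
have [mphi [B [_ [_ [B0 _ _ fB _]]]]] := test_function_lipc tphi.
have sf' := smooth_derive1 sf; have fT' := vanishes_derive1 fT.
have [mphi' [B' [_ [_ [B'0 _ _ fB' _]]]]] := smooth_lipc T0 sf' fT'.
pose f z t := kap t * phi (z - s * t).
have df z t : is_derive z 1 (f ^~ t) (kap t * phi^`()%classic (z - s * t)).
  have := @is_derive_affine R phi 1 (- (s * t)) z (smooth_derivable sf).
  rewrite !mul1r => h.
  have -> : f ^~ t = kap t \*: (fun y => phi (1 * y + - (s * t))).
    by apply/funext => y; rewrite /f /GRing.scale/= mul1r.
  exact: is_deriveZ.
have pd z t : partial1of2 f z t = kap t * phi^`()%classic (z - s * t).
  by rewrite partial1of2E; have [_ ->] := df z t.
(* For z within distance 1 of x the integrand vanishes once t > T', so a single integrable majorant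
   serves the whole neighbourhood. *)
pose T' := T + `|x| + 2.
have T'0 : 0 < T' by rewrite /T' ltr_wpDl// addr_ge0.
pose G t := B' * (if t <= T' then kap t else 0).
have xI : `]x - 1, x + 1[%classic x by rewrite /= in_itv/= ltrBlDr ltrDl ltr01.
have intG : mu.-integrable [set: R] (EFin \o G).
  have := integrableZl measurableT B' (kap_trunc_integrable T'0).
  by apply: eq_integrable => // t _; rewrite /G EFinM.
have := @differentiation_under_integral R _ _ mu f setT measurableT x (x - 1) (x + 1) xI _ _ G _ intG _.
rewrite /rl_potential => ->.
- by apply: eq_Rintegral => t _; rewrite pd.
- by move=> z _; exact: (kap_mul_integrable z s1 mphi B0 T0 fB fT).
- by move=> z t _ _; have [] := df z t.
- by move=> t; rewrite /G mulr_ge0//; case: ifP => // _; exact: pker_ge0.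
- move=> z t /=; rewrite in_itv/= => /andP[xz zx] _; rewrite pd /G.
  rewrite normrM (ger0_norm (pker_ge0 _ t)) mulrC.
  case: (leP t T') => tT; first by rewrite ler_wpM2r ?pker_ge0.
  rewrite fT' ?normr0 ?mul0r ?mulr0//.
  have := lerB_dist (s * t) z; rewrite distrC normrM s1 mul1r.
  have : `|z| < `|x| + 1.
    rewrite -ltrBlDl; apply: le_lt_trans (lerB_dist _ _) _.
    rewrite ltr_norml; apply/andP; split; lra.
  rewrite /T' in tT; have := ler_norm t; lra.
Qed.

Lemma integral_tail_kernel y : 0 < y ->
  (\int[mu]_t (if y < t then a * k t else 0)%:E = (kap y)%:E)%E.
Proof.
move=> y0; rewrite pkerE// -(integral_powR_tail a0 y0) [RHS]integral_mkcond.
apply: eq_integral => t _; rewrite patchE mem_setE in_itv/= andbT.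
by case: ifPn => // yt; rewrite pkerE// (lt_trans y0 yt).
Qed.

Lemma increment_integral (s : R) phi x t : test_function phi -> 0 < t ->
  (\int[mu]_(y in `]0%R, t[) (s * phi^`()%classic (x - s * y))%:E = (phi x - phi (x - s * t))%:E)%E.
Proof.
move=> tphi t0; have /test_functionP[sf [T T0 fT]] := tphi.
have sf' := smooth_derive1 sf.
have cpsi : continuous (fun y => s * phi^`()%classic (x - s * y)).
  exact: continuous_reflected.
have dF y : is_derive y 1 (fun y => - phi (x - s * y)) (s * phi^`()%classic (x - s * y)).
  have := @is_derive_affine R phi (- s) x y (smooth_derivable sf).
  rewrite mulNr => h.
  have -> : (fun y => - phi (x - s * y)) = - (fun y => phi (- s * y + x)).
    by apply/funext => y'; rewrite fctE mulNr addrC.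
  rewrite -[X in is_derive _ _ _ X]opprK; apply: is_deriveN.
  have e : - s * y + x = x - s * y by rewrite mulNr addrC.
  by rewrite e in h.
rewrite -(@integral_itv_bndoo _ _ _ _ true false); last first.
  by apply/measurable_EFinP; apply: measurable_funTS; exact: continuous_measurable_fun.
rewrite (@continuous_FTC2 _ _ (fun y => - phi (x - s * y)))//.
- by rewrite -EFinB mulr0 subr0 opprK addrC.
- exact: continuous_subspaceT.
- have cF : continuous (fun y => - phi (x - s * y)).
    move=> y; apply: differentiable_continuous; apply/derivable1_diffP.
    by have [] := dF y.
  split.
  + by move=> y _; have [] := dF y.
  + by apply: cvg_at_right_filter; exact: cF.
  + by apply: cvg_at_left_filter; exact: cF.
- by move=> y _; rewrite derive1E; have [_ ->] := dF y.
Qed.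

(* Fubini, after writing y^(-a) as the integral of a t^(-1-a) over t > y. *)
Lemma rl_potential_marchaud (s : R) phi x : `|s| = 1 -> test_function phi ->
  s * rl_potential s (phi^`()%classic) x = a * marchaud a s phi x.
Proof.
move=> s1 tphi; have /test_functionP[sf [T T0 fT]] := tphi.
have sf' := smooth_derive1 sf; have fT' := vanishes_derive1 fT.
have [mphi' [B' [_ [_ [B'0 _ _ fB' _]]]]] := smooth_lipc T0 sf' fT'.
have np := lipc_nice (test_function_lipc tphi).
have ik := kap_mul_integrable x s1 mphi' B'0 T0 fB' fT'.
have im := marchaud_integrable a0 a1 s1 x np.
pose psi y := s * phi^`()%classic (x - s * y).
have mpsi : measurable_fun [set: R] psi by rewrite /psi; mfun.
(* Supported on 0 < y < t. Integrating in t first produces the potential of the derivative;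
   integrating in y first produces the increment of phi. *)
pose H t y := (if y < t then a * k t else 0) * (if 0 < y then psi y else 0).
have mH : measurable_fun setT (fun p : R * R => H p.1 p.2).
  rewrite /H; apply: measurable_funM; apply: measurable_fun_ifT => //.
  - by apply: measurable_fun_ltr; [exact: measurable_snd|exact: measurable_fst].
  - by mfun.
  - by apply: measurable_fun_ltr => //; exact: measurable_snd.
  - by mfun.
have HE y : (\int[mu]_t (H t y)%:E = (kap y * psi y)%:E)%E.
  rewrite /H; case: (ltP 0 y) => y0; last first.
    by rewrite pker0// mul0r integral0_eq// => t _; rewrite mulr0.
  under eq_integral do rewrite EFinM muleC.
  have mt : measurable_fun [set: R] (fun t => (if y < t then a * k t else 0)%:E).
    apply/measurable_EFinP; apply: measurable_fun_ifT => //; first by apply: measurable_fun_ltr.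
    by mfun.
  have tk := integral_tail_kernel y0.
  rewrite integralZl//.
    by rewrite tk -EFinM mulrC.
  apply: integrable_ge0; last by rewrite tk ltry.
    exact/measurable_EFinP.
  by move=> t; case: ifP => // _; rewrite mulr_ge0 ?pker_ge0// ltW.
(* The factor depending on t is nonnegative, so taking absolute values changes nothing in the
   t-integral and integrability reduces to that of the potential. *)
have absH y : (\int[mu]_t (`|H t y|)%:E = (`|kap y * psi y|)%:E)%E.
  rewrite /H; case: (ltP 0 y) => y0; last first.
    by rewrite pker0// mul0r normr0 integral0_eq// => t _; rewrite mulr0 normr0.
  have c0 t : 0 <= (if y < t then a * k t else 0).
    by case: ifP => // _; rewrite mulr_ge0 ?pker_ge0// ltW.
  under eq_integral do rewrite normrM mulrC EFinM (ger0_norm (c0 _)).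
  rewrite ge0_integralZl//; last 2 first.
  - apply/measurable_EFinP; apply: measurable_fun_ifT => //; first by apply: measurable_fun_ltr.
    by mfun.
  - by move=> t _; rewrite lee_fin.
  by rewrite integral_tail_kernel// -EFinM (normrM (kap y)) (ger0_norm (pker_ge0 _ y)) mulrC.
have ipsi : mu.-integrable [set: R] (fun y => (kap y * psi y)%:E).
  have := integrableZl measurableT s ik.
  by apply: eq_integrable => // y _; rewrite -EFinM /psi mulrCA.
have Hoo : (\int[mu]_t \int[mu]_y (`|H t y|)%:E < +oo)%E.
  rewrite (tonelli (F := fun t y => (`|H t y|)%:E))//; last by mfun.
  under eq_integral do rewrite absH.
  by have /integrableP[] := ipsi.
have := fubini_int mH Hoo.
under [X in _ = X -> _]eq_integral do rewrite HE.
have -> : (\int[mu]_t \int[mu]_y (H t y)%:E = \int[mu]_t (a%:E * (k t * (phi x - phi (x - s * t)))%:E))%E.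
  apply: eq_integral => t _; rewrite /H; case: (ltP 0 t) => t0; last first.
    rewrite (pker0 _ t0) !mul0r mule0 integral0_eq// => y _.
    by rewrite mulr0 if_same mul0r.
  transitivity ((a * k t)%:E * (phi x - phi (x - s * t))%:E)%E; last by rewrite -!EFinM mulrA.
  rewrite -(increment_integral s x tphi t0) [in RHS]integral_mkcond.
  have ip : mu.-integrable [set: R] ((fun y => (psi y)%:E) \_ `]0, t[).
    apply/integrable_restrict => //; rewrite setTI.
    apply: (@integrableS _ _ _ mu `[0, t]%classic) => //.
      by apply: subset_itv; rewrite bnd_simp.
    apply: continuous_compact_integrable; first exact: segment_compact.
    by apply: continuous_subspaceT; exact: continuous_reflected.
  rewrite -integralZl//; apply: eq_integral => y _.
  rewrite patchE mem_setE in_itv/=.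
  by case: (0 < y); case: (y < t); rewrite /= ?mule0 ?mulr0 ?mul0r// EFinM.
rewrite integralZl// => e.
have -> : s * rl_potential s phi^`()%classic x = \int[mu]_y (kap y * psi y).
  rewrite /rl_potential -RintegralZl//; apply: eq_Rintegral => y _.
  by rewrite /psi mulrCA.
by rewrite /Rintegral -e fineM//; exact: integrable_fin_num im.
Qed.

Lemma left_potential phi z : test_function phi ->
  \int[mu]_(y in `]-oo, z[) (phi y / (z - y) `^ a) = rl_potential 1 phi z.
Proof.
move=> tphi; have /test_functionP[sf [T T0 fT]] := tphi.
have [mphi [B [_ [_ [B0 _ _ fB _]]]]] := test_function_lipc tphi.
rewrite Rintegral_mkcond.
have ii : mu.-integrable [set: R] (fun y => (kap (z - y) * phi y)%:E).
  have := kap_mul_integrable z (normr1 _) mphi B0 T0 fB fT.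
  have N0 : (- 1 : R) != 0 by rewrite oppr_eq0 oner_neq0.
  move=> /(integrable_affine z N0); apply: eq_integrable => // y _.
  by rewrite mul1r mulN1r (addrC _ z) subKr.
rewrite /rl_potential; under [RHS]eq_Rintegral do rewrite mul1r.
have := reflect_integral z ii => /= e.
transitivity (\int[mu]_y (kap (z - y) * phi y)); last first.
  by rewrite -e; apply: eq_Rintegral => t _; rewrite subKr.
apply: eq_Rintegral => y _; rewrite patchE mem_setE in_itv/=.
case: ifPn => yz; last by rewrite pker0 ?mul0r// subr_le0 leNgt.
by rewrite pkerE ?subr_gt0// powRN mulrC.
Qed.

Lemma right_potential phi z : test_function phi ->
  \int[mu]_(y in `]z, +oo[) (phi y / (y - z) `^ a) = rl_potential (- 1) phi z.
Proof.
move=> tphi; have /test_functionP[sf [T T0 fT]] := tphi.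
have [mphi [B [_ [_ [B0 _ _ fB _]]]]] := test_function_lipc tphi.
have N1 : `|- 1 : R| = 1 by rewrite normrN normr1.
rewrite Rintegral_mkcond.
have ii : mu.-integrable [set: R] (fun y => (kap (y - z) * phi y)%:E).
  have := kap_mul_integrable z N1 mphi B0 T0 fB fT.
  move=> /(integrable_affine (- z) (oner_neq0 _)); apply: eq_integrable => // y _.
  by rewrite mul1r mulN1r opprK (addrC z) subrK.
rewrite /rl_potential.
have := integral_affine z (oner_neq0 _) ii; rewrite normr1 invr1 mul1e => e.
transitivity (\int[mu]_y (kap (y - z) * phi y)); last first.
  rewrite /Rintegral -e; congr fine; apply: eq_integral => t _.
  by rewrite mul1r mulN1r opprK addrK addrC.
apply: eq_Rintegral => y _; rewrite patchE mem_setE in_itv/= andbT.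
case: ifPn => yz; last by rewrite pker0 ?mul0r// subr_le0 leNgt.
by rewrite pkerE ?subr_gt0// powRN mulrC.
Qed.

Definition fracD_cst : R := (Gamma (1 - a))^-1 * a.

Lemma left_fracDE phi x : test_function phi ->
  left_fracD a phi x = fracD_cst * marchaud a 1 phi x.
Proof.
move=> tphi; rewrite /left_fracD /fracD_cst -mulrA -rl_potential_marchaud ?normr1//.
have -> : (fun z => \int[mu]_(y in `]-oo, z[) (phi y / (z - y) `^ a)) = rl_potential 1 phi.
  by apply/funext => z; exact: left_potential.
by rewrite mul1r -derive_rl_potential ?normr1.
Qed.

(** The minus sign in the right derivative is the factor s = -1 of [rl_potential_marchaud]. *)
Lemma right_fracDE phi x : test_function phi ->
  right_fracD a phi x = fracD_cst * marchaud a (- 1) phi x.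
Proof.
move=> tphi; rewrite /right_fracD /fracD_cst -mulrA -rl_potential_marchaud ?normrN ?normr1//.
have -> : (fun z => \int[mu]_(y in `]z, +oo[) (phi y / (y - z) `^ a)) = rl_potential (- 1) phi.
  by apply/funext => z; exact: right_potential.
by rewrite -derive_rl_potential ?normrN ?normr1// mulN1r mulrN mulNr.
Qed.

(** [Gamma] is a real-valued integral, which would be 0 if the integral diverged; positivity
    therefore needs a finite upper bound as well as a lower one. *)
Lemma Gamma_onem_gt0 : 0 < Gamma (1 - a).
Proof.
rewrite /Gamma Rintegral_mkcond.
pose f t := kap t * expR (- t).
have -> : \int[mu]_x ((fun t : R => t `^ (1 - a - 1) * expR (- t)) \_ `]0, +oo[) x = \int[mu]_t f t.
  apply: eq_Rintegral => t _; rewrite patchE mem_setE in_itv/= andbT /f.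
  case: ifPn => t0; last by rewrite pker0 ?mul0r// leNgt.
  by rewrite pkerE//; congr (_ `^ _ * _); ring.
have f0 t : 0 <= f t by rewrite mulr_ge0 ?pker_ge0 ?expR_ge0.
have mf : measurable_fun [set: R] f.
  apply: measurable_funM; first exact: measurable_pker.
  by apply: measurableT_comp; [exact: measurable_expR|exact: measurable_funN].
have f_ge : ((expR (- 1))%:E <= \int[mu]_t (f t)%:E)%E.
  apply: (@le_trans _ _ (\int[mu]_(t in `]0%R, 1%R]) (cst (expR (- 1))%:E t)))%E.
    by rewrite integral_cst//= lebesgue_measure_itv/= lte01 sube0 mule1.
  apply: (@le_trans _ _ (\int[mu]_(t in `]0%R, 1%R]) (f t)%:E)%E); last first.
    by apply: ge0_subset_integral => //; [mfun|move=> t _; rewrite lee_fin].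
  apply: ge0_le_integral => //.
  - by move=> t _; rewrite lee_fin expR_ge0.
  - by apply/measurable_EFinP; exact: measurable_funTS.
  - move=> t /=; rewrite in_itv/= => /andP[t0 t1]; rewrite lee_fin /f -[leLHS]mul1r.
    rewrite ler_pM ?expR_ge0// ?ler_expR ?lerN2// pkerE//.
    apply: le_trans (_ : t `^ 0 <= _); first by rewrite powRr0.
    by apply: ger_powR; rewrite ?t0// oppr_le0 ltW.
have mh : measurable_fun [set: R] (fun t : R => if t <= 1 then kap t else 0).
  by apply: measurable_fun_ifT => //; [apply: measurable_fun_ler|exact: measurable_pker].
have mt : measurable_fun [set: R] (fun t : R => if 1 < t then pker (- 1 - 1) t else 0).
  by apply: measurable_fun_ifT => //; [apply: measurable_fun_ltr|exact: measurable_pker].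
have h0 t : 0 <= (if t <= 1 then kap t else 0) by case: ifP => // _; exact: pker_ge0.
have t0 t : 0 <= (if 1 < t then pker (- 1 - 1) t else 0) by case: ifP => // _; exact: pker_ge0.
(* Below 1 the exponential is at most 1; above 1 it is at most 2 t^(-2), from exp t >= 1 + t^2 /
   2. *)
have f_lty : (\int[mu]_t (f t)%:E < +oo)%E.
  apply: (@le_lt_trans _ _ (\int[mu]_t (if (t <= 1)%R then kap t else 0%R)%:E
    + 2%:E * \int[mu]_t (if (1 < t)%R then pker (- 1 - 1) t else 0%R)%:E)%E); last first.
    apply: lte_add_pinfty; first by rewrite pker_head_lty// ltrN2.
    by rewrite lte_mul_pinfty// pker_tail_lty.
  rewrite -ge0_integralZl; [|exact: measurableT|exact/measurable_EFinP|by move=> t _; rewrite lee_fin|by []].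
  rewrite -ge0_integralD; [|exact: measurableT|by move=> t _; rewrite lee_fin|exact/measurable_EFinP
    |by move=> t _; rewrite -EFinM lee_fin mulr_ge0|by apply: emeasurable_funM => //; exact/measurable_EFinP].
  apply: ge0_le_integral; [exact: measurableT|by move=> t _; rewrite lee_fin|exact/measurable_EFinP| |].
    by apply: emeasurable_funD; [|apply: emeasurable_funM => //]; exact/measurable_EFinP.
  move=> t _; rewrite -EFinM -EFinD lee_fin /f; case: (ltP 0 t) => tp; last first.
    by rewrite !pker0// mul0r !if_same mulr0 addr0.
  case: (ltP 1 t) => t1.
    rewrite add0r !pkerE//; apply: (@le_trans _ _ (1 * (2 * t `^ (- 1 - 1)))); last by rewrite mul1r.
    rewrite ler_pM ?powR_ge0 ?expR_ge0//.
      apply: le_trans (_ : _ <= t `^ 0) _; last by rewrite powRr0.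
      by apply: ler_powR; rewrite ?(ltW t1)// oppr_le0 ltW.
    have -> : - 1 - 1 = - 2 :> R by ring.
    rewrite powR_invn ?(ltW tp)// expRN -[leRHS]invrK invfM invrK lef_pV2 ?posrE ?expR_gt0 ?mulr_gt0 ?invr_gt0 ?exprn_gt0//.
    have := @expR_ge1Dxn R t 1 (ltW tp); have := sqr_ge0 t; rewrite /factorial/=.
    rewrite (_ : (2 * 1)%N%:R = 2 :> R)// mulrC; lra.
  by rewrite mulr0 addr0 ler_piMr ?pker_ge0// expR_le1 oppr_le0 ltW.
have : (0 < \int[mu]_t (f t)%:E)%E by apply: lt_le_trans f_ge; rewrite lte_fin expR_gt0.
by move=> p; rewrite /Rintegral fine_gt0// p f_lty.
Qed.

Lemma fracD_cst_gt0 : 0 < fracD_cst.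
Proof. by rewrite mulr_gt0// invr_gt0 Gamma_onem_gt0. Qed.

End FractionalDerivative.

(** * Construction of smooth mollifiers *)

Section Mollifier.
Context {R : realType}.
Local Notation mu := (@lebesgue_measure R).
Implicit Types (t x y z h : R) (p q : {poly R}).

(** Positive exactly on ]0, 1[; the basic bump is exp (-1 / W) there. *)
Let W : {poly R} := 'X * (1 - 'X).

Let WE x : W.[x] = x * (1 - x).
Proof. by rewrite /W hornerM hornerD hornerN !hornerE. Qed.

(* As p and m vary, this family is closed under differentiation. *)
Definition bumpf p (m : nat) x : R :=
  if 0 < W.[x] then p.[x] * W.[x]^-1 ^+ m * expR (- W.[x]^-1) else 0.

(** One term of the exponential series at 1 / W, of order m + 2, beats W^(-m) and leaves two powers
    of W to spare. *)
Let exp_decay m y : 0 < W.[y] -> W.[y]^-1 ^+ m * expR (- W.[y]^-1) <= m.+2`!%:R * W.[y] ^+ 2.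
Proof.
move=> W0; set v := W.[y]; have v0 : 0 < v by [].
have vi : 0 <= v^-1 by rewrite invr_ge0 ltW.
have := @expR_ge1Dxn R v^-1 m.+1 vi.
have f0 : 0 < m.+2`!%:R :> R by rewrite ltr0n fact_gt0.
have h1 : v^-1 ^+ m.+2 / m.+2`!%:R <= 1 + v^-1 ^+ m.+2 / m.+2`!%:R by rewrite lerDr.
move=> /(le_trans h1); rewrite ler_pdivrMr// => h2.
rewrite expRN ler_pdivrMr ?expR_gt0//.
have -> : v^-1 ^+ m = v ^+ 2 * v^-1 ^+ m.+2.
  by rewrite -[m.+2]addn2 exprD mulrCA -exprMn mulfV ?gt_eqF// expr1n mulr1.
rewrite [leRHS](_ : _ = v ^+ 2 * (expR v^-1 * m.+2`!%:R)); last by ring.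
by rewrite ler_wpM2l ?sqr_ge0.
Qed.

Let W_lip x y : W.[x] = 0 -> `|y - x| <= 1 -> `|W.[y]| <= 2 * `|y - x|.
Proof.
rewrite !WE => /eqP; rewrite mulf_eq0 subr_eq0 => /orP[/eqP->|/eqP<-] yx.
  rewrite subr0 normrM mulrC ler_wpM2r//; apply: le_trans (ler_normB _ _) _.
  by rewrite subr0 in yx; rewrite normr1; lra.
rewrite normrM -(distrC 1) ler_wpM2r// -[y](subrK 1); apply: le_trans (ler_normD _ _) _.
by rewrite normr1; lra.
Qed.

(** At a zero of W the bump is O(|y - x|^2), since W vanishes at least linearly there; hence its
    derivative is 0. *)
Let bumpf_flat p m x : W.[x] = 0 -> is_derive x 1 (bumpf p m) 0.
Proof.
move=> W0; pose C := (`|p.[x]| + 1) * (m.+2`!%:R * 4) : R.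
have C0 : 0 < C.
  by rewrite !mulr_gt0// ?ltr0n ?fact_gt0// ltr_wpDl.
have fx : bumpf p m x = 0 by rewrite /bumpf W0 ltxx.
have bd : \forall y \near x, `|bumpf p m y| <= C * `|y - x| ^+ 2.
  near=> y; have py : `|p.[y]| <= `|p.[x]| + 1.
    near: y; have := (@continuous_horner R p x) => /cvgrPdist_le/(_ 1 ltr01).
    apply: filterS => y; rewrite distrC => h.
    rewrite -[p.[y]](subrK p.[x]) addrC; apply: le_trans (ler_normD _ _) _; lra.
  have yx : `|y - x| <= 1.
    by near: y; have := (@cvg_id _ (nbhs x)) => /cvgrPdist_le/(_ 1 ltr01); apply: filterS => y; rewrite distrC.
  rewrite /bumpf; case: ifPn => [Wy|_]; last by rewrite normr0 mulr_ge0 ?sqr_ge0// ltW.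
  rewrite -mulrA normrM /C -mulrA ler_pM//.
  rewrite ger0_norm; last by rewrite mulr_ge0 ?expR_ge0// exprn_ge0// invr_ge0 ltW.
  apply: le_trans (exp_decay m Wy) _; rewrite -mulrA ler_wpM2l//.
  have := W_lip W0 yx; rewrite (gtr0_norm Wy) => h.
  apply: le_trans (_ : (2 * `|y - x|) ^+ 2 <= _); first by rewrite lerXn2r ?nnegrE// ?mulr_ge0// ltW.
  by rewrite exprMn -natrX.
have cv : h^-1 *: (bumpf p m (h *: (1 : R) + x) - bumpf p m x) @[h --> (0 : R)^'] --> (0 : R).
  apply/cvgrPdist_le => e e0; near=> h.
  have h0 : h != 0 by near: h; exact: nbhs_dnbhs_neq.
  rewrite sub0r normrN fx subr0 /GRing.scale/= mulr1 normrM normfV.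
  have hb : `|bumpf p m (h + x)| <= C * `|h| ^+ 2.
    rewrite -{2}[h](addrK x); near: h; apply: nbhs_dnbhs.
    have : h + x @[h --> (0:R)] --> x.
      by rewrite -{2}[x]add0r; apply: cvgD; [exact: cvg_id|exact: cvg_cst].
    by move=> /(_ _ bd).
  rewrite ler_pdivrMl ?normr_gt0//; apply: le_trans hb _.
  rewrite expr2 mulrCA ler_wpM2l// -ler_pdivlMl// mulrC.
  by near: h; apply: dnbhs0_le; rewrite divr_gt0.
apply: DeriveDef; last exact: cvg_lim cv.
by apply/cvg_ex; exists 0; exact: cv.
Unshelve. all: by end_near. Qed.

Let bumpf_derive p m : exists q k, forall x, is_derive x 1 (bumpf p m) (bumpf q k x).
Proof.
(* The derivative of p W^(-m) exp (-1 / W), brought to the common denominator W^(m+2). *)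
exists (p^`() * W ^+ 2 - m%:R *: (p * W * W^`()) + p * W^`()), m.+2 => x.
have cW : W.[y] @[y --> x] --> W.[x] by exact: continuous_horner.
case: (ltgtP 0 W.[x]) => W0.
- have Wn0 : W.[x] != 0 by rewrite gt_eqF.
  have diw : is_derive x 1 (fun y => W.[y]^-1) (- W.[x] ^- 2 *: W^`().[x]).
    exact: is_deriveV.
  have d := is_deriveM (is_deriveM (is_derive_poly p x) (is_deriveX m diw))
    (is_derive1_comp (is_derive_expR _) (is_deriveN diw)).
  have ne : \near x, (horner p * (fun y => W.[y]^-1) ^+ m * (expR \o - (fun y => W.[y]^-1))) x = bumpf p m x.
    near=> y; have Wy : 0 < W.[y] by near: y; exact: (cvgr_gt _ cW _ W0).
    by rewrite /bumpf Wy !fctE.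
  apply: is_derive_eq; first exact: near_eq_is_derive ne d.
  rewrite /bumpf W0; set w := W.[x]^-1; set E := expR (- w).
  have Ww : W.[x] * w = 1 by rewrite /w mulfV.
  have w1 : w ^+ m = W.[x] ^+ 2 * w ^+ m.+2.
    by rewrite -[m.+2]addn2 exprD mulrCA -exprMn Ww expr1n mulr1.
  have w2 : m%:R * w ^+ m.-1 * w ^+ 2 = m%:R * W.[x] * w ^+ m.+2 :> R.
    case: (m) => [|j]; first by rewrite !mul0r.
    by rewrite -!mulrA -exprD addn2 [in RHS]exprS (mulrA W.[x]) Ww mul1r.
  have wm : ((fun y => W.[y]^-1) ^+ m) x = w ^+ m by rewrite exprfctE.
  transitivity (p.[x] * w ^+ m * (E * - (- w ^+ 2 * W^`().[x])) +
    E * (p.[x] * ((m%:R * w ^+ m.-1) * (- w ^+ 2 * W^`().[x])) + w ^+ m * p^`().[x])).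
    by rewrite mulrfctE wm -exprVn.
  have -> (V : {poly R}) : (p^`() * V ^+ 2 - m%:R *: (p * V * V^`()) + p * V^`()).[x] =
      p^`().[x] * V.[x] ^+ 2 - m%:R * (p.[x] * V.[x] * V^`().[x]) + p.[x] * V^`().[x].
    by rewrite !(hornerD, hornerN, hornerZ, hornerM, horner_exp).
  transitivity ((p.[x] * W^`().[x] * (w ^+ m * w ^+ 2) - p.[x] * W^`().[x] * (m%:R * w ^+ m.-1 * w ^+ 2) + w ^+ m * p^`().[x]) * E).
    by ring.
  rewrite w2 -exprD addn2 w1.
  by move: (W.[x]) (W^`().[x]) (w ^+ m.+2) => ? ? ?; ring.
- have -> : bumpf (p^`() * W ^+ 2 - m%:R *: (p * W * W^`()) + p * W^`()) m.+2 x = 0.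
    by rewrite /bumpf ltNge ltW.
  apply: (near_eq_is_derive _ (is_derive_cst (0 : R) x 1)).
  near=> y; have Wy : W.[y] < 0 by near: y; exact: (cvgr_lt _ cW _ W0).
  by rewrite /bumpf ltNge ltW.
- rewrite {2}/bumpf -W0 ltxx; exact: bumpf_flat.
Unshelve. all: by end_near. Qed.

Lemma smooth_bumpf p m : smooth (bumpf p m).
Proof.
have main n : exists q k, (bumpf p m)^`(n)%classic = bumpf q k.
  elim: n => [|n [q [k e]]]; first by exists p, m; rewrite derive1n0.
  have [q' [k' d]] := bumpf_derive q k; exists q', k'.
  rewrite derive1nS e; apply/funext => x; rewrite derive1E.
  by have [_ ->] := d x.
move=> n x; have [q [k ->]] := main n; have [q' [k' d]] := bumpf_derive q k.
by have [] := d x.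
Qed.

Lemma bumpf_vanishes p m : vanishes_beyond 1 (bumpf p m).
Proof.
move=> x x1; rewrite /bumpf WE; case: ifPn => // h; exfalso.
move: x1; rewrite ltNge => /negP; apply; rewrite ler_norml.
suff : (0 < x)%R /\ (x < 1)%R by move=> [? ?]; apply/andP; split; lra.
by split; nra.
Qed.

(** C does not depend on d: the bound C / d then compares r with uniform averages over intervals of
    length comparable to d. No symmetry of r is asked. *)
Definition mollifier (C d : R) r := [/\ test_function r, forall t, 0 <= r t <= C / d,
  (\int[mu]_t (r t)%:E = 1)%E & vanishes_beyond d r].

Lemma exists_mollifier : exists2 C : R, 0 < C & forall d : R, 0 < d -> exists r, mollifier C d r.
Proof.
have tb p m : test_function (bumpf p m).
  by apply/test_functionP; split; [exact: smooth_bumpf|exists 1 => //; exact: bumpf_vanishes].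
have ii := lipc_integrable (test_function_lipc (tb 1 0%N)).
pose f0 := bumpf 1 0%N.
have f00 x : 0 <= f0 x.
  by rewrite /f0 /bumpf; case: ifP => // _; rewrite hornerC mul1r expr0 mul1r expR_ge0.
have mf := measurable_int _ ii.
have If : (\int[mu]_x (f0 x)%:E)%E \is a fin_num by exact: integrable_fin_num.
(* On [1/4, 3/4] one has W >= 1/8, so the bump is at least exp (-8) on an interval of length 1/2. *)
have I0 : (0 < \int[mu]_x (f0 x)%:E)%E.
  apply: (@lt_le_trans _ _ (expR (- 8) / 2)%:E); first by rewrite lte_fin divr_gt0// expR_gt0.
  apply: (@le_trans _ _ (\int[mu]_(x in `[(4^-1)%R, (3 / 4)%R]) (cst (expR (- 8))%:E x)))%E.
    rewrite integral_cst//= lebesgue_measure_itv/= lte_fin.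
    have -> : (4^-1 < 3 / 4 :> R) by lra.
    by rewrite -EFinB -EFinM lee_fin ler_wpM2l ?expR_ge0//; lra.
  apply: (@le_trans _ _ (\int[mu]_(x in `[(4^-1)%R, (3 / 4)%R]) (f0 x)%:E)%E); last first.
    by apply: ge0_subset_integral => //; move=> x _; rewrite lee_fin.
  apply: ge0_le_integral => //.
  - by move=> x _; rewrite lee_fin expR_ge0.
  - exact: measurable_funTS.
  - move=> x /=; rewrite in_itv/= => /andP[x1 x2]; rewrite lee_fin /f0 /bumpf WE.
    have w8 : 8^-1 <= x * (1 - x) by nra.
    have w0 : 0 < x * (1 - x) by apply: lt_le_trans w8; rewrite invr_gt0.
    rewrite w0 hornerC mul1r expr0 mul1r ler_expR lerN2 -[leRHS]invrK lef_pV2 ?posrE// invr_gt0.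
pose c := (fine (\int[mu]_x (f0 x)%:E)%E)^-1.
have c0 : 0 < c by rewrite invr_gt0 fine_gt0// I0 ltey_eq If.
have e b x : bumpf b%:P 0 x = b * f0 x.
  by rewrite /f0 /bumpf; case: ifP => _; rewrite ?mulr0// !hornerC !expr0 !mulr1 mul1r.
have [mb [B [L [T [B0 _ _ bB _]]]]] := test_function_lipc (tb c%:P 0%N).
exists (B + 1) => [|d d0]; first by rewrite ltr_wpDl.
have di0 : d^-1 != 0 by rewrite invr_neq0// gt_eqF.
(* Normalization and dilation are absorbed in the constant polynomial, so that smoothness and
   support are those already proved. *)
exists (fun t => bumpf (d^-1 * c)%:P 0 (d^-1 * t + 0)); split.
- exact: test_function_affine.
- move=> t; rewrite e -mulrA -e mulrC.
  have cf : 0 <= bumpf c%:P 0 (d^-1 * t + 0) by rewrite e mulr_ge0// ltW.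
  rewrite mulr_ge0 ?invr_ge0 ?(ltW d0)//= ler_pM2r ?invr_gt0//.
  by apply: le_trans (ler_norm _) _; apply: le_trans (bB _) _; rewrite lerDl.
- rewrite (ge0_integral_affine 0 (f := fun x => (bumpf (d^-1 * c)%:P 0 x)%:E))//.
  + under eq_integral do rewrite e EFinM.
    rewrite integralZl// -(fineK If) -!EFinM /c gtr0_norm ?invr_gt0// invrK.
    by rewrite mulrA mulrA mulfV ?gt_eqF// mul1r mulVf// gt_eqF// fine_gt0// I0 ltey_eq If.
  + by apply/measurable_EFinP; have [] := test_function_lipc (tb (d^-1 * c)%:P 0%N).
  + move=> x; rewrite lee_fin e; apply: mulr_ge0; last exact: f00.
    by apply: mulr_ge0; apply: ltW => //; rewrite invr_gt0.
- move=> t dt; apply: bumpf_vanishes.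
  by rewrite addr0 normrM normfV (gtr0_norm d0) mulrC ltr_pdivlMr// mul1r.
Qed.

End Mollifier.

(** * Fatou's lemma for norms, energies and the seminorm *)

Section LowerSemicontinuity.
Context {R : realType}.
Local Notation mu := (@lebesgue_measure R).
Implicit Types (u v f g : R -> R) (t x y d : R).

Lemma limn_einf_ge (w : nat -> \bar R) (l : \bar R) :
  (\forall n \near \oo, l <= w n)%E -> (l <= limn_einf w)%E.
Proof.
move=> lw; rewrite limn_einf_lim; apply: lime_ge; first exact: is_cvg_einfs.
case: lw => N _ lw; exists N => // n /= Nn.
by apply: le_ereal_inf_tmp => _ [m /= nm <-]; apply: lw => /=; exact: leq_trans nm.
Qed.

Lemma limn_einf_le (w : nat -> \bar R) (l : \bar R) :
  (\forall n \near \oo, w n <= l)%E -> (limn_einf w <= l)%E.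
Proof.
move=> wl; rewrite limn_einf_lim; apply: lime_le; first exact: is_cvg_einfs.
apply: filterS wl => n; apply: le_trans.
by apply: ereal_inf_lbound; exists n => /=.
Qed.

Lemma fatou_ae (f : nat -> R -> \bar R) (g : R -> \bar R) :
  (forall n, measurable_fun [set: R] (f n)) -> measurable_fun [set: R] g ->
  (forall n x, 0 <= f n x)%E -> (forall x, 0 <= g x)%E ->
  {ae mu, forall x, (g x <= limn_einf (f ^~ x))%E} ->
  (\int[mu]_x g x <= limn_einf (fun n => \int[mu]_x f n x))%E.
Proof.
have aeF := ae_filter_ringOfSetsType mu.
move=> mf mg f0 g0 gf; apply: le_trans (fatou _ _ _ _) => //.
apply: ae_ge0_le_integral => //.
- by move=> x _; apply: limn_einf_ge; exact: nearW.
- rewrite /limn_einf; apply: measurableT_comp => //.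
  by apply: measurable_fun_limn_esup => n; apply: measurableT_comp (mf n); exact: oppe_measurable.
- by apply: filterS gf => x.
Qed.

(** Translates of null sets are null; this gives almost everywhere convergence at x and x - t
    together. *)
Lemma ae_shift (P : R -> Prop) t : {ae mu, forall x, P x} -> {ae mu, forall x, P (x - t)}.
Proof.
move=> [N [mN N0 PN]]; exists ((fun x => 1 * x + - t) @^-1` N); split.
- by rewrite -[X in measurable X]setTI; exact: measurable_affine.
- have := lebesgue_affine_measure (- t) (oner_neq0 R) mN; rewrite N0 => /esym.
  by move=> /(congr1 (fun z => (`|1|^-1%:E * z)%E)); rewrite mule0 muleA -EFinM mulVf ?normr1// mul1e.
- by move=> x /= nP; apply: PN => /=; rewrite mul1r.
Qed.

Lemma sqn_le_liminf (U : nat -> R -> R) u : (forall n, measurable_fun [set: R] (U n)) ->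
  measurable_fun [set: R] u -> {ae mu, forall x, U n x @[n --> \oo] --> u x} ->
  (sqn u <= limn_einf (fun n => sqn (U n)))%E.
Proof.
have aeF := ae_filter_ringOfSetsType mu.
move=> mU mu_ Uu; apply: (fatou_ae (f := fun n x => (U n x ^+ 2)%:E)).
- by move=> n; apply/measurable_EFinP; exact: measurable_funX.
- by apply/measurable_EFinP; exact: measurable_funX.
- by move=> n x; rewrite lee_fin sqr_ge0.
- by move=> x; rewrite lee_fin sqr_ge0.
apply: filterS Uu => x Ux.
suff /cvg_limn_einf_sup[-> _] : (U n x ^+ 2)%:E @[n --> \oo] --> (u x ^+ 2)%:E by [].
by apply: cvg_EFin; [exact: nearW|exact: cvgM].
Qed.

Lemma energy_le_liminf (U : nat -> R -> R) u t : (forall n, measurable_fun [set: R] (U n)) ->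
  measurable_fun [set: R] u -> {ae mu, forall x, U n x @[n --> \oo] --> u x} ->
  (energy u t <= limn_einf (fun n => energy (U n) t))%E.
Proof.
have aeF := ae_filter_ringOfSetsType mu.
move=> mU mu_ Uu; apply: (sqn_le_liminf (U := fun n x => U n x - U n (x - t))).
- by move=> n; apply: measurable_funB => //; apply: (measurableT_comp (mU n)); exact: measurable_funB.
- by apply: measurable_funB => //; apply: (measurableT_comp mu_); exact: measurable_funB.
apply: filterS2 Uu (ae_shift t Uu) => x Ux Uxt; exact: cvgB.
Qed.

Lemma limn_einfZ (w : nat -> \bar R) (c : R) : 0 <= c -> (forall n, 0 <= w n)%E ->
  (c%:E * limn_einf w <= limn_einf (fun n => c%:E * w n))%E.
Proof.
move=> c0 w0; rewrite [X in (_ * X <= _)%E]limn_einf_lim -limeMl//; last exact: is_cvg_einfs.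
rewrite limn_einf_lim; apply: lee_lim.
- by apply: is_cvgeMl => //; exact: is_cvg_einfs.
- exact: is_cvg_einfs.
apply: nearW => n; apply: le_ereal_inf_tmp => _ [m nm <-].
by apply: lee_wpmul2l; rewrite ?lee_fin//; apply: ereal_inf_lbound; exists m.
Qed.

(** Fatou twice: in x for each energy, then in t against the kernel. *)
Lemma gagliardo_le_liminf (a : R) (U : nat -> R -> R) u :
  (forall n, measurable_fun [set: R] (U n)) ->
  measurable_fun [set: R] u -> {ae mu, forall x, U n x @[n --> \oo] --> u x} ->
  (gagliardo a u <= limn_einf (fun n => gagliardo a (U n)))%E.
Proof.
have aeF := ae_filter_ringOfSetsType mu.
move=> mU mu_ Uu; apply: (fatou_ae (f := fun n t => ((pker (- 1 - 2 * a) t)%:E * energy (U n) t)%E)).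
- move=> n; apply: emeasurable_funM; last exact: measurable_energy.
  by apply/measurable_EFinP; exact: measurable_pker.
- apply: emeasurable_funM; last exact: measurable_energy.
  by apply/measurable_EFinP; exact: measurable_pker.
- by move=> n t; rewrite mule_ge0// ?energy_ge0// lee_fin pker_ge0.
- by move=> t; rewrite mule_ge0// ?energy_ge0// lee_fin pker_ge0.
apply: nearW => t; apply: le_trans (limn_einfZ (pker_ge0 _ _) _); last by move=> n; exact: energy_ge0.
by apply: lee_wpmul2l; [rewrite lee_fin pker_ge0|exact: energy_le_liminf].
Qed.

(** From |u| <= 1 + u^2, since compact sets have finite measure. *)
Lemma sqn_locally_integrable u : measurable_fun [set: R] u -> (sqn u < +oo)%E ->
  locally_integrable [set: R] u.
Proof.
move=> mu_ uo; split => //; first exact: openT.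
move=> K _ cK; have mK : measurable K by exact: compact_measurable.
apply: (@le_lt_trans _ _ (\int[mu]_(x in K) (cst 1 x + (u x ^+ 2)%:E))%E).
  apply: ge0_le_integral => //.
  - by apply/measurable_EFinP/measurableT_comp => //; exact: measurable_funTS.
  - by apply: emeasurable_funD => //; apply/measurable_EFinP/measurable_funX; exact: measurable_funTS.
  move=> x _; rewrite -EFinD lee_fin -(real_normK (num_real (u x))).
  by have := sqr_ge0 (`|u x| - 1); have := normr_ge0 (u x); nra.
rewrite ge0_integralD//; last 2 first.
  by move=> x _; rewrite lee_fin sqr_ge0.
  by apply/measurable_EFinP/measurable_funX; exact: measurable_funTS.
apply: lte_add_pinfty; first by rewrite integral_cst// mul1e; exact: compact_finite_measure.
apply: le_lt_trans uo; apply: ge0_subset_integral => //.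
- by apply/measurable_EFinP/measurable_funX.
- by move=> x _; rewrite lee_fin sqr_ge0.
Qed.

End LowerSemicontinuity.

(** * Almost everywhere convergence of mollifications *)

Section Mollification.
Context {R : realType}.
Local Notation mu := (@lebesgue_measure R).
Implicit Types (u v f g r : R -> R) (t x y d C : R).

Lemma mollifier_lipc C d r : mollifier C d r -> lipc r.
Proof. by case=> /test_function_lipc. Qed.

Lemma sqn_lipc r : lipc r -> (sqn r < +oo)%E.
Proof. by move=> /lipc_nice[]. Qed.

Lemma convEFin r u x : lipc r -> measurable_fun [set: R] u -> (sqn u < +oo)%E ->
  ((conv r u x)%:E = \int[mu]_y (u y * r (x - y))%:E)%E.
Proof.
move=> lr mu_ uo; have lrx := lipc_reflect x lr; have [mrx _] := lrx.
rewrite convE// /Rintegral fineK//; apply: integrable_fin_num => //.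
by apply: integrable_mul => //; exact: sqn_lipc.
Qed.

Lemma conv_errorE C d r u x : mollifier C d r -> measurable_fun [set: R] u -> (sqn u < +oo)%E ->
  ((conv r u x - u x)%:E = \int[mu]_y ((u y - u x) * r (x - y))%:E)%E.
Proof.
move=> Mr mu_ uo; have lr := mollifier_lipc Mr; have [_ _ r1 _] := Mr.
have lrx := lipc_reflect x lr; have [mrx _] := lrx.
have i1 : mu.-integrable [set: R] (fun y => (u y * r (x - y))%:E).
  by apply: integrable_mul => //; exact: sqn_lipc.
have i2 : mu.-integrable [set: R] (fun y => (u x * r (x - y))%:E).
  under eq_fun do rewrite EFinM.
  by apply: integrableZl => //; exact: lipc_integrable.
have r1x : \int[mu]_y r (x - y) = 1.
  by rewrite (reflect_integral _ (lipc_integrable lr)) /Rintegral r1.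
under eq_integral do rewrite mulrBl EFinB.
rewrite integralB// -convEFin// EFinB; congr (_ - _)%E.
rewrite -[LHS]mule1 -[X in (_ * X)%E]/(1%:E) -r1x /Rintegral fineK; last first.
  by apply: integrable_fin_num => //; exact: lipc_integrable.
rewrite -integralZl//; exact: lipc_integrable.
Qed.

(* The open ball of radius 2 d contains the support of the mollifier and has
   measure 4 d. *)
Lemma conv_error_davg C d r u x : 0 < d -> mollifier C d r -> measurable_fun [set: R] u ->
  (sqn u < +oo)%E -> (`|conv r u x - u x|%:E <= (4 * C)%:E * davg u x (2 * d))%E.
Proof.
move=> d0 Mr mu_ uo; have lr := mollifier_lipc Mr; have [_ rC _ rd] := Mr.
have [mrx _] := lipc_reflect x lr.
have C0 : 0 <= C / d by have /andP[] := rC 0; exact: le_trans.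
have d20 : 0 < 2 * d by rewrite mulr_gt0.
have mF : measurable_fun [set: R] (fun y => (u y - u x) * r (x - y)).
  by apply: measurable_funM => //; exact: measurable_funB.
rewrite -abse_EFin (conv_errorE _ Mr)//.
apply: le_trans (le_abse_integral _ _ _) _ => //; first exact/measurable_EFinP.
have -> : ((4 * C)%:E * davg u x (2 * d) =
    \int[mu]_(y in ball x (2 * d)) ((C / d)%:E * `|(u y - u x)%:E|))%E.
  rewrite ge0_integralZl//; last 2 first.
    exact: measurable_ball.
    by apply: measurableT_comp => //; apply/measurable_EFinP/measurable_funTS; exact: measurable_funB.
  rewrite /davg /iavg lebesgue_measure_ball 1?ltW// muleA; congr (_ * _)%E.
  rewrite inver mulrn_eq0/= gt_eqF// -EFinM; congr (_%:E).
  by field; rewrite gt_eqF.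
rewrite [leRHS]integral_mkcond; apply: ge0_le_integral => //.
- by apply: measurableT_comp => //; exact/measurable_EFinP.
- apply/(measurable_restrictT _ _).1; first exact: measurable_ball.
  apply: measurable_funTS; apply: emeasurable_funM => //.
  by apply: measurableT_comp => //; apply/measurable_EFinP; exact: measurable_funB.
move=> y _; rewrite patchE; case: ifPn => yb.
  rewrite /= -EFinM lee_fin normrM mulrC ler_wpM2r//.
  by have /andP[r0 rc] := rC (x - y); rewrite ger0_norm.
have dy : d < `|x - y|.
  move: yb; rewrite notin_setE /ball/= => /negP; rewrite -leNgt; apply: lt_le_trans; lra.
by rewrite rd// mulr0 /= normr0.
Qed.

(** The error at x is at most 4 C times the mean oscillation of u about u x on a shrinking ball,
    which tends to 0 at every Lebesgue point. *)
Lemma conv_cvg_ae C (r : nat -> R -> R) (d : nat -> R) u :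
  (forall n, 0 < d n) -> d n @[n --> \oo] --> 0 ->
  (forall n, mollifier C (d n) (r n)) -> measurable_fun [set: R] u -> (sqn u < +oo)%E ->
  {ae mu, forall x, conv (r n) u x @[n --> \oo] --> u x}.
Proof.
have aeF := ae_filter_ringOfSetsType mu.
move=> dp d0 Mr mu_ uo.
have C0 : 0 <= C.
  have [_ /(_ 0)/andP[h1 h2] _ _] := Mr 0%N.
  by have := le_trans h1 h2; rewrite pmulr_lge0// invr_gt0.
have := lebesgue_differentiation (sqn_locally_integrable mu_ uo).
apply: filterS => x; rewrite /lebesgue_pt => ux.
apply/cvgrPdist_le => e e0.
pose e' := e / (4 * C + 1); have e'0 : 0 < e' by rewrite divr_gt0// ltr_wpDl// mulr_ge0.
have [dl/= dl0 hdl] : \forall z \near (0 : R)^'+, (davg u x z < e'%:E)%E.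
  by apply: (ux [set z | (z < e'%:E)%E]); apply: open_ereal_lt'; rewrite lte_fin.
near=> n.
have dn : 2 * d n < dl.
  rewrite mulrC -ltr_pdivlMr//; near: n; apply: (cvgr_lt _ d0); exact: divr_gt0.
have := hdl (2 * d n); rewrite /= sub0r normrN gtr0_norm ?mulr_gt0// => /(_ dn).
move=> /(_ isT) hd.
rewrite distrC -lee_fin; apply: le_trans (conv_error_davg x (dp n) (Mr n) mu_ uo) _.
apply: (@le_trans _ _ ((4 * C)%:E * e'%:E)%E).
  by apply: lee_wpmul2l; [rewrite lee_fin mulr_ge0|exact: ltW].
rewrite -EFinM lee_fin /e' mulrA ler_pdivrMr ?ltr_wpDl ?mulr_ge0// mulrC.
by rewrite ler_wpM2l ?lerDl// ltW.
Unshelve. all: by end_near. Qed.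

End Mollification.

(** * From a weak derivative in L^2 to a finite seminorm *)

Section WeakMarchaud.
Context {R : realType}.
Local Notation mu := (@lebesgue_measure R).
Implicit Types (u v f g r : R -> R) (t x y d : R).

Lemma mollifier_L1 C d r : mollifier C d r -> (\int[mu]_t (`|r t|)%:E <= 1)%E.
Proof.
move=> [_ rC r1 _]; rewrite -r1 le_eqVlt; apply/orP; left; apply/eqP.
by apply: eq_integral => t _; have /andP[/ger0_norm ->] := rC t.
Qed.

Lemma sqn_conv_le C d r u : mollifier C d r -> measurable_fun [set: R] u ->
  (sqn (conv r u) <= sqn u)%E.
Proof.
move=> Mr mu_; have [mr _] := mollifier_lipc Mr.
rewrite -[leRHS]mul1e -[X in (X%:E * _)%E](expr1n R 2).
apply: (young_le (F := fun x t => u (x - t))) => //.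
- apply: (measurableT_comp mu_); apply: measurable_funB; [exact: measurable_fst|exact: measurable_snd].
- exact: mollifier_L1 Mr.
- exact: sqn_ge0.
- by move=> t; rewrite sqn_shift.
Qed.

Context (a s : R) (a0 : 0 < a) (a1 : a < 1) (s1 : `|s| = 1).
Local Notation k := (pker (- 1 - a)).

Let s1N : `|- s| = 1. Proof. by rewrite normrN. Qed.

(* The weak form of v = fracD_cst a * marchaud a s u. *)
Definition weak_marchaud u v := forall phi, test_function phi ->
  (\int[mu]_x (v x * phi x)%:E =
   \int[mu]_x (u x * (fracD_cst a * marchaud a (- s) phi x))%:E)%E.

(** Shifting the convolution by s t shifts the reflected kernel y -> r (x - y) by -s t, which is
    where the opposite direction comes from. *)
Lemma marchaud_conv r u x : lipc r -> measurable_fun [set: R] u -> (sqn u < +oo)%E ->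
  ((marchaud a s (conv r u) x)%:E =
   \int[mu]_y (u y * marchaud a (- s) (fun z => r (x - z)) y)%:E)%E.
Proof.
move=> lr mu_ uo; have nrx := lipc_nice (lipc_reflect x lr).
have nru := conv_nice lr mu_ uo.
rewrite (marchaud_duality a0 a1 s1N mu_ uo nrx).
have ii z : mu.-integrable [set: R] (fun y => (u y * r (z - y))%:E).
  have lz := lipc_reflect z lr; have [mz _] := lz.
  by apply: integrable_mul => //; exact: sqn_lipc.
rewrite /marchaud /Rintegral fineK; last first.
  by apply: integrable_fin_num => //; exact: marchaud_integrable.
apply: eq_integral => t _; rewrite EFinM; congr (_ * _)%E.
rewrite EFinB !convEFin// -integralB//; apply: eq_integral => y _.
rewrite -EFinB -mulrBr; congr (_ * (_ - r _))%:E; ring.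
Qed.

(** The weak identity is tested with y -> r (x - y). *)
Lemma weak_marchaud_conv r u v x : test_function r -> measurable_fun [set: R] u ->
  (sqn u < +oo)%E -> measurable_fun [set: R] v -> (sqn v < +oo)%E -> weak_marchaud u v ->
  conv r v x = fracD_cst a * marchaud a s (conv r u) x.
Proof.
move=> tr mu_ uo mv vo uv; have lr := test_function_lipc tr.
have trx : test_function (fun y => r (x - y)).
  have -> : (fun y => r (x - y)) = (fun y => r (- 1 * y + x)).
    by apply/funext => y; rewrite mulN1r addrC.
  by apply: test_function_affine => //; rewrite oppr_eq0 oner_neq0.
have nrx := lipc_nice (lipc_reflect x lr).
apply: EFin_inj; rewrite convEFin// uv// EFinM marchaud_conv//.
rewrite -integralZl//; first by apply: eq_integral => y _; rewrite -EFinM mulrCA.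
apply: integrable_mul => //; last exact: sqn_marchaud_lty.
by apply: measurable_marchaud => //; have [] := nrx.
Qed.

Definition core_cst : R := fracD_cst a ^+ 2 * fine (cst_core a).

Lemma core_cst_gt0 : 0 < core_cst.
Proof.
rewrite mulr_gt0 ?exprn_gt0 ?fracD_cst_gt0// fine_gt0//.
by rewrite cst_core_gt0// cst_core_lty.
Qed.

Lemma sqn_fracD_marchaud u : nice u ->
  sqn (fun x => fracD_cst a * marchaud a s u x) = (core_cst%:E * gagliardo a u)%E.
Proof.
move=> nu; have [mu_ _ _] := nu.
rewrite sqnZ; last exact: measurable_marchaud.
rewrite sqn_marchaud// muleA; congr (_ * _)%E.
rewrite /core_cst [RHS]EFinM fineK//.
by rewrite ge0_fin_numE ?cst_core_lty// ltW// cst_core_gt0.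
Qed.

Lemma weak_marchaud_gagliardo u v : measurable_fun [set: R] u -> (sqn u < +oo)%E ->
  measurable_fun [set: R] v -> (sqn v < +oo)%E -> weak_marchaud u v ->
  (gagliardo a u < +oo)%E.
Proof.
move=> mu_ uo mv vo uv; have [C C0 exC] := @exists_mollifier R.
have dp n : 0 < n.+1%:R^-1 :> R by rewrite invr_gt0.
have [r Mr] := choice (fun n => exC _ (dp n)).
have cv := conv_cvg_ae dp (@cvg_harmonic R) Mr mu_ uo.
have mr n : measurable_fun [set: R] (r n) by have [] := mollifier_lipc (Mr n).
apply: (@le_lt_trans _ _ ((core_cst^-1)%:E * sqn v)%E); last first.
  by rewrite lte_mul_pinfty// lee_fin invr_ge0 ltW// core_cst_gt0.
apply: le_trans (gagliardo_le_liminf a _ mu_ cv) _.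
  by move=> n; exact: measurable_conv.
apply: limn_einf_le; apply: nearW => n; rewrite lee_pdivlMl ?core_cst_gt0//.
have lr := mollifier_lipc (Mr n); have [tr _ _ _] := Mr n.
rewrite -sqn_fracD_marchaud; last exact: conv_nice.
apply: le_trans _ (sqn_conv_le (Mr n) mv).
rewrite le_eqVlt; apply/orP; left; apply/eqP; congr sqn; apply/funext => x.
by rewrite (weak_marchaud_conv x tr mu_ uo mv vo uv).
Qed.

End WeakMarchaud.

(** * Approximation by mollification in L^2 and in the seminorm *)

Section EnergyApproximation.
Context {R : realType}.
Local Notation mu := (@lebesgue_measure R).
Implicit Types (u v f g r : R -> R) (t x y d : R).

Lemma energyB f g t : measurable_fun [set: R] f -> measurable_fun [set: R] g ->
  (energy (fun x => f x - g x)%R t <= 2%:E * energy f t + 2%:E * energy g t)%E.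
Proof.
move=> mf mg; rewrite /energy.
have ms (h : R -> R) : measurable_fun [set: R] h -> measurable_fun [set: R] (fun x => h x - h (x - t)).
  move=> mh; apply: measurable_funB => //; apply: (measurableT_comp mh).
  exact: measurable_funB.
apply: le_trans (sqnB (ms _ mf) (ms _ mg)); rewrite le_eqVlt; apply/orP; left; apply/eqP.
by congr sqn; apply/funext => x; ring.
Qed.

Lemma niceB f g : nice f -> nice g -> nice (fun x => f x - g x).
Proof.
move=> [mf fo [M M0 [fM fE]]] [mg go [N N0 [gN gE]]]; split.
- exact: measurable_funB.
- by apply: le_lt_trans (sqnB mf mg) _; rewrite lte_add_pinfty// lte_mul_pinfty.
exists (2 * M + 2 * N); first by rewrite addr_gt0// mulr_gt0.
split=> [x y|t].
  have -> : f x - g x - (f y - g y) = (f x - f y) - (g x - g y) by ring.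
  apply: le_trans (ler_normB _ _) _; have := wgt_ge0 (x - y).
  have := fM x y; have := gN x y; nra.
apply: le_trans (energyB t mf mg) _.
apply: (@le_trans _ _ (2%:E * (M * wgt t ^+ 2)%:E + 2%:E * (N * wgt t ^+ 2)%:E)%E).
  by apply: leeD; apply: lee_wpmul2l; rewrite ?lee_fin.
by rewrite -!EFinM -EFinD lee_fin; lra.
Qed.

Lemma gagliardoB (a : R) f g : measurable_fun [set: R] f -> measurable_fun [set: R] g ->
  (gagliardo a (fun x => f x - g x)%R <= 2%:E * gagliardo a f + 2%:E * gagliardo a g)%E.
Proof.
move=> mf mg; rewrite /gagliardo; set k2 := pker _.
have mk : measurable_fun [set: R] (fun t => (k2 t)%:E).
  by apply/measurable_EFinP; exact: measurable_pker.
have k20 t : (0 <= (k2 t)%:E)%E by rewrite lee_fin pker_ge0.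
have me h : measurable_fun [set: R] h -> measurable_fun [set: R] (fun t => (k2 t)%:E * energy h t)%E.
  by move=> mh; apply: emeasurable_funM => //; exact: measurable_energy.
have ke h t : (0 <= (k2 t)%:E * energy h t)%E by rewrite mule_ge0// energy_ge0.
have Zl h : measurable_fun [set: R] h ->
    (\int[mu]_t (2%:E * ((k2 t)%:E * energy h t)) = 2%:E * \int[mu]_t ((k2 t)%:E * energy h t))%E.
  by move=> mh; apply: ge0_integralZl; [exact: measurableT|exact: me|move=> t _; exact: ke|rewrite lee_fin].
have m2 h : measurable_fun [set: R] h ->
    measurable_fun [set: R] (fun t => 2%:E * ((k2 t)%:E * energy h t))%E.
  by move=> mh; apply: emeasurable_funM; [exact: measurable_cst|exact: me].
have k2e0 h t : (0 <= 2%:E * ((k2 t)%:E * energy h t))%E by rewrite mule_ge0.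
rewrite -(Zl f mf).
rewrite -(Zl g mg).
rewrite -ge0_integralD; [|exact: measurableT
  |by move=> t _; exact: k2e0|exact: m2|by move=> t _; exact: k2e0|exact: m2].
apply: ge0_le_integral; [exact: measurableT|by move=> t _; exact: ke|by apply: me; exact: measurable_funB
  |by apply: emeasurable_funD; exact: m2|].
move=> t _; apply: (@le_trans _ _ ((k2 t)%:E * (2%:E * energy f t + 2%:E * energy g t))%E).
  by apply: lee_wpmul2l => //; exact: energyB.
rewrite ge0_muleDr ?mule_ge0 ?energy_ge0// !muleA.
by rewrite [((k2 t)%:E * 2%:E)%E]muleC.
Qed.

(** Convolution commutes with increments and, as r has mass 1, contracts L^2. *)
Lemma energy_conv C d r u t : mollifier C d r -> measurable_fun [set: R] u -> (sqn u < +oo)%E ->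
  (energy (conv r u) t <= energy u t)%E.
Proof.
move=> Mr mu_ uo; have lr := mollifier_lipc Mr; have [mr _] := lr.
rewrite -[leRHS]mul1e -[X in (X%:E * _)%E](expr1n R 2) /energy.
have -> : (fun x => conv r u x - conv r u (x - t)) =
    (fun x => \int[mu]_z (r z * (u (x - z) - u (x - z - t)))).
  apply/funext => x; rewrite /conv -RintegralB//; try exact: conv_integrable.
  by apply: eq_Rintegral => z _; rewrite -mulrBr addrAC.
have mF : measurable_fun [set: R] (fun x => u x - u (x - t)).
  by apply: measurable_funB => //; apply: (measurableT_comp mu_); exact: measurable_funB.
apply: (young_le (F := fun x z => u (x - z) - u (x - z - t))) => //.
- apply: (measurableT_comp (f := fun x => u x - u (x - t)) (g := fun p : R * R => p.1 - p.2)) => //.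
  by apply: measurable_funB; [exact: measurable_fst|exact: measurable_snd].
- exact: mollifier_L1 Mr.
- exact: sqn_ge0.
- by move=> z; rewrite (sqn_shift (f := fun x => u x - u (x - t))).
Qed.

(** Since r is a probability density, the error is the r-average of increments of u, and the square
    of an average is at most the average of the squares. *)
Lemma sqn_conv_energy C d r u : mollifier C d r -> measurable_fun [set: R] u ->
  (sqn u < +oo)%E ->
  (sqn (fun x => conv r u x - u x)%R <= \int[mu]_t ((r t)%:E * energy u t))%E.
Proof.
move=> Mr mu_ uo; have lr := mollifier_lipc Mr; have [mr _] := lr; have [_ rC r1 _] := Mr.
have -> : (fun x => conv r u x - u x) = (fun x => \int[mu]_t (r t * (u (x - t) - u x))).
  apply/funext => x; under eq_Rintegral do rewrite mulrBr.
  rewrite RintegralB//; last 2 first.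
  - exact: conv_integrable.
  - rewrite (_ : EFin \o _ = (fun t => (u x)%:E * (r t)%:E)%E).
      by apply: integrableZl => //; exact: lipc_integrable.
    by apply/funext => t; rewrite /= mulrC EFinM.
  congr (_ - _); rewrite RintegralZr//; last exact: lipc_integrable.
  by rewrite /Rintegral r1 mul1r.
apply: le_trans (young (F := fun x t => u (x - t) - u x) mr _ ltr01 (mollifier_L1 Mr)) _.
  apply: measurable_funB; last exact: (measurableT_comp mu_ measurable_fst).
  by apply: (measurableT_comp mu_); apply: measurable_funB; [exact: measurable_fst|exact: measurable_snd].
rewrite mul1e le_eqVlt; apply/orP; left; apply/eqP; apply: eq_integral => t _.
have /andP[r0 _] := rC t; rewrite ger0_norm//; congr (_ * _)%E.
by rewrite /energy -sqnN; congr sqn; apply/funext => x; rewrite opprB.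
Qed.

Context (a : R) (a0 : 0 < a) (a1 : a < 1).
Local Notation k2 := (pker (- 1 - 2 * a)).

(** From t^(1+2a) <= d^(1+2a). It trades the height 1 / d of a mollifier for the Gagliardo kernel,
    at the price of a factor that vanishes with d. *)
Lemma inv_le_pker d t : 0 < t -> t <= d -> d^-1 <= d `^ (2 * a) * k2 t.
Proof.
move=> t0 td; have d0 := lt_le_trans t0 td; have a0' := a0.
rewrite pkerE// (_ : - 1 - 2 * a = - (1 + 2 * a)); last by ring.
rewrite powRN ler_pdivlMr ?powR_gt0// mulrC ler_pdivrMr//.
apply: le_trans (_ : d `^ (1 + 2 * a) <= _).
  by apply: ge0_ler_powR; rewrite ?nnegrE ?(ltW t0) ?(ltW d0)//; lra.
rewrite powRD; last by apply/implyP => _; rewrite gt_eqF.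
by rewrite mulrC powRr1// ltW.
Qed.

Lemma gagliardo_symm u : measurable_fun [set: R] u ->
  (\int[mu]_t ((k2 t + k2 (- t))%:E * energy u t) = 2%:E * gagliardo a u)%E.
Proof.
move=> mu_; have me := measurable_energy mu_.
have mk : measurable_fun [set: R] (fun t => (k2 t)%:E * energy u t)%E.
  by apply: emeasurable_funM => //; apply/measurable_EFinP; exact: measurable_pker.
have k0 t : (0 <= (k2 t)%:E * energy u t)%E.
  by rewrite mule_ge0 ?energy_ge0// lee_fin pker_ge0.
have n0 : - 1 != 0 :> R by rewrite oppr_eq0 oner_eq0.
have := ge0_integral_affine 0 n0 mk k0; rewrite normrN1 invr1 mul1e => /esym sy.
have symE t : ((k2 (- 1 * t + 0)%R)%:E * energy u (- 1 * t + 0)%R = (k2 (- t)%R)%:E * energy u t)%E.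
  by rewrite mulN1r addr0 energyN.
rewrite /gagliardo mule_natl mule2n {2}sy.
rewrite -ge0_integralD; [|exact: measurableT|by move=> t _; exact: k0|exact: mk
  |by move=> t _; exact: k0|]; last first.
  by apply: (measurableT_comp mk); exact: measurable_affine.
apply: eq_integral => t _; rewrite EFinD ge0_muleDl; [|by rewrite lee_fin; exact: pker_ge0..].
by congr (_ + _)%E; exact/esym/symE.
Qed.

(** A finite seminorm yields L^2 convergence at the rate d^(2a), with no appeal to density of
    continuous functions. *)
Lemma sqn_conv_error C d r u : 0 < d -> mollifier C d r -> measurable_fun [set: R] u ->
  (sqn u < +oo)%E ->
  (sqn (fun x => conv r u x - u x)%R <= (2 * C * d `^ (2 * a))%:E * gagliardo a u)%E.
Proof.
move=> d0 Mr mu_ uo; have [mr _] := mollifier_lipc Mr; have [_ rC _ rd] := Mr.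
apply: le_trans (sqn_conv_energy Mr mu_ uo) _.
have C0 : 0 <= C.
  by have /andP[h1 h2] := rC 0; have := le_trans h1 h2; rewrite pmulr_lge0// invr_gt0.
rewrite (_ : 2 * C * _ = (C * d `^ (2 * a)) * 2); last by ring.
have c0 : 0 <= C * d `^ (2 * a) by rewrite mulr_ge0// powR_ge0.
have [c cE] : exists c, c = C * d `^ (2 * a) by exists (C * d `^ (2 * a)).
rewrite -cE in c0 *.
rewrite EFinM -muleA -gagliardo_symm//.
have me := measurable_energy mu_.
have mk : measurable_fun [set: R] (fun t => (k2 t + k2 (- t))%:E).
  apply/measurable_EFinP; apply: measurable_funD; first exact: measurable_pker.
  by apply: (measurableT_comp (measurable_pker _)); exact: measurable_funN.
have kk0 t : 0 <= k2 t + k2 (- t) by rewrite addr_ge0// pker_ge0.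
have mkE : measurable_fun [set: R] (fun t => (k2 t + k2 (- t))%:E * energy u t)%E.
  exact: emeasurable_funM.
have kE0 t : (0 <= (k2 t + k2 (- t))%:E * energy u t)%E.
  by rewrite mule_ge0 ?energy_ge0// lee_fin.
rewrite -ge0_integralZl; [|exact: measurableT|exact: mkE|by move=> t _; exact: kE0|by rewrite lee_fin].
apply: ge0_le_integral; first exact: measurableT.
- by move=> t _; rewrite mule_ge0 ?energy_ge0// lee_fin; have /andP[] := rC t.
- by apply: emeasurable_funM => //; exact/measurable_EFinP.
- by apply: emeasurable_funM; [exact: measurable_cst|exact: mkE].
move=> t _; have [->|t0] := eqVneq t 0; first by rewrite energy0 !mule0.
rewrite muleA -EFinM; apply: lee_wpmul2r; first exact: energy_ge0.
rewrite lee_fin; have [td|dt] := leP `|t| d; last by rewrite rd// mulr_ge0.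
have /andP[_ rtC] := rC t; apply: le_trans rtC _; rewrite cE -mulrA ler_wpM2l//.
have tp : 0 < `|t| by rewrite normr_gt0.
apply: le_trans (inv_le_pker tp td) _; rewrite ler_wpM2l ?powR_ge0//.
by case: (ger0P t) => _; rewrite ?lerDl ?lerDr; exact: pker_ge0.
Qed.

(** For the seminorm, dominated convergence in t: the energy of the error is at most 4 times that of
    u, and for each t it tends to 0 because the error does so in L^2. *)
Lemma conv_approx u (e : R) : measurable_fun [set: R] u -> (sqn u < +oo)%E ->
  (gagliardo a u < +oo)%E -> 0 < e ->
  exists U, [/\ nice U, (sqn (fun x => U x - u x)%R <= e%:E)%E &
    (gagliardo a (fun x => U x - u x)%R <= e%:E)%E].
Proof.
move=> mu_ uo go e0; have [C C0 exC] := @exists_mollifier R.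
pose d n : R := n.+1%:R^-1.
have dp n : 0 < d n by rewrite invr_gt0.
have [r Mr] := choice (fun n => exC _ (dp n)).
have mr n : measurable_fun [set: R] (r n) by have [] := mollifier_lipc (Mr n).
pose D n x := conv (r n) u x - u x.
have mD n : measurable_fun [set: R] (D n).
  by apply: measurable_funB => //; exact: measurable_conv.
have D0 : sqn (D n) @[n --> \oo] --> 0%E.
  apply: (@squeeze_cvge _ _ _ _ (cst 0%E) _
    (fun n => ((2 * C * d n `^ (2 * a))%:E * gagliardo a u)%E)).
  - by apply: nearW => n; rewrite sqn_ge0/=; exact: sqn_conv_error.
  - exact: cvg_cst.
  have gf : gagliardo a u \is a fin_num by rewrite ge0_fin_numE// gagliardo_ge0.
  rewrite -(fineK gf) -[X in _ --> X](mul0e (fine (gagliardo a u))%:E).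
  apply: cvgeMr => //; apply: cvg_EFin; first exact: nearW.
  rewrite -[X in _ --> X](mulr0 (2 * C)); apply: cvgMr.
  have a20 : 0 < 2 * a by rewrite mulr_gt0.
  apply/cvgrPdist_lt => z z0; move/cvgrPdist_lt: (powR_cvg0 a20) => /(_ z z0)[dl/= dl0 hdl].
  near=> n; apply: hdl; last exact: dp.
  rewrite /= sub0r normrN gtr0_norm//; near: n; exact: (cvgr_lt _ (@cvg_harmonic R)).
pose k2e n t := ((k2 t)%:E * energy (D n) t)%E.
have E4 n t : (energy (D n) t <= 4%:E * energy u t)%E.
  apply: le_trans (energyB t _ mu_) _; first exact: measurable_conv.
  apply: (@le_trans _ _ (2%:E * energy u t + 2%:E * energy u t)%E).
    by rewrite leeD2r// lee_wpmul2l// (energy_conv t (Mr n)).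
  by rewrite -ge0_muleDl// -EFinD (_ : 2 + 2 = 4 :> R)//; ring.
have G0 : gagliardo a (D n) @[n --> \oo] --> 0%E.
  have mk : measurable_fun [set: R] (fun t => (k2 t)%:E).
    by apply/measurable_EFinP; exact: measurable_pker.
  have k20 t : (0 <= (k2 t)%:E)%E by rewrite lee_fin pker_ge0.
  have mkE f : measurable_fun [set: R] f -> measurable_fun [set: R] (fun t => (k2 t)%:E * energy f t)%E.
    by move=> mf; apply: emeasurable_funM => //; exact: measurable_energy.
  rewrite -(integral0 mu [set: R]).
  apply: (@dominated_cvg _ _ _ mu _ measurableT k2e (cst 0%E)
    (fun t => 4%:E * ((k2 t)%:E * energy u t))%E).
  - by move=> n; exact: mkE.
  - move=> t _; rewrite -[X in _ --> X](mule0 (k2 t)%:E).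
    apply: cvgeMl => //.
    apply: (@squeeze_cvge _ _ _ _ (cst 0%E) _ (fun n => 4%:E * sqn (D n))%E).
    + by apply: nearW => n; rewrite energy_ge0/=; exact: energy_le4.
    + exact: cvg_cst.
    + by rewrite -[X in _ --> X](mule0 4%:E); apply: cvgeMl.
  - move=> t _; rewrite fin_numM// fin_numM// ge0_fin_numE ?energy_ge0//.
    by apply: le_lt_trans (energy_le4 _ mu_) _; rewrite lte_mul_pinfty.
  - apply: integrableZl => //; apply/integrableP; split; first exact: mkE.
    apply: le_lt_trans go; rewrite le_eqVlt; apply/orP; left; apply/eqP.
    by apply: eq_integral => t _; rewrite gee0_abs// mule_ge0 ?energy_ge0.
  - move=> n t _; rewrite gee0_abs; last by rewrite mule_ge0 ?energy_ge0.
    by rewrite muleCA lee_wpmul2l.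
have near_le (w : nat -> \bar R) : w n @[n --> \oo] --> 0%E -> \forall n \near \oo, (w n <= e%:E)%E.
  move=> w0; have : nbhs (0%E : \bar R) [set z | (z < e%:E)%E] by apply: open_ereal_lt'; rewrite lte_fin.
  by move=> /w0 w0n; near=> n; apply: ltW; near: n; exact: w0n.
have [n [n1 n2]] : exists n, (sqn (D n) <= e%:E)%E /\ (gagliardo a (D n) <= e%:E)%E.
  near \oo => n; exists n; split; near: n; exact: near_le.
exists (conv (r n) u); split => //.
by apply: conv_nice => //; exact: mollifier_lipc (Mr n).
Unshelve. all: by end_near. Qed.

End EnergyApproximation.

(** * Completeness of L^2 with explicit rates, and limits in duality *)

Section L2Limits.
Context {R : realType}.
Local Notation mu := (@lebesgue_measure R).
Implicit Types (u v f g r : R -> R) (t x y d : R).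

Lemma sum_half_le n : \sum_(0 <= j < n) (2^-1 : R) ^+ j <= 2.
Proof.
have -> : \sum_(0 <= j < n) (2^-1 : R) ^+ j = 2 - 2 * 2^-1 ^+ n.
  elim: n => [|n IH]; first by rewrite big_nil expr0 mulr1 subrr.
  by rewrite big_nat_recr//= IH exprS; field.
by rewrite gerBl mulr_ge0// exprn_ge0.
Qed.

Lemma geometric_cvg (V : nat -> R) (c : R) : 0 <= c ->
  (forall j, `|V j.+1 - V j| <= c * 2^-1 ^+ j) -> cvgn V.
Proof.
move=> c0 Vc.
have sV : cvgn (series (telescope V)).
  apply: normed_cvg; apply: (@series_le_cvg _ _ (geometric c 2^-1)) => //.
  - by move=> n /=.
  - by move=> n; rewrite /geometric/= mulr_ge0// exprn_ge0.
  - by apply: is_cvg_geometric_series; rewrite gtr0_norm ?invf_lt1 ?ltr1n// invr_gt0.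
have -> : V = (fun n => V 0%N + series (telescope V) n).
  by apply/funext => n; exact: eq_sum_telescope.
by apply: is_cvgD => //; exact: is_cvg_cst.
Qed.

(* The weights 4^j leave the bounds 2^-j summable, and a finite weighted sum
   forces geometric decay of the increments. *)
Lemma geometric_ae_cvg (V : nat -> R -> R) (K : R) : 0 <= K ->
  (forall j, measurable_fun [set: R] (V j)) ->
  (forall j, sqn (fun x => V j.+1 x - V j x)%R <= (K * 8^-1 ^+ j)%:E)%E ->
  {ae mu, forall x, cvgn (fun j => V j x)}.
Proof.
have aeF := ae_filter_ringOfSetsType mu.
move=> K0 mV VK.
pose w j x : \bar R := (4 ^+ j * (V j.+1 x - V j x) ^+ 2)%:E.
have w0 j x : (0 <= w j x)%E by rewrite lee_fin mulr_ge0 ?sqr_ge0// exprn_ge0.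
have mdV j : measurable_fun [set: R] (fun x => (V j.+1 x - V j x) ^+ 2).
  by apply: measurable_funX; exact: measurable_funB.
have mw j : measurable_fun [set: R] (w j).
  by apply/measurable_EFinP; apply: measurable_funM.
have Iw j : (\int[mu]_x w j x <= (K * 2^-1 ^+ j)%:E)%E.
  have e4 : 0 <= 4 ^+ j :> R by rewrite exprn_ge0.
  apply: (@le_trans _ _ ((4 ^+ j)%:E * (K * 8^-1 ^+ j)%:E)%E).
    apply: le_trans (lee_wpmul2l _ (VK j)); last by rewrite lee_fin.
    rewrite /sqn -ge0_integralZl//.
    - by apply/measurable_EFinP; exact: mdV.
    - by move=> x _; rewrite lee_fin sqr_ge0.
  rewrite -EFinM lee_fin mulrCA -exprMn (_ : 4 * 8^-1 = 2^-1 :> R)//; by field.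
pose G x := (\sum_(0 <= j <oo) w j x)%E.
have G0 x : (0 <= G x)%E by apply: nneseries_ge0 => j _ _.
have mG : measurable_fun [set: R] G.
  exact: (@ge0_emeasurable_sum _ _ _ _ w xpredT).
have GI : (\int[mu]_x G x < +oo)%E.
  rewrite /G integral_nneseries//.
  apply: (@le_lt_trans _ _ (K * 2)%:E); last exact: ltry.
  apply: lime_le; first by apply: is_cvg_nneseries => j _ _; exact: integral_ge0.
  apply: nearW => n; apply: (@le_trans _ _ (\sum_(0 <= j < n) (K * 2^-1 ^+ j)%:E)%E).
    by apply: lee_sum => j _; exact: Iw.
  by rewrite sumEFin lee_fin -mulr_sumr ler_wpM2l// sum_half_le.
have iG : mu.-integrable [set: R] G.
  apply/integrableP; split => //; apply: le_lt_trans GI.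
  rewrite le_eqVlt; apply/orP; left; apply/eqP; apply: eq_integral => x _; exact: gee0_abs.
apply: filterS (integrable_ae measurableT iG) => x /(_ I) Gx.
pose g := fine (G x); have g0 : 0 <= g by exact: fine_ge0.
(* The increments are at most sqrt(g) 2^(-j); 1 + g avoids the root, as g <= (1 + g)^2. *)
apply: (@geometric_cvg _ (1 + g)); first by rewrite addr_ge0.
move=> j; have wG : 4 ^+ j * (V j.+1 x - V j x) ^+ 2 <= g.
  rewrite -lee_fin /g fineK//.
  apply: le_trans (nneseries_lim_ge (P := xpredT) j.+1 _); last by move=> n _ _; exact: w0.
  by rewrite big_nat_recr//= leeDr// sume_ge0.
rewrite -[leRHS]ger0_norm; last by rewrite mulr_ge0 ?exprn_ge0// addr_ge0.
rewrite -ler_sqr ?nnegrE// !real_normK ?num_real// exprMn -exprM mulnC exprM.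
have -> : (2^-1 : R) ^+ 2 = 4^-1 by rewrite expr2; field.
rewrite exprVn ler_pdivlMr ?exprn_gt0// mulrC; apply: le_trans wG _.
by have := sqr_ge0 g; nra.
Qed.

Lemma L2_limit (V : nat -> R -> R) (K : R) : 0 <= K ->
  (forall j, measurable_fun [set: R] (V j)) -> (sqn (V 0%N) < +oo)%E ->
  (forall j m, sqn (fun x => V j x - V m x)%R <= (K * (8^-1 ^+ j + 8^-1 ^+ m))%:E)%E ->
  exists v, [/\ measurable_fun [set: R] v, (sqn v < +oo)%E &
    forall j, (sqn (fun x => V j x - v x)%R <= (2 * K * 8^-1 ^+ j)%:E)%E].
Proof.
have aeF := ae_filter_ringOfSetsType mu.
move=> K0 mV V0 VK.
(* The upper limit is measurable and defined everywhere; it is the limit wherever that exists. *)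
pose v x := fine (limn_esup (fun j => (V j x)%:E)).
have mv : measurable_fun [set: R] v.
  apply: measurableT_comp; first exact: fine_measurable.
  by apply: measurable_fun_limn_esup => j; exact/measurable_EFinP.
have e8 j : 0 <= (8^-1 : R) ^+ j by rewrite exprn_ge0.
have e8le j m : (j <= m)%N -> (8^-1 : R) ^+ m <= 8^-1 ^+ j.
  by move=> jm; apply: ler_wiXn2l => //; rewrite invf_le1// ler1n.
have Vv : {ae mu, forall x, V j x @[j --> \oo] --> v x}.
  have : {ae mu, forall x, cvgn (fun j => V j x)}.
    apply: (@geometric_ae_cvg V (2 * K)) => //; first by rewrite mulr_ge0.
    move=> j; apply: le_trans (VK _ _) _; rewrite lee_fin.
    by have := e8le _ _ (leqnSn j); have := K0; nra.
  apply: filterS => x /cvg_ex[l Vl].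
  have [_ e] : (limn_einf (fun j => (V j x)%:E) = l%:E) * (limn_esup (fun j => (V j x)%:E) = l%:E).
    by apply: cvg_limn_einf_sup; apply: cvg_EFin => //; exact: nearW.
  by rewrite /v e.
have vK j : (sqn (fun x => V j x - v x)%R <= (2 * K * 8^-1 ^+ j)%:E)%E.
  apply: le_trans (@sqn_le_liminf R (fun m x => V j x - V m x) _ _ _ _) _.
  - by move=> m; exact: measurable_funB.
  - exact: measurable_funB.
  - by apply: filterS Vv => x Vx; apply: cvgB => //; exact: cvg_cst.
  apply: limn_einf_le; near=> m; apply: le_trans (VK _ _) _; rewrite lee_fin.
  have jm : (j <= m)%N by near: m; exact: nbhs_infty_ge.
  by have := e8le _ _ jm; have := K0; nra.
exists v; split => //.
have -> : v = (fun x => V 0%N x - (V 0%N x - v x)) by apply/funext => x; ring.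
apply: le_lt_trans (sqnB (mV 0%N) _) _; first exact: measurable_funB.
rewrite lte_add_pinfty// lte_mul_pinfty//.
by apply: le_lt_trans (vK 0%N) _; rewrite ltry.
Unshelve. all: by end_near. Qed.

(** [integral_mul_le] with l = 1 / e makes both terms linear in e. *)
Lemma integral_mul_small f g (e : R) : 0 < e -> measurable_fun [set: R] f ->
  measurable_fun [set: R] g -> (sqn f <= (e ^+ 2)%:E)%E -> (sqn g < +oo)%E ->
  `|\int[mu]_x (f x * g x)| <= e * ((1 + fine (sqn g)) / 2).
Proof.
move=> e0 mf mg fe go.
have gf : sqn g \is a fin_num by rewrite ge0_fin_numE// sqn_ge0.
have fo : (sqn f < +oo)%E by apply: le_lt_trans fe (ltry _).
have ii := integrable_mul mf mg fo go.
have ei0 : 0 < e^-1 by rewrite invr_gt0.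
rewrite -lee_fin -abse_EFin /Rintegral fineK; last exact: integrable_fin_num.
apply: le_trans (le_abse_integral _ _ (measurable_int _ ii)) _ => //.
apply: le_trans (integral_mul_le ei0 mf mg) _; rewrite invrK.
apply: (@le_trans _ _ ((e^-1 / 2)%:E * (e ^+ 2)%:E + (e / 2)%:E * (fine (sqn g))%:E)%E).
  by rewrite fineK// leeD2r// lee_wpmul2l// lee_fin divr_ge0// ltW.
rewrite -!EFinM -EFinD lee_fin le_eqVlt; apply/orP; left; apply/eqP; field.
by rewrite gt_eqF.
Qed.

Lemma L2_duality_limit u v f g : measurable_fun [set: R] u -> measurable_fun [set: R] v ->
  measurable_fun [set: R] f -> measurable_fun [set: R] g ->
  (sqn u < +oo)%E -> (sqn v < +oo)%E -> (sqn f < +oo)%E -> (sqn g < +oo)%E ->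
  (forall e : R, 0 < e -> exists U V : R -> R, [/\ measurable_fun [set: R] U, measurable_fun [set: R] V,
     (sqn (fun x => U x - u x)%R <= (e ^+ 2)%:E)%E, (sqn (fun x => V x - v x)%R <= (e ^+ 2)%:E)%E &
     \int[mu]_x (V x * f x) = \int[mu]_x (U x * g x)]) ->
  \int[mu]_x (v x * f x) = \int[mu]_x (u x * g x).
Proof.
move=> mu_ mv mf mg uo vo fo go H; apply/eqP; rewrite -subr_eq0 -normr_le0.
set X := _ - _; pose A := (1 + fine (sqn f)) / 2 + (1 + fine (sqn g)) / 2.
have f0 : 0 <= fine (sqn f) by rewrite fine_ge0// sqn_ge0.
have g0 : 0 <= fine (sqn g) by rewrite fine_ge0// sqn_ge0.
have A0 : 0 < A by rewrite /A; lra.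
apply/ler_addgt0Pr => e e0; rewrite add0r.
have eA : 0 < e / A by exact: divr_gt0.
have [U [V [mU mV Uu Vv UV]]] := H _ eA.
have diff (p q h : R -> R) : measurable_fun [set: R] p -> measurable_fun [set: R] q ->
    measurable_fun [set: R] h -> (sqn q < +oo)%E -> (sqn h < +oo)%E ->
    (sqn (fun x => p x - q x)%R <= ((e / A) ^+ 2)%:E)%E ->
    `|\int[mu]_x (p x * h x) - \int[mu]_x (q x * h x)| <= e / A * ((1 + fine (sqn h)) / 2).
  move=> mp mq mh qo ho pq.
  have mpq : measurable_fun [set: R] (fun x => p x - q x) by exact: measurable_funB.
  have po : (sqn p < +oo)%E.
    have -> : p = (fun x => (p x - q x) + q x) by apply/funext => x; ring.
    apply: le_lt_trans (sqnD mpq mq) _.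
    by rewrite lte_add_pinfty// lte_mul_pinfty//; apply: le_lt_trans pq (ltry _).
  have := integral_mul_small eA mpq mh pq ho.
  under eq_Rintegral do rewrite mulrBl.
  by rewrite RintegralB//; exact: integrable_mul.
have h1 := diff V v f mV mv mf vo fo Vv.
have h2 := diff U u g mU mu_ mg uo go Uu.
have -> : X = (\int[mu]_x (U x * g x) - \int[mu]_x (u x * g x)) -
    (\int[mu]_x (V x * f x) - \int[mu]_x (v x * f x)) by rewrite UV /X; ring.
apply: le_trans (ler_normB _ _) _; apply: le_trans (lerD h2 h1) _.
by rewrite -mulrDr [X in _ * X]addrC -/A divfK// gt_eqF.
Qed.

End L2Limits.

(** * From a finite seminorm to a weak derivative in L^2 *)

Section WeakExistence.
Context {R : realType}.
Local Notation mu := (@lebesgue_measure R).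
Implicit Types (u v f g r : R -> R) (t x y d : R).
Context (a s : R) (a0 : 0 < a) (a1 : a < 1) (s1 : `|s| = 1).
Local Notation k := (pker (- 1 - a)).

Let s1N : `|- s| = 1. Proof. by rewrite normrN. Qed.

Lemma marchaudB f g x : nice f -> nice g ->
  marchaud a s (fun y => f y - g y) x = marchaud a s f x - marchaud a s g x.
Proof.
move=> nf ng; rewrite /marchaud -RintegralB//; last 2 first.
- exact: marchaud_integrable.
- exact: marchaud_integrable.
by apply: eq_Rintegral => t _; ring.
Qed.

(** With the t-integral outside, adjointness is for each t the translation x -> x + s t. *)
Lemma marchaud_adjoint f g : nice f -> nice g ->
  (\int[mu]_x (f x * marchaud a s g x)%:E = \int[mu]_x (g x * marchaud a (- s) f x)%:E)%E.
Proof.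
move=> nf ng; have [mf fo _] := nf; have [mg go _] := ng.
rewrite (marchaud_duality a0 a1 s1 mf fo ng) (marchaud_duality a0 a1 s1N mg go nf).
have sh (h : R -> R) (c : R) : measurable_fun [set: R] h -> measurable_fun [set: R] (fun x => h (x - c)).
  by move=> mh; apply: (measurableT_comp mh); exact: measurable_funB.
have so (h : R -> R) (c : R) : measurable_fun [set: R] h -> (sqn h < +oo)%E ->
    (sqn (fun x => h (x - c)%R) < +oo)%E.
  by move=> mh ho; rewrite sqn_shift.
apply: eq_integral => t _; congr (_ * _)%E.
under eq_integral do rewrite mulrBr EFinB.
rewrite integralB//; last 2 first.
- exact: integrable_mul.
- by apply: integrable_mul => //; [exact: sh|exact: so].
under [RHS]eq_integral do rewrite mulrBr EFinB.
rewrite integralB//; last 2 first.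
- exact: integrable_mul.
- by apply: integrable_mul => //; [exact: sh|exact: so].
congr (_ - _)%E; first by apply: eq_integral => x _; rewrite mulrC.
have ii : mu.-integrable [set: R] (fun x => (f x * g (x - s * t))%:E).
  by apply: integrable_mul => //; [exact: sh|exact: so].
have := integral_affine (s * t) (oner_neq0 R) ii; rewrite normr1 invr1 mul1e => <-.
apply: eq_integral => x _; rewrite mul1r addrK mulrC; congr (_ * f _)%:E; ring.
Qed.

Lemma gagliardo_weak_marchaud u : measurable_fun [set: R] u -> (sqn u < +oo)%E ->
  (gagliardo a u < +oo)%E ->
  exists v, [/\ measurable_fun [set: R] v, (sqn v < +oo)%E & weak_marchaud a s u v].
Proof.
move=> mu_ uo go.
have e8 j : 0 < (8^-1 : R) ^+ j by rewrite exprn_gt0.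
(* The rate 8^(-j) is the one that [L2_limit] consumes. *)
have [U UP] := choice (fun j => conv_approx a0 mu_ uo go (e8 j)).
have nU j : nice (U j) by have [] := UP j.
have mU j : measurable_fun [set: R] (U j) by have [] := nU j.
pose V j x := fracD_cst a * marchaud a s (U j) x.
have mV j : measurable_fun [set: R] (V j).
  by apply: measurable_funM => //; exact: measurable_marchaud.
have cc0 := core_cst_gt0 a0 a1.
have VK j m : (sqn (fun x => V j x - V m x)%R <=
    (2 * core_cst a * (8^-1 ^+ j + 8^-1 ^+ m))%:E)%E.
  rewrite (_ : (fun x => _) = (fun x => fracD_cst a * marchaud a s (fun y => U j y - U m y) x)).
    2: by apply/funext => x; rewrite marchaudB// mulrBr.
  rewrite sqn_fracD_marchaud//; last exact: niceB.
  rewrite (_ : 2 * core_cst a * (8^-1 ^+ j + 8^-1 ^+ m) =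
    core_cst a * (2 * 8^-1 ^+ j + 2 * 8^-1 ^+ m)); last by ring.
  rewrite [leRHS]EFinM; apply: lee_wpmul2l; first by rewrite lee_fin ltW.
  rewrite (_ : (fun y => U j y - U m y) = (fun y => (U j y - u y) - (U m y - u y))).
    2: by apply/funext => y; ring.
  apply: le_trans (gagliardoB _ _ _) _; [exact: measurable_funB|exact: measurable_funB|].
  have [_ _ Gj] := UP j; have [_ _ Gm] := UP m.
  apply: (@le_trans _ _ (2%:E * (8^-1 ^+ j)%:E + 2%:E * (8^-1 ^+ m)%:E)%E).
    by apply: leeD; apply: lee_wpmul2l; rewrite ?lee_fin.
  by rewrite -!EFinM -EFinD.
have V0 : (sqn (V 0%N) < +oo)%E.
  rewrite sqn_fracD_marchaud//; apply: lte_mul_pinfty; [by rewrite lee_fin ltW|by []|].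
  exact: nice_gagliardo_lty.
have K0 : 0 <= 2 * core_cst a by rewrite mulr_ge0// ltW.
have [v [mv vo Vv]] := L2_limit K0 mV V0 VK.
exists v; split => // phi tphi.
have nphi := lipc_nice (test_function_lipc tphi); have [mphi phio _] := nphi.
have mD : measurable_fun [set: R] (fun x => fracD_cst a * marchaud a (- s) phi x).
  by apply: measurable_funM => //; exact: measurable_marchaud.
have Do : (sqn (fun x => fracD_cst a * marchaud a (- s) phi x)%R < +oo)%E.
  rewrite sqnZ; last exact: measurable_marchaud.
  by rewrite lte_mul_pinfty ?lee_fin ?sqr_ge0//; exact: sqn_marchaud_lty.
suff : \int[mu]_x (v x * phi x) = \int[mu]_x (u x * (fracD_cst a * marchaud a (- s) phi x)).
  move=> vu; have := f_equal (@EFin R) vu; rewrite /Rintegral !fineK//.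
    by apply: integrable_fin_num => //; exact: integrable_mul.
  by apply: integrable_fin_num => //; exact: integrable_mul.
apply: L2_duality_limit => // e e0.
(* B dominates both error constants: 1 for [U j] and twice 2 [core_cst a] for [V j]. *)
pose B := 1 + 2 * (2 * core_cst a).
have B0 : 0 < B by rewrite /B; lra.
have [j je] : exists j, B * 8^-1 ^+ j <= e ^+ 2.
  have : (8^-1 : R) ^+ j @[j --> \oo] --> 0.
    by apply: cvg_expr; rewrite gtr0_norm ?invf_lt1 ?ltr1n// invr_gt0.
  move=> /(cvgr_lt _) /(_ (e ^+ 2 / B)) h; near \oo => j; exists j.
  rewrite mulrC -ler_pdivlMr// ltW//; near: j; apply: h.
  by rewrite divr_gt0// exprn_gt0.
exists (U j), (V j); split => //.
- have [_ h _] := UP j; apply: le_trans h _; rewrite lee_fin; apply: le_trans je.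
  by rewrite ler_peMl ?ltW// /B; lra.
- apply: le_trans (Vv j) _; rewrite lee_fin; apply: le_trans je.
  by rewrite ler_wpM2r ?ltW// /B; lra.
congr fine; transitivity ((fracD_cst a)%:E * \int[mu]_x (phi x * marchaud a s (U j) x)%:E)%E.
  rewrite -integralZl//; first by apply: eq_integral => x _; rewrite -EFinM /V mulrC mulrCA.
  apply: integrable_mul => //; [exact: measurable_marchaud|exact: sqn_marchaud_lty].
rewrite marchaud_adjoint// -integralZl//; first by apply: eq_integral => x _; rewrite -EFinM mulrCA.
have [_ Uo _] := nU j.
apply: integrable_mul => //; [exact: measurable_marchaud|exact: sqn_marchaud_lty].
Unshelve. all: by end_near. Qed.

End WeakExistence.

(** * Identification of the function spaces *)

Section Spaces.
Context {R : realType}.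
Local Notation mu := (@lebesgue_measure R).
Implicit Types (u v : R -> R) (t x y : R).

Lemma Lfun2P u : u \in Lfun mu 2%:E <-> measurable_fun [set: R] u /\ (sqn u < +oo)%E.
Proof.
split=> [uL|[mu_ uo]].
  split; last exact: integrable_lty (Lfun2_integrable_sqr uL).
  by move: uL; rewrite inE => /andP[]; rewrite inE.
rewrite inE; apply/andP; split; rewrite inE//= /finite_norm unlock /=.
rewrite poweR_lty//.
suff -> : (\int[mu]_x (`|(u x)%:E| `^ 2) = sqn u)%E by [].
by apply: eq_integral => x _; rewrite abse_EFin poweR_EFin powR_mulrn// real_normK// num_real.
Qed.

Context (a : R) (a0 : 0 < a) (a1 : a < 1).
Local Notation k2 := (pker (- 1 - 2 * a)).

(** Off the diagonal exactly one of the two half-line kernels is nonzero; on it the numerator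
    vanishes, whatever value the quotient is given. *)
Lemma gagliardo_kernelE u x y :
  `|u x - u y| ^+ 2 / `|x - y| `^ (1 + 2 * a) =
  (u x - u y) ^+ 2 * (k2 (x - y) + k2 (- (x - y))).
Proof.
rewrite real_normK ?num_real//; have [->|xy] := eqVneq x y.
  by rewrite subrr expr0n/= !mul0r.
have xy0 : x - y != 0 by rewrite subr_eq0.
rewrite -powRN opprD; congr (_ * _).
case: (ger0P (x - y)) => h.
  by rewrite pkerE ?lt_neqAle ?h 1?eq_sym ?xy0// pker0 ?addr0// oppr_le0.
by rewrite pker0 ?ltW// add0r pkerE// oppr_gt0.
Qed.

Lemma gagliardo_double u : measurable_fun [set: R] u ->
  (\int[mu]_x \int[mu]_y (`|u x - u y| ^+ 2 / `|x - y| `^ (1 + 2 * a))%:E =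
   2%:E * gagliardo a u)%E.
Proof.
move=> mu_; rewrite -gagliardo_symm//.
have mk : measurable_fun [set: R] (fun t => k2 t + k2 (- t)).
  apply: measurable_funD; first exact: measurable_pker.
  by apply: (measurableT_comp (measurable_pker _)); exact: measurable_funN.
have k0 t : 0 <= k2 t + k2 (- t) by rewrite addr_ge0// pker_ge0.
have m12 : measurable_fun [set: R * R] (fun p : R * R => p.1 - p.2).
  by apply: measurable_funB; [exact: measurable_fst|exact: measurable_snd].
transitivity (\int[mu]_x \int[mu]_t ((u x - u (x - t)%R) ^+ 2 * (k2 t + k2 (- t)))%:E)%E.
  apply: eq_integral => x _; under eq_integral do rewrite gagliardo_kernelE.
  have n0 : - 1 != 0 :> R by rewrite oppr_eq0 oner_eq0.
  have := ge0_integral_affine x n0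
    (f := fun y => ((u x - u y) ^+ 2 * (k2 (x - y) + k2 (- (x - y))))%:E).
  rewrite normrN1 invr1 mul1e => <-.
  - apply: eq_integral => t _; congr (_%:E).
    by rewrite (_ : -1 * t + x = x - t) ?subKr//; ring.
  - apply/measurable_EFinP; apply: measurable_funM.
      by apply: measurable_funX; exact: measurable_funB.
    by apply: (measurableT_comp mk); exact: measurable_funB.
  - by move=> y; rewrite lee_fin mulr_ge0// sqr_ge0.
rewrite (tonelli (F := fun x t => ((u x - u (x - t)%R) ^+ 2 * (k2 t + k2 (- t)))%:E)).
- apply: eq_integral => t _; rewrite muleC /energy /sqn.
  under eq_integral do rewrite EFinM.
  apply: ge0_integralZr; [exact: measurableT| |by move=> x _; rewrite lee_fin sqr_ge0|by rewrite lee_fin].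
  apply/measurable_EFinP; apply: measurable_funX; apply: measurable_funB => //.
  by apply: (measurableT_comp mu_); exact: measurable_funB.
- apply/measurable_EFinP; apply: measurable_funM; last exact: (measurableT_comp mk measurable_snd).
  apply: measurable_funX; apply: measurable_funB; first exact: (measurableT_comp mu_ measurable_fst).
  exact: (measurableT_comp mu_ m12).
- by move=> x t; rewrite lee_fin mulr_ge0// sqr_ge0.
Qed.

(** The tested operator D is abstract, so that one argument serves both spaces; a weak derivative in
    direction s is tested against direction -s. *)
Lemma fracH_gagliardoH (s : R) (D : (R -> R) -> R -> R) : `|s| = 1 ->
  (forall phi x, test_function phi -> D phi x = fracD_cst a * marchaud a (- s) phi x) ->
  [set u | u \in Lfun mu 2%:E /\ exists v,
     (locally_integrable [set: R] v /\ forall phi, test_function phi ->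
       \int[mu]_x (v x * phi x)%:E = \int[mu]_x (u x * D phi x)%:E)%E /\
     v \in Lfun mu 2%:E] = gagliardoH a.
Proof.
move=> s1 DE; have De u phi : test_function phi ->
    (\int[mu]_x (u x * D phi x)%:E =
     \int[mu]_x (u x * (fracD_cst a * marchaud a (- s) phi x))%:E)%E.
  by move=> tphi; apply: eq_integral => x _; rewrite DE.
apply/seteqP; split => u [uL].
  move=> [v [[_ vD] vL]]; split => //.
  have [mu_ uo] := (Lfun2P u).1 uL; have [mv vo] := (Lfun2P v).1 vL.
  rewrite gagliardo_double//; apply: lte_mul_pinfty => //.
  apply: (weak_marchaud_gagliardo a0 a1 s1 mu_ uo mv vo) => phi tphi.
  by rewrite vD// De.
have [mu_ uo] := (Lfun2P u).1 uL.
rewrite gagliardo_double// => go; split => //.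
have go' : (gagliardo a u < +oo)%E.
  apply: le_lt_trans go; rewrite -[leLHS]mul1e; apply: lee_wpmul2r; first exact: gagliardo_ge0.
  by rewrite lee_fin ler1n.
have [v [mv vo vD]] := gagliardo_weak_marchaud a0 a1 s1 mu_ uo go'.
exists v; split; last exact/Lfun2P.
split; first exact: sqn_locally_integrable.
by move=> phi tphi; rewrite De// vD.
Qed.

End Spaces.

Theorem theorem4p41 (R : realType) (a : R) (ha0 : 0 < a) (ha1 : a < 1) :
  left_fracH a = gagliardoH a /\ right_fracH a = gagliardoH a.
Proof.
split.
(* The left weak derivative has direction 1 and is tested against the right derivative, of direction
   -1. *)
- apply: (fracH_gagliardoH ha0 ha1 (s := 1) (D := right_fracD a)) => [|phi x tphi].
    exact: normr1.
  exact: right_fracDE.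
- apply: (fracH_gagliardoH ha0 ha1 (s := - 1) (D := left_fracD a)) => [|phi x tphi].
    exact: normrN1.
  by rewrite opprK; exact: left_fracDE.
Qed.
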